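(* Let $\Bbbk$ be an algebraically closed field. If $\mathcal H\subset\mathrm{Aut}(\mathbb A^n)$ is a connected solvable subgroup containing a torus $T$ of dimension $n$, then $\mathcal H$ is conjugate in $\mathrm{Aut}(\mathbb A^n)$ to a subgroup of $\mathrm{Jonq}(n)$.
   Context: $\Bbbk$ is an algebraically closed field of arbitrary characteristic; varieties and morphisms are over $\Bbbk$, and $\mathbb A^n$ is affine $n$-space. For a variety $X$, a map $\rho\colon A\to\mathrm{Aut}(X)$ from a variety $A$ is a morphism if $A\times X\to X$, $(a,x)\mapsto\rho(a)(x)$, is a morphism of varieties. A subgroup $G\subseteq\mathrm{Aut}(X)$ is connected if for every $g\in G$ there is a morphism $\rho\colon A\to\mathrm{Aut}(X)$ with $A$ irreducible, $\rho(A)\subseteq G$ and $\mathrm{id}_X,g\in\rho(A)$. A torus of dimension $s$ in $\mathrm{Aut}(X)$ is a subgroup which is the image of a faithful algebraic action of $(\mathbf G_m)^s$ on $X$ (i.e. an algebraic subgroup isomorphic to $(\mathbf G_m)^s$). $\mathrm{Jonq}(n)\subset\mathrm{Aut}(\mathbb A^n)$ is the group of automorphisms of the form $(x_1,\dots,x_n)\mapsto(a_1x_1+p_1,\,a_2x_2+p_2(x_1),\dots,a_nx_n+p_n(x_1,\dots,x_{n-1}))$ with $a_i\in\Bbbk^\times$, $p_1\in\Bbbk$ and $p_i\in\Bbbk[x_1,\dots,x_{i-1}]$ for $i\ge2$. *)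

(* Defs.v *)
From HB Require Import structures.
From mathcomp Require Import all_boot all_algebra.
From mathcomp Require Import boolp classical_sets functions topology_structure.
From mathcomp Require Import mpoly.

Set Implicit Arguments.
Unset Strict Implicit.
Unset Printing Implicit Defensive.

Import GRing.Theory.
Local Open Scope classical_set_scope.
Local Open Scope ring_scope.

(* Varieties over a field k are set up through "spaces with functions": a
   topological space together with, for each open U, a k-algebra of k-valued
   regular functions on U, forming a sheaf, such that the non-vanishing locus
   of a regular function is open and its inverse is regular there.  A function
   on U is encoded by any total function; [kreg_local] (which expresses
   restriction, extensionality on U and gluing at once) ensures that the values
   outside U are irrelevant.  [kreg U] is meaningful only for open U. *)
Record kspace (k : fieldType) := KSpace {
  kpt :> topologicalType;
  kreg : set kpt -> set (kpt -> k);
  kreg_local : forall (U : set kpt) (f : kpt -> k), open U ->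
    (forall x, U x -> exists (W : set kpt) (g : kpt -> k),
       [/\ open W, W x, kreg W g & forall y, U y -> W y -> f y = g y]) ->
    kreg U f;
  kreg_cst : forall (U : set kpt) (c : k), open U -> kreg U (fun=> c);
  kregD : forall (U : set kpt) (f g : kpt -> k), open U ->
    kreg U f -> kreg U g -> kreg U (fun x => f x + g x);
  kregM : forall (U : set kpt) (f g : kpt -> k), open U ->
    kreg U f -> kreg U g -> kreg U (fun x => f x * g x);
  kregV : forall (U : set kpt) (f : kpt -> k), open U -> kreg U f ->
    open (U `&` [set x | f x != 0]) /\
    kreg (U `&` [set x | f x != 0]) (fun x => (f x)^-1)
}.

Definition kmorphism (k : fieldType) (X Y : kspace k) (f : X -> Y) : Prop :=
  continuous f /\
  forall (V : set Y) (g : Y -> k), open V -> kreg V g ->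
    kreg (f @^-1` V) (g \o f).

Definition kisomorphic (k : fieldType) (X Y : kspace k) : Prop :=
  exists (f : X -> Y) (g : Y -> X),
    [/\ kmorphism f, kmorphism g, cancel f g & cancel g f].

(* The coarsest structure of space with functions on a set T in which, for every
   pair (D, f) with G D f, the set D is open and f is regular on D.  Affine
   space, induced structures and products are all of this form. *)
Section Generated.
Variables (k : fieldType) (T : choiceType) (G : set T -> set (T -> k)).

Inductive gen_alg : set T -> (T -> k) -> Prop :=
| GenBase D f : G D f -> gen_alg D f
| GenCst c : gen_alg setT (fun=> c)
| GenAdd D D' f g : gen_alg D f -> gen_alg D' g ->
    gen_alg (D `&` D') (fun x => f x + g x)
| GenMul D D' f g : gen_alg D f -> gen_alg D' g ->
    gen_alg (D `&` D') (fun x => f x * g x).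

Definition gen_open : set (set T) := [set U | forall x, U x ->
  exists D s, [/\ gen_alg D s, D x, s x != 0 &
                 forall y, D y -> s y != 0 -> U y]].

Definition gen_reg (U : set T) : set (T -> k) := [set f | forall x, U x ->
  exists D a s, [/\ gen_alg D a, gen_alg D s, D x, s x != 0 &
                   forall y, U y -> D y -> s y != 0 -> f y = a y / s y]].

Definition gen_carrier : Type := T.

HB.instance Definition _ := Choice.on gen_carrier.

Lemma gen_openT : gen_open setT.
Proof.
by move=> x _; exists setT, (fun=> 1); split; rewrite ?oner_eq0 //; exact: GenCst.
Qed.

Lemma gen_openI : setI_closed gen_open.
Proof.
move=> A B oA oB x [Ax Bx].
have [D [s [hs Dx sx sA]]] := oA _ Ax; have [E [t [ht Ex tx tB]]] := oB _ Bx.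
exists (D `&` E), (fun y => s y * t y); split=> //; first exact: GenMul.
  by rewrite mulf_neq0.
move=> y [Dy Ey]; rewrite mulf_eq0 negb_or => /andP[sy ty].
by split; [exact: sA | exact: tB].
Qed.

Lemma gen_open_bigU (I : Type) (F : I -> set T) :
  (forall i, gen_open (F i)) -> gen_open (\bigcup_i F i).
Proof.
move=> oF x [i _ Fx]; have [D [s [hs Dx sx sF]]] := oF i _ Fx.
by exists D, s; split=> // y Dy sy; exists i => //; exact: sF.
Qed.

HB.instance Definition _ := isOpenTopological.Build gen_carrier
  gen_openT gen_openI gen_open_bigU.

Lemma gen_openP (U : set gen_carrier) : open U <-> gen_open U.
Proof. by []. Qed.

Lemma gen_alg_open D f : gen_alg D f ->
  open ((D `&` [set x | f x != 0]) : set gen_carrier).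
Proof. by move=> h; apply/gen_openP => x [Dx fx]; exists D, f. Qed.

Lemma gen_alg_open_dom D f : gen_alg D f -> open (D : set gen_carrier).
Proof.
move=> h; apply/gen_openP => x Dx.
exists (D `&` setT `&` setT), (fun x => f x * 0 + 1); split=> //.
- exact: (GenAdd (GenMul h (GenCst 0)) (GenCst 1)).
- by rewrite mulr0 add0r oner_eq0.
- by move=> y [[]].
Qed.

Lemma gen_alg_restr D E f g : gen_alg D f -> gen_alg E g ->
  gen_alg (D `&` E) f.
Proof.
move=> hf hg; have := GenAdd hf (GenMul hg (GenCst 0)).
rewrite setIT; congr gen_alg.
by apply/funext => x; rewrite mulr0 addr0.
Qed.

Lemma gen_reg_local (U : set gen_carrier) (f : gen_carrier -> k) : open U ->
  (forall x, U x -> exists (W : set gen_carrier) (g : gen_carrier -> k),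
     [/\ open W, W x, gen_reg W g & forall y, U y -> W y -> f y = g y]) ->
  gen_reg U f.
Proof.
move=> _ h x Ux; have [W [g [/gen_openP oW Wx rg fg]]] := h x Ux.
have [D [a [s [ha hs Dx sx E]]]] := rg _ Wx.
have [D' [t [ht D'x tx sW]]] := oW _ Wx.
exists (D `&` D'), (fun y => a y * t y), (fun y => s y * t y); split=> //.
- exact: GenMul.
- exact: GenMul.
- by rewrite mulf_neq0.
move=> y Uy [Dy D'y]; rewrite mulf_eq0 negb_or => /andP[sy ty].
have Wy := sW _ D'y ty.
by rewrite fg // E // -mulf_div divff // mulr1.
Qed.

Lemma gen_reg_cst (U : set gen_carrier) (c : k) : open U ->
  gen_reg U (fun=> c).
Proof.
move=> _ x Ux; exists setT, (fun=> c), (fun=> 1).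
by split; rewrite ?oner_eq0 //; [exact: GenCst | exact: GenCst | move=> *; rewrite divr1].
Qed.

Lemma gen_regD (U : set gen_carrier) (f g : gen_carrier -> k) : open U ->
  gen_reg U f -> gen_reg U g -> gen_reg U (fun x => f x + g x).
Proof.
move=> _ rf rg x Ux.
have [D [a [s [ha hs Dx sx E]]]] := rf _ Ux.
have [D' [b [t [hb ht D'x tx E']]]] := rg _ Ux.
exists (D `&` D'), (fun y => a y * t y + b y * s y), (fun y => s y * t y).
split=> //.
- rewrite -[D `&` D']setIid; apply: GenAdd; first exact: GenMul.
  by rewrite setIC; exact: GenMul.
- exact: GenMul.
- by rewrite mulf_neq0.
move=> y Uy [Dy D'y]; rewrite mulf_eq0 negb_or => /andP[sy ty].
by rewrite E // E' // addf_div.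
Qed.

Lemma gen_regM (U : set gen_carrier) (f g : gen_carrier -> k) : open U ->
  gen_reg U f -> gen_reg U g -> gen_reg U (fun x => f x * g x).
Proof.
move=> _ rf rg x Ux.
have [D [a [s [ha hs Dx sx E]]]] := rf _ Ux.
have [D' [b [t [hb ht D'x tx E']]]] := rg _ Ux.
exists (D `&` D'), (fun y => a y * b y), (fun y => s y * t y).
split=> //; [exact: GenMul | exact: GenMul | by rewrite mulf_neq0 |].
move=> y Uy [Dy D'y]; rewrite mulf_eq0 negb_or => /andP[sy ty].
by rewrite E // E' // mulf_div.
Qed.

Lemma gen_regV (U : set gen_carrier) (f : gen_carrier -> k) : open U ->
  gen_reg U f ->
  open (U `&` [set x | f x != 0]) /\
  gen_reg (U `&` [set x | f x != 0]) (fun x => (f x)^-1).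
Proof.
move=> /gen_openP oU rf.
have key x : (U `&` [set x | f x != 0]) x -> exists D a s,
    [/\ gen_alg D a, gen_alg D s, D x, a x * s x != 0 &
      forall y, D y -> a y * s y != 0 -> U y /\ f y = a y / s y].
  move=> [Ux /= fx]; have [D [a [s [ha hs Dx sx E]]]] := rf _ Ux.
  have [D' [t [ht D'x tx tU]]] := oU _ Ux.
  have ax : a x != 0.
    by apply: contra_neq fx; rewrite E // => ->; rewrite mul0r.
  exists (D `&` D'), (fun y => a y * t y), (fun y => s y * t y); split=> //.
  - exact: GenMul.
  - exact: GenMul.
  - by rewrite !mulf_neq0.
  move=> y [Dy D'y]; rewrite !mulf_eq0 !negb_or => /andP[/andP[ay ty] /andP[sy _]].
  have Uy := tU _ D'y ty; split=> //.
  by rewrite E // -mulf_div divff // mulr1.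
split.
  apply/gen_openP => x /key[D [a [s [ha hs Dx asx h]]]].
  exists D, (fun y => a y * s y); split=> //.
    by rewrite -[D]setIid; exact: GenMul.
  move=> y Dy asy; have [Uy fy] := h _ Dy asy; split=> //=.
  move: asy; rewrite fy mulf_eq0 negb_or => /andP[ay sy].
  by rewrite mulf_neq0 ?invr_neq0.
move=> x /key[D [a [s [ha hs Dx asx h]]]].
exists D, (fun y => s y * s y), (fun y => a y * s y); split=> //.
- by rewrite -[D]setIid; exact: GenMul.
- by rewrite -[D]setIid; exact: GenMul.
move=> y _ Dy asy; have [_ ->] := h _ Dy asy.
move: asy; rewrite mulf_eq0 negb_or => /andP[ay sy].
by rewrite invf_div -mulf_div divff // mulr1.
Qed.

Definition gen_kspace : kspace k :=
  KSpace gen_reg_local gen_reg_cst gen_regD gen_regM gen_regV.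

End Generated.

(* The points of A^n are the finite functions 'I_n -> k; closed sets are the
   zero loci of polynomials, regular functions are locally quotients p / q. *)
Definition affine_space (k : fieldType) (n : nat) : kspace k :=
  @gen_kspace k {ffun 'I_n -> k}
    (fun D f => D = setT /\ exists p : {mpoly k[n]}, f = fun x => p.@[x]).

(* A subset S of X with its induced structure: relatively open sets, and
   functions which locally extend to regular functions on X. *)
Definition sub_kspace (k : fieldType) (X : kspace k) (S : set X) : kspace k :=
  @gen_kspace k (set_type S)
    (fun D f => exists (U : set X) (g : X -> k),
       [/\ open U, kreg U g, D = val @^-1` U & f = g \o val]).

(* The product in the category of spaces with functions. *)
Definition prod_kspace (k : fieldType) (X Y : kspace k) : kspace k :=
  @gen_kspace k (X * Y)%type
    (fun D f =>
       (exists (U : set X) (g : X -> k),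
          [/\ open U, kreg U g, D = fst @^-1` U & f = g \o fst]) \/
       (exists (V : set Y) (g : Y -> k),
          [/\ open V, kreg V g, D = snd @^-1` V & f = g \o snd])).

Definition affine_variety (k : fieldType) (X : kspace k) : Prop :=
  exists (N : nat) (Z : set (affine_space k N)),
    closed Z /\ kisomorphic X (sub_kspace Z).

Definition separated (k : fieldType) (X : kspace k) : Prop :=
  closed [set p : prod_kspace X X | p.1 = p.2].

(* Not assumed irreducible. *)
Definition variety (k : fieldType) (X : kspace k) : Prop :=
  separated X /\
  exists (m : nat) (U : 'I_m -> set X),
    [/\ forall i, open (U i),
        forall i, affine_variety (sub_kspace (U i)) &
        \bigcup_i U i = setT].

Definition irreducible (X : topologicalType) : Prop :=
  [set: X] !=set0 /\
  forall C D : set X, closed C -> closed D ->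
    C `|` D = setT -> C = setT \/ D = setT.

Lemma kmorphism_id (k : fieldType) (X : kspace k) : kmorphism (@id X).
Proof. by split=> // x; exact: cvg_id. Qed.

Lemma kmorphism_comp (k : fieldType) (X Y Z : kspace k) (f : X -> Y) (g : Y -> Z) :
  kmorphism f -> kmorphism g -> kmorphism (g \o f).
Proof.
move=> [cf rf] [cg rg]; split.
  by move=> x; exact: (continuous_comp (cf x) (cg (f x))).
move=> V h oV rh; have /continuousP cg' := cg.
exact: (rf (g @^-1` V) (h \o g) (cg' _ oV) (rg _ _ oV rh)).
Qed.

Section Automorphisms.
Variables (k : fieldType) (X : kspace k).

Record aut := Aut {
  aut_fun :> X -> X;
  autP : kmorphism aut_fun /\
         exists g : X -> X, [/\ kmorphism g, cancel aut_fun g & cancel g aut_fun]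
}.

HB.instance Definition _ := gen_eqMixin aut.
HB.instance Definition _ := gen_choiceMixin aut.

Lemma aut_inj (f g : aut) : (forall x, f x = g x) -> f = g.
Proof.
case: f g => [f fP] [g gP] /= /funext fg; rewrite fg in fP *.
by congr Aut; exact: Prop_irrelevance.
Qed.

Lemma aut_one_subproof : kmorphism (@id X) /\
  exists g : X -> X, [/\ kmorphism g, cancel id g & cancel g id].
Proof.
split; first exact: kmorphism_id.
by exists id; split=> //; exact: kmorphism_id.
Qed.

Definition aut_one : aut := Aut aut_one_subproof.

Lemma aut_mul_subproof (f g : aut) : kmorphism (f \o g) /\
  exists h : X -> X, [/\ kmorphism h, cancel (f \o g) h & cancel h (f \o g)].
Proof.
case: f g => [f [mf [f' [mf' fK f'K]]]] [g [mg [g' [mg' gK g'K]]]] /=.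
split; first exact: kmorphism_comp.
exists (g' \o f'); split; first exact: kmorphism_comp.
- exact: can_comp.
- exact: can_comp.
Qed.

Definition aut_mul (f g : aut) : aut := Aut (aut_mul_subproof f g).

Definition aut_inv_fun (f : aut) : X -> X := projT1 (cid (autP f).2).

Lemma aut_inv_funP (f : aut) :
  [/\ kmorphism (aut_inv_fun f), cancel f (aut_inv_fun f) &
      cancel (aut_inv_fun f) f].
Proof. exact: projT2 (cid (autP f).2). Qed.

Lemma aut_inv_subproof (f : aut) : kmorphism (aut_inv_fun f) /\
  exists g : X -> X,
    [/\ kmorphism g, cancel (aut_inv_fun f) g & cancel g (aut_inv_fun f)].
Proof.
have [mg fK gK] := aut_inv_funP f; split=> //.
by exists f; split=> //; exact: (autP f).1.
Qed.

Definition aut_inv (f : aut) : aut := Aut (aut_inv_subproof f).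

Lemma aut_invK (f : aut) : cancel (aut_inv f) f.
Proof. by have [] := aut_inv_funP f. Qed.

Lemma autK (f : aut) : cancel f (aut_inv f).
Proof. by have [] := aut_inv_funP f. Qed.

Lemma aut_mulA : associative aut_mul.
Proof. by move=> f g h; exact: aut_inj. Qed.
Lemma aut_mul1 : left_id aut_one aut_mul.
Proof. by move=> f; exact: aut_inj. Qed.
Lemma aut_mulr1 : right_id aut_one aut_mul.
Proof. by move=> f; exact: aut_inj. Qed.
Lemma aut_mulV : left_inverse aut_one aut_inv aut_mul.
Proof. by move=> f; apply: aut_inj => x; exact: autK. Qed.
Lemma aut_mulrV : right_inverse aut_one aut_inv aut_mul.
Proof. by move=> f; apply: aut_inj => x; exact: aut_invK. Qed.

(* The product is composition: (f * g) x = f (g x). *)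
HB.instance Definition _ := isGroup.Build aut
  aut_mulA aut_mul1 aut_mulr1 aut_mulV aut_mulrV.

End Automorphisms.

Definition aut_family (k : fieldType) (X A : kspace k) (rho : A -> aut X) : Prop :=
  @kmorphism k (prod_kspace A X) X (fun p => rho p.1 p.2).

Section AbstractGroups.
Variable gT : groupType.
Local Open Scope group_scope.

Definition is_subgroup (H : set gT) : Prop := group_closed (mem H).

Definition derived (H : set gT) : set gT :=
  smallest is_subgroup [set [~ x, y] | x in H & y in H].

Definition solvable_subgroup (H : set gT) : Prop :=
  is_subgroup H /\ exists m : nat, iter m derived H = [set 1].

End AbstractGroups.

Definition connected_subgroup (k : fieldType) (X : kspace k) (H : set (aut X)) :
    Prop :=
  is_subgroup H /\
  forall g, H g -> exists (A : kspace k) (rho : A -> aut X),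
    [/\ variety A, irreducible A, aut_family rho & range rho `<=` H] /\
    [/\ range rho 1%g & range rho g].

(* (G_m)^s, as an open subvariety of A^s with coordinatewise multiplication. *)
Definition Gm_set (k : fieldType) (s : nat) : set (affine_space k s) :=
  [set a : {ffun 'I_s -> k} | forall i, a i != 0].

Definition Gm (k : fieldType) (s : nat) : kspace k := sub_kspace (@Gm_set k s).

Definition Gm_coord (k : fieldType) (s : nat) (a : Gm k s) : {ffun 'I_s -> k} :=
  val (a : set_type (@Gm_set k s)).

Lemma Gm_coord_neq0 (k : fieldType) (s : nat) (a : Gm k s) (i : 'I_s) :
  Gm_coord a i != 0.
Proof. by rewrite /Gm_coord; case: a => a /= /set_mem; apply. Qed.

Lemma Gm_mul_subproof (k : fieldType) (s : nat) (a b : Gm k s) :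
  [ffun i => Gm_coord a i * Gm_coord b i] \in @Gm_set k s.
Proof. by apply/mem_set => i; rewrite ffunE mulf_neq0 ?Gm_coord_neq0. Qed.

Definition Gm_mul (k : fieldType) (s : nat) (a b : Gm k s) : Gm k s :=
  exist (fun x => x \in @Gm_set k s) _ (Gm_mul_subproof a b).

Definition is_torus (k : fieldType) (X : kspace k) (s : nat) (T : set (aut X)) :
    Prop :=
  exists phi : Gm k s -> aut X,
    [/\ aut_family phi,
        forall a b, phi (Gm_mul a b) = (phi a * phi b)%g,
        injective phi &
        T = range phi].

(* With indices starting at 0, the i-th polynomial has the i variables x_j,
   j < i. *)
Definition Jonq (k : fieldType) (n : nat) : set (aut (affine_space k n)) :=
  [set f | exists (a : 'I_n -> k) (p : forall i : 'I_n, {mpoly k[i]}),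
     (forall i, a i != 0) /\
     forall (x : {ffun 'I_n -> k}) (i : 'I_n),
       (f x : {ffun 'I_n -> k}) i =
       a i * x i + (p i).@[fun j : 'I_i => x (widen_ord (ltnW (ltn_ord i)) j)]].

(* Main.v *)
(* A torus of dimension [n] is conjugate to the diagonal one: the weight spaces of
   [k[x]] are lines, because [n] variables leave no room for [n + 1] independent
   elements. Hence the weights form a pointed monoid, evaluating the weight-zero
   component gives a fixed point, and weight vectors whose differentials at that
   point form a basis of the cotangent space generate [k[x]] multiplicatively, so
   they are coordinates.

   Let now [M] be connected, solvable and normalized by the diagonal torus, and
   write [j -> i] if the [i]-th coordinate of some element of [M] involves [x_j].
   Genericity in the torus excludes cancellations in compositions, so this relation
   is transitive. If it has no cycle of length two, then each coordinate of each
   element is [a x_i + p] with [p] in the predecessors of [i], and sorting the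
   variables yields triangular automorphisms. Cycles are excluded by induction on
   the derived length: the derived group has none, so some vertex [i2] of a cycle
   [i1 -> i2 -> i1] of [M] has all its predecessors for the derived group in the set
   [B] of its strict predecessors for [M], and every commutator acts on [x_i2] by
   [a x_i2 + r (x_B)]. Conjugating one of two generic elements by the one-parameter
   subgroup scaling [x_i1] and comparing the powers of the parameter in their
   commutation relation shows that modulo [x_i1] their coordinates become
   polynomials in [x_B], which contradicts genericity.

   Genericity in [M] is where connectedness enters. It passes to the derived group
   because the inverses in a family of automorphisms again form a family: their
   degrees are bounded by a dimension count, and their coefficients are then given
   by Cramer's rule. *)

Require Import Defs.
From HB Require Import structures.
From mathcomp Require Import all_boot all_algebra.
From mathcomp Require Import boolp classical_sets functions topology_structure.
From mathcomp Require Import mpoly.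
From mathcomp Require Import zify ring.

Set Implicit Arguments.
Unset Strict Implicit.
Unset Printing Implicit Defensive.

Import GRing.Theory.
Local Open Scope classical_set_scope.
Local Open Scope ring_scope.

(** * Regular functions are polynomials *)

(** [Aut(A^n)] is infinite-dimensional and the characteristic is arbitrary, so neither the structure
    theory of algebraic groups nor derivations are at hand: all arguments concern supports of
    polynomials. Conjugation by a generic diagonal [t] keeps supports visible, because distinct
    monomials [m] acquire distinct factors [t^m]. Connectedness supplies one group element with
    several prescribed coefficients nonzero: each coefficient is a regular function on an
    irreducible parameter space and is nonzero somewhere, hence so is their product. This explains
    the form of a family, bounded degree plus regular values at each point: its coefficients are
    then fixed linear combinations of finitely many values, hence regular.

    In the scaling argument, the exponents that can occur in the commutation relation form a window
    whose width is the largest exponent [e] of [x_i1] in one coordinate. A monomial attaining [e]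
    pins down one end of the window, and all others are measured against it. *)

Lemma radix_inj (K n : nat) (a b : nat -> nat) :
  (forall i, i < n -> a i < K)%N -> (forall i, i < n -> b i < K)%N ->
  (\sum_(i < n) a i * K ^ i = \sum_(i < n) b i * K ^ i)%N ->
  forall i, (i < n)%N -> a i = b i.
Proof.
elim: n a b => [|n IH] a b ha hb //.
rewrite !big_ord_recl /= !expn0 !muln1.
have E (c : nat -> nat) : (\sum_(i < n) c (bump 0 i) * K ^ bump 0 i =
    (\sum_(i < n) c i.+1 * K ^ i) * K)%N.
  by rewrite big_distrl /=; apply: eq_bigr => i _; rewrite /bump /= add1n expnSr mulnA.
rewrite !E => e.
have Kgt0 : (0 < K)%N by apply: leq_ltn_trans (ha 0%N _).
have h0 : a 0%N = b 0%N.
  have /(congr1 (modn^~ K)) := e; rewrite ![(a _ + _)%N]addnC ![(b _ + _)%N]addnC !modnMDl.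
  by rewrite !modn_small ?ha ?hb.
move: e; rewrite h0 => /addnI /eqP; rewrite eqn_pmul2r // => /eqP e.
move=> [|i] // lti.
by apply: (IH (fun i => a i.+1) (fun i => b i.+1)) => // j ltj; [apply: ha | apply: hb].
Qed.

Section MpolyField.
Variable (k : closedFieldType).

Section OneMany.
Variable n : nat.
Implicit Types (p q : {mpoly k[n]}) (v : {ffun 'I_n -> k}).

(* Kronecker substitution [x_i = s ^ (K ^ i)] reduces to one variable. *)
Lemma mpoly_nonroot p : p != 0 ->
  exists v, (forall i, v i != 0) /\ p.@[v] != 0.
Proof.
move=> pn0; pose K := msize p.
pose e (m : 'X_{1..n}) : nat := (\sum_(i < n) m i * K ^ i)%N.
have mK m i : m \in msupp p -> (m i < K)%N.
  move=> /msize_mdeg_lt; apply: leq_ltn_trans.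
  by rewrite mdegE (bigD1 i) //= leq_addr.
have einj : {in msupp p &, injective e}.
  move=> m m' hm hm' em; apply/mnmP => i.
  pose A (m : 'X_{1..n}) j := (nth 0 m j)%N.
  have AE (l : 'X_{1..n}) (j : 'I_n) : A l j = l j by rewrite /A -mnm_nth.
  have AK l : l \in msupp p -> forall j, (j < n)%N -> (A l j < K)%N.
    by move=> hl j ltj; rewrite -[j]/(val (Ordinal ltj)) AE mK.
  have := radix_inj (AK _ hm) (AK _ hm').
  have -> : (\sum_(i < n) A m i * K ^ i)%N = e m by apply: eq_bigr => j _; rewrite AE.
  have -> : (\sum_(i < n) A m' i * K ^ i)%N = e m' by apply: eq_bigr => j _; rewrite AE.
  by move=> /(_ em i (ltn_ord i)); rewrite !AE.
pose P : {poly k} := \sum_(m <- msupp p) p@_m *: 'X^(e m).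
have Pn0 : P != 0.
  have hm := mlead_supp pn0; apply: contraTneq hm => P0.
  rewrite mcoeff_msupp negbK -[X in _ == X](coef0 _ (e (mlead p))) -P0.
  rewrite coef_sum (bigD1_seq (mlead p)) ?mlead_supp ?msupp_uniq //=.
  rewrite coefZ coefXn eqxx mulr1 big_seq_cond big1 ?addr0 // => m /andP[hm nm].
  rewrite coefZ coefXn; case: eqP; rewrite ?mulr0 // => E.
  by move: nm; rewrite (einj _ _ _ _ E) ?eqxx ?mlead_supp.
(* The factor ['X] also makes [s], hence every coordinate of the point, nonzero. *)
have [s] : exists s, ~~ root (P * 'X) s by apply/closed_nonrootP; rewrite mulf_neq0 ?polyX_eq0.
rewrite rootM negb_or !rootE hornerX => /andP[rs s0].
exists [ffun i => s ^+ (K ^ (nat_of_ord i))]; split.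
  by move=> i; rewrite ffunE expf_neq0.
apply: contraNneq rs => p0; rewrite -p0 /P mevalE.
rewrite horner_sum; apply/eqP/eq_bigr => m _.
rewrite hornerZ hornerXn; congr (_ * _); rewrite /e -prodrXr.
by apply: eq_bigr => i _; rewrite ffunE mulnC exprM.
Qed.

Lemma meval_inj p q : (forall v, p.@[v] = q.@[v]) -> p = q.
Proof.
move=> E; apply/eqP; rewrite -subr_eq0; apply/negP => /negP /mpoly_nonroot[v [_]].
by rewrite mevalB E subrr eqxx.
Qed.

Lemma meval_inj_dense w p q : w != 0 ->
  (forall v, w.@[v] != 0 -> p.@[v] = q.@[v]) -> p = q.
Proof.
move=> w0 E; apply/(mulIf w0)/meval_inj => v; rewrite !mevalM.
by have [->|/E ->] := eqVneq w.@[v] 0; rewrite ?mulr0.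
Qed.

End OneMany.

End MpolyField.

Section Univariate.
Variable (k : closedFieldType).

Lemma distinct_nodes (D : nat) : exists s : seq k,
  [/\ uniq s, size s = D & forall x, x \in s -> x != 0].
Proof.
elim: D => [|D [s [us ss s0]]]; first by exists [::].
have [x] : exists x, ~~ root ('X * \prod_(z <- s) ('X - z%:P)) x.
  apply/closed_nonrootP; rewrite mulf_neq0 ?polyX_eq0 //.
  by rewrite monic_neq0 // monic_prod_XsubC.
rewrite rootM negb_or root_prod_XsubC rootE hornerX => /andP[x0 xs].
exists (x :: s); split; rewrite /= ?xs ?us ?ss // => y.
by rewrite inE => /orP[/eqP->|/s0].
Qed.

(** Lagrange interpolation, at nonzero nodes so that it also serves the punctured line. *)
Lemma interpolation (D : nat) : exists (s : 'I_D -> k) (L : 'I_D -> {poly k}),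
  (forall c, s c != 0) /\
  forall r : {poly k}, (size r <= D)%N -> r = \sum_c r.[s c] *: L c.
Proof.
have [s [us ss s0]] := distinct_nodes D.
have nth_s (c : 'I_D) : nth 0 s c \in s by rewrite mem_nth ?ss.
pose L (c : 'I_D) : {poly k} := \prod_(d < D | d != c)
   ((nth 0 s c - nth 0 s d)^-1 *: ('X - (nth 0 s d)%:P)).
exists (fun c => nth 0 s c), L; split=> [c|r hr]; first exact: s0.
have LE (c d : 'I_D) : (L c).[nth 0 s d] = (d == c)%:R.
  rewrite horner_prod; have [->|ne] := eqVneq d c.
    rewrite big1 // => i ic; rewrite hornerZ hornerXsubC mulVf // subr_eq0.
    by rewrite nth_uniq ?ss // eq_sym.
  by rewrite (bigD1 d) //= hornerZ hornerXsubC subrr mulr0 mul0r.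
apply/eqP; rewrite -subr_eq0; apply/eqP.
apply: (@roots_geq_poly_eq0 _ _ s) => //; last first.
  rewrite ss (leq_trans (size_polyD _ _)) // geq_max hr size_polyN.
  apply: (leq_trans (size_sum _ _ _)); apply/bigmax_leqP => c _.
  apply: (leq_trans (size_scale_leq _ _)).
  apply: (leq_trans (size_prod_leq _ _)).
  have : (\sum_(d < D | d != c) size (((nth 0 s c - nth 0 s d)^-1 *: ('X - (nth 0 s d)%:P))%R : {poly k})
     <= \sum_(d < D | d != c) 2)%N.
    apply: leq_sum => d _; apply: (leq_trans (size_scale_leq _ _)).
    by rewrite size_XsubC.
  have E : #|[pred d : 'I_D | d != c]| = D.-1 by rewrite -[D in RHS]card_ord -(cardC1 c).
  rewrite sum_nat_const E; have := ltn_ord c.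
  by move: (\sum_(d < D | d != c) _)%N => S; lia.
apply/allP => x /(nthP 0)[i]; rewrite ss => lti <-.
rewrite rootE hornerD hornerN horner_sum (bigD1 (Ordinal lti)) //= hornerZ.
rewrite (LE _ (Ordinal lti)) eqxx mulr1 big1 ?addr0 ?subrr // => c nc.
by rewrite hornerZ (LE _ (Ordinal lti)) eq_sym (negPf nc) mulr0.
Qed.

(* The flag [e] selects the line ([e = 0]) or the punctured line ([e = 1]). *)
Lemma univariate_regular (e : bool) (f : k -> k) (M N : nat) (p0 q0 : {poly k}) :
  (forall s, s ^+ e != 0 -> exists p q : {poly k}, q.[s] != 0 /\
     forall y, y ^+ e != 0 -> f y * q.[y] = p.[y]) ->
  q0 != 0 -> (forall y, y ^+ e != 0 -> f y * q0.[y] = p0.[y]) ->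
  (size p0 <= M)%N -> (size q0 <= N)%N ->
  exists2 r : {poly k}, (size r <= M + (N + e * N))%N &
    forall y, y ^+ e != 0 -> f y * y ^+ (e * N) = r.[y].
Proof.
move=> floc q00 f0 sp0 sq0.
(* A denominator [q] of least size divides every other denominator [q'], since [q' %% q] is again
   one. At each point of the domain some [q'] is nonzero, so [q] has no root there. *)
pose good d := `[< exists p q : {poly k}, [/\ q != 0, size q = d &
    forall y, y ^+ e != 0 -> f y * q.[y] = p.[y]] >].
have exg : exists d, good d by exists (size q0); apply/asboolP; exists p0, q0.
case: (ex_minnP exg) => d /asboolP [p [q [qn0 sq fq]]] dmin.
have small (p' q' : {poly k}) : (size q' < d)%N ->
    (forall y, y ^+ e != 0 -> f y * q'.[y] = p'.[y]) -> q' = 0.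
  move=> lt fq'; apply/eqP; apply: contraTT lt => q'n0; rewrite -leqNgt.
  by apply: dmin; apply/asboolP; exists p', q'.
have roots_q z : root q z -> z ^+ e = 0.
  move=> qz; apply/eqP; apply/negPn/negP => /floc[p' [q' [q'z fq']]].
  have E := divp_eq q' q.
  have r0 : q' %% q = 0.
    apply: (small (p' - p * (q' %/ q))); first by rewrite -sq ltn_modp.
    move=> y hy; have -> : q' %% q = q' - (q' %/ q) * q by rewrite {2}E addrC addKr.
    rewrite !(hornerD, hornerN, hornerM) mulrBr fq' // -fq //.
    by ring.
  move: q'z; rewrite E r0 addr0 hornerM; rewrite /root in qz.
  by rewrite (eqP qz) mulr0 eqxx.
have [rs qE] := closed_field_poly_normal q.
have lq0 : lead_coef q != 0 by rewrite lead_coef_eq0.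
have rs0 z : z \in rs -> z ^+ e = 0.
  move=> zrs; apply: roots_q; rewrite qE rootZ //.
  by rewrite root_prod_XsubC.
have qX y : y ^+ e != 0 -> q.[y] = lead_coef q * y ^+ (e * size rs).
  move=> hy; rewrite {1}qE hornerZ horner_prod; congr (_ * _).
  case: e rs0 {f0 floc exg dmin good fq small roots_q hy} => rs0.
    rewrite mul1n; elim: (rs) rs0 => [|z t IH] rs0; first by rewrite big_nil.
    rewrite big_cons IH => [|x xt]; last by apply: rs0; rewrite inE xt orbT.
    by have := rs0 z (mem_head _ _); rewrite expr1 => ->; rewrite hornerXsubC subr0 exprS.
  case: (rs) rs0 => [|z t] rs0; first by rewrite big_nil.
  by have /eqP := rs0 z (mem_head _ _); rewrite expr0 oner_eq0.
have sqN : (d <= N)%N.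
  by apply: leq_trans sq0; apply: dmin; apply/asboolP; exists p0, q0.
have srs : size q = (size rs).+1.
  by rewrite {1}qE size_scale // size_prod_XsubC.
(* This identity bounds the size of [p] by those of [p0] and [q0], hence uniformly over all
   coordinate lines. *)
have pE : p * q0 = p0 * q.
  apply/eqP; rewrite -subr_eq0; apply/negPn/negP => nz.
  have [y] : exists y, ~~ root ((p * q0 - p0 * q) * 'X) y.
    by apply/closed_nonrootP; rewrite mulf_neq0 ?polyX_eq0.
  rewrite rootM negb_or !rootE hornerX => /andP[+ y0].
  have ye : y ^+ e != 0 by rewrite expf_neq0.
  by rewrite hornerD hornerN !hornerM -fq // -f0 // mulrAC subrr eqxx.
have sp : (size p <= M + N)%N.
  have [->|pn0] := eqVneq p 0; first by rewrite size_poly0.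
  have p0n0 : p0 != 0.
    by apply: contraTneq (mulf_neq0 pn0 q00) => z; rewrite pE z mul0r eqxx.
  have := congr1 (fun r : {poly k} => size r) pE.
  rewrite !size_mul // => E.
  have q0gt : (0 < size q0)%N by rewrite size_poly_gt0.
  have qgt : (0 < size q)%N by rewrite size_poly_gt0.
  move: E q0gt qgt sp0 sq0; rewrite sq; move: sqN.
  move: (size p) (size q0) (size p0) => a b c; clear; lia.
exists ((lead_coef q)^-1 *: (p * 'X^(e * (N - size rs)))).
  apply: (leq_trans (size_scale_leq _ _)).
  apply: (leq_trans (size_polyMleq _ _)); rewrite size_polyXn.
  move: sp; move: (size p) (size rs) => a b; clear; case: e; lia.
move=> y hy; rewrite hornerZ hornerM hornerXn -fq // qX //.
have -> : (e * N = e * size rs + e * (N - size rs))%N.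
  by rewrite -mulnDr subnKC //; move: sqN; rewrite -sq srs; move: (size rs) => b; clear; lia.
by rewrite exprD; field.
Qed.
End Univariate.

Definition compm (R : comNzRingType) (n l : nat) (g : 'I_n -> {mpoly R[l]})
  (p : {mpoly R[n]}) : {mpoly R[l]} := p \mPo [tuple g i | i < n].

Lemma compmE (R : comNzRingType) (n l : nat) (g : 'I_n -> {mpoly R[l]}) p v :
  (compm g p).@[v] = p.@[fun i => (g i).@[v]].
Proof.
by rewrite /compm comp_mpoly_meval; apply: meval_eq => i; rewrite tnth_mktuple.
Qed.

Section Multivariate.
Variables (k : closedFieldType) (n : nat) (e : bool).
Local Notation pt := {ffun 'I_n -> k}.
Implicit Types (x y : pt) (f : pt -> k) (p q : {mpoly k[n]}) (j : 'I_n).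

(* [A^n] for [e = false], the open subset where no coordinate vanishes for
   [e = true]. *)
Definition chart : set pt := [set x | forall i, x i ^+ e != 0].

Definition chart_poly : {mpoly k[n]} := \prod_i 'X_i ^+ e.

Lemma chart_polyE x : chart x <-> chart_poly.@[x] != 0.
Proof.
rewrite /chart_poly rmorph_prod /=; split=> [h|/prodf_neq0 h i].
  by apply/prodf_neq0 => i _; rewrite rmorphXn /= mevalXU; exact: h.
by have := h i isT; rewrite rmorphXn /= mevalXU.
Qed.

Lemma chart_poly_neq0 : chart_poly != 0.
Proof.
apply/prodf_neq0 => i _; rewrite expf_neq0 // -(msize_poly_eq0 'X_i) msizeX.
by [].
Qed.

Definition locally_rational f := forall x, chart x -> exists p q,
  q.@[x] != 0 /\ forall y, chart y -> q.@[y] != 0 -> f y = p.@[y] / q.@[y].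

Definition pregular f := forall x, chart x -> exists p q,
  q.@[x] != 0 /\ forall y, chart y -> f y * q.@[y] = p.@[y].

(** Two local fractions for [f] agree where both denominators are nonzero, hence as rational
    functions. So [f * q = p] persists at the zeros of [q]. *)
Lemma locally_rationalP f : locally_rational f -> pregular f.
Proof.
move=> hf x cx; have [p [q [qx fq]]] := hf x cx; exists p, q; split=> // y cy.
have [p1 [q1 [q1y fq1]]] := hf y cy.
have q0 : q != 0 by apply: contraNneq qx => ->; rewrite meval0.
have q10 : q1 != 0 by apply: contraNneq q1y => ->; rewrite meval0.
have E : p * q1 = p1 * q.
  apply: (@meval_inj_dense _ _ (q * q1 * chart_poly)).
    by rewrite !mulf_neq0 // chart_poly_neq0.
  move=> v; rewrite !mevalM !mulf_eq0 !negb_or => /andP[/andP[qv q1v]].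
  move=> /chart_polyE cv; have := fq v cv qv; rewrite (fq1 v cv q1v) => E.
  by rewrite -[p1.@[_]](divfK q1v) E; field.
apply: (mulIf q1y); rewrite fq1 // mulrAC divfK // -!mevalM.
by rewrite E.
Qed.

Lemma pregular_dense f w : w != 0 -> pregular f ->
  (forall x, chart x -> w.@[x] != 0 -> f x = 0) -> forall x, chart x -> f x = 0.
Proof.
move=> w0 hf fw x cx; have [p [q [qx fq]]] := hf x cx.
suff p0 : p = 0.
  by apply: (mulIf qx); rewrite fq // p0 meval0 mul0r.
apply: (@meval_inj_dense _ _ (w * chart_poly)).
  by rewrite mulf_neq0 // chart_poly_neq0.
move=> v; rewrite mevalM mulf_eq0 negb_or => /andP[wv /chart_polyE cv].
by rewrite -fq // fw // mul0r meval0.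
Qed.

Lemma pregularD f g : pregular f -> pregular g -> pregular (fun x => f x + g x).
Proof.
move=> hf hg x cx; have [p [q [qx fq]]] := hf x cx.
have [p' [q' [qx' fq']]] := hg x cx; exists (p * q' + p' * q), (q * q').
split=> [|y cy]; first by rewrite mevalM mulf_neq0.
by rewrite mevalD !mevalM -fq // -fq' //; ring.
Qed.

Lemma pregularMp f p : pregular f -> pregular (fun x => p.@[x] * f x).
Proof.
move=> hf x cx; have [p' [q [qx fq]]] := hf x cx; exists (p * p'), q.
by split=> // y cy; rewrite mevalM -fq // mulrA.
Qed.

Lemma pregular0 : pregular (fun=> 0).
Proof.
move=> x cx; exists 0, 1; rewrite meval1 oner_neq0; split=> // y _.
by rewrite mul0r meval0.
Qed.

Lemma pregular_sum (I : Type) (r : seq I) (F : I -> pt -> k) :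
  (forall i, pregular (F i)) -> pregular (fun x => \sum_(i <- r) F i x).
Proof.
move=> hF; elim: r => [|i r IH].
  by rewrite (_ : (fun x => _) = fun=> 0); [exact: pregular0 | apply/funext => x; rewrite big_nil].
rewrite (_ : (fun x => _) = fun x => F i x + \sum_(i <- r) F i x).
  exact: pregularD.
by apply/funext => x; rewrite big_cons.
Qed.

Definition upd x j (s : k) : pt := [ffun i => if i == j then s else x i].

Lemma upd_chart x j s : chart x -> s ^+ e != 0 -> chart (upd x j s).
Proof. by move=> cx hs i; rewrite ffunE; case: ifP. Qed.

Lemma pregular_upd f j s : s ^+ e != 0 -> pregular f ->
  pregular (fun x => f (upd x j s)).
Proof.
move=> hs hf x cx; have [p [q [qx fq]]] := hf _ (upd_chart j cx hs).
pose g i : {mpoly k[n]} := if i == j then s%:MP else 'X_i.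
have gE r y : (compm g r).@[y] = r.@[upd y j s].
  rewrite compmE; apply: meval_eq => i; rewrite /g ffunE.
  by case: ifP => _; rewrite ?mevalC ?mevalXU.
exists (compm g p), (compm g q); rewrite gE; split=> // y cy.
by rewrite !gE fq //; exact: upd_chart.
Qed.

Lemma line_poly p x j : exists2 P : {poly k}, (size P <= msize p)%N &
  forall s, P.[s] = p.@[upd x j s].
Proof.
pose E i : {poly k} := if i == j then 'X else (x i)%:P.
exists (\sum_(m <- msupp p) p@_m *: \prod_i E i ^+ m i).
  rewrite big_seq; apply: (leq_trans (size_sum _ _ _)).
  apply/bigmax_leqP_seq => m _ hm; apply: (leq_trans (size_scale_leq _ _)).
  rewrite (bigD1 j) //= {1}/E eqxx.
  have [c ->] : exists c : k, \prod_(i | i != j) E i ^+ m i = c%:P.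
    exists (\prod_(i | i != j) x i ^+ m i); rewrite rmorph_prod /=.
    by apply: eq_bigr => i /negPf ij; rewrite /E ij rmorphXn.
  apply: (leq_trans (size_polyMleq _ _)); rewrite size_polyXn.
  have := size_polyC_leq1 c; have := msize_mdeg_lt hm.
  by rewrite mdegE (bigD1 j) //=; move: (size _) => a; lia.
move=> s; rewrite mevalE horner_sum; apply: eq_bigr => m _.
rewrite hornerZ horner_prod; congr (_ * _); apply: eq_bigr => i _.
by rewrite horner_exp /E ffunE; case: ifP; rewrite ?hornerX ?hornerC.
Qed.

Definition lift_poly (P : {poly k}) j : {mpoly k[n]} :=
  \sum_(i < size P) P`_i *: 'X_j ^+ i.

Lemma lift_polyE P j x : (lift_poly P j).@[x] = P.[x j].
Proof.
rewrite horner_coef raddf_sum; apply: eq_bigr => i _.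
by rewrite /= mevalZ rmorphXn /= mevalXU.
Qed.

Lemma chart1 : chart [ffun=> 1].
Proof. by move=> i; rewrite ffunE expr1n oner_neq0. Qed.

(** On a coordinate line through a point where [q0] is nonzero, [f] times a power of the coordinate
    is a polynomial of size at most [D]. As [D] is the same for all lines, fixed nodes determine it.
    Both sides of the formula are regular, so it extends to the chart by density. *)
Lemma interpolate_coordinate f : pregular f ->
  exists (N D : nat) (s : 'I_D -> k) (L : 'I_D -> {poly k}),
  (forall c, s c ^+ e != 0) /\ forall x j, chart x ->
    f x * x j ^+ (e * N) = \sum_c s c ^+ (e * N) * (L c).[x j] * f (upd x j (s c)).
Proof.
move=> hf; have [p0 [q0 [q01 fq0]]] := hf _ chart1.
pose N := msize q0; pose D := (msize p0 + (N + e * N))%N.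
have [s [L [s0 LE]]] := interpolation k D.
exists N, D, s, L; split=> [c|x j]; first by rewrite expf_neq0.
have q0n0 : q0 != 0 by apply: contraNneq q01 => ->; rewrite meval0.
pose h y := f y * y j ^+ (e * N)
  - \sum_c s c ^+ (e * N) * (L c).[y j] * f (upd y j (s c)).
have sc c : s c ^+ e != 0 by rewrite expf_neq0.
suff H y : chart y -> h y = 0.
  by move=> cx; apply/eqP; rewrite -subr_eq0; apply/eqP/(H x).
apply: (@pregular_dense _ q0) => //.
  apply: pregularD.
    rewrite (_ : (fun y => _) = fun y => ('X_j ^+ (e * N)).@[y] * f y).
      exact: pregularMp.
    by apply/funext => z; rewrite rmorphXn /= mevalXU mulrC.
  rewrite (_ : (fun y => _) = fun y => (-1)%:MP.@[y] * \sum_c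
     (s c ^+ (e * N) *: lift_poly (L c) j).@[y] * f (upd y j (s c))).
    apply: pregularMp; apply: pregular_sum => c.
    apply: pregularMp; exact: pregular_upd.
  apply/funext => z; rewrite mevalC mulN1r; congr (- _); apply: eq_bigr => c _.
  by rewrite mevalZ lift_polyE.
move=> z cz q0z; rewrite /h.
have [P0 sP0 P0E] := line_poly p0 z j; have [Q0 sQ0 Q0E] := line_poly q0 z j.
have zE : upd z j (z j) = z.
  by apply/ffunP => i; rewrite ffunE; case: eqP => [->|].
have [] := @univariate_regular k e (fun t => f (upd z j t)) (msize p0) N P0 Q0 _ _ _ sP0 sQ0.
- move=> t ht; have [p [q [qx fq]]] := hf _ (upd_chart j cz ht).
  have [P _ PE] := line_poly p z j; have [Q _ QE] := line_poly q z j.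
  exists P, Q; rewrite QE; split=> // u hu; rewrite QE PE.
  by apply: fq; exact: upd_chart.
- by apply: contraNneq q0z => Q00; have := Q0E (z j); rewrite zE Q00 horner0 => <-.
- by move=> u hu; rewrite Q0E P0E; apply: fq0; exact: upd_chart.
move=> r sr rE; have cj := cz j; have := rE _ cj; rewrite zE => ->.
rewrite {1}(LE r sr) horner_sum -sumrB big1 // => c _.
rewrite hornerZ -rE //; move: (f _) (s c ^+ _) _.[_] => a b d.
by clear; ring.
Qed.

Definition upds (js : seq 'I_n) (v x : pt) : pt :=
  [ffun i => if i \in js then v i else x i].

(** Each interpolation freezes one more coordinate of the argument of [f] at fixed values. Once [js]
    lists all coordinates, the values of [f] are constants and only polynomials remain. *)
Lemma interpolate_coordinates f : pregular f -> exists N : nat,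
  forall js, uniq js -> exists2 l : seq ({mpoly k[n]} * pt),
    (forall c, c \in l -> chart c.2) & forall x, chart x ->
      f x * (\prod_(j <- js) x j) ^+ (e * N) =
      \sum_(c <- l) c.1.@[x] * f (upds js c.2 x).
Proof.
move=> hf; have [N [D [s [L [sc E]]]]] := interpolate_coordinate hf.
exists N; elim=> [|j js IH] /= => [_|/andP[jjs ujs]].
  exists [:: (1, [ffun=> 1])]; first by move=> c; rewrite inE => /eqP->; exact: chart1.
  move=> x cx; rewrite big_nil expr1n mulr1 big_seq1 meval1 mul1r.
  by congr f; apply/ffunP => i; rewrite ffunE.
have [l lc lE] := IH ujs.
exists [seq (c.1 * (s d ^+ (e * N) *: lift_poly (L d) j), upd c.2 j (s d)) |
          c <- l, d <- enum 'I_D].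
  by move=> c /allpairsP[[a d] /= [al _ ->]] /=; apply: upd_chart => //; exact: lc.
move=> x cx; rewrite big_cons exprMn mulrCA mulrC lE // big_distrl /=.
rewrite big_allpairs_dep /= big_seq [RHS]big_seq; apply: eq_bigr => c cl.
have cu : chart (upds js c.2 x) by move=> i; rewrite ffunE; case: ifP => _; [exact: lc|exact: cx].
rewrite -mulrA; have -> : x j = upds js c.2 x j by rewrite ffunE (negPf jjs).
rewrite E // big_enum /= big_distrr /=; apply: eq_bigr => d _.
rewrite mevalM mevalZ lift_polyE -!mulrA; do 2!congr (_ * _).
rewrite ffunE (negPf jjs); congr (_ * f _); apply/ffunP => i; rewrite !ffunE inE.
by case: (eqVneq i j) => //= ->.
Qed.

Lemma pregular_poly f : pregular f -> exists (N : nat) p,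
  forall x, chart x -> f x * (\prod_j x j) ^+ (e * N) = p.@[x].
Proof.
move=> /interpolate_coordinates [N /(_ _ (enum_uniq 'I_n)) [l lc lE]].
exists N, (\sum_(c <- l) f c.2 *: c.1) => x cx.
rewrite -big_enum lE // raddf_sum; apply: eq_bigr => c _.
rewrite /= mevalZ mulrC; congr (f _ * _); apply/ffunP => i.
by rewrite ffunE mem_enum.
Qed.

End Multivariate.

(** * Morphisms into generated spaces, and algebras of functions *)

Section Generated.
Variables (k : fieldType) (T : choiceType) (G : set T -> set (T -> k)).

Lemma gen_kreg_base D f : G D f -> @kreg k (gen_kspace G) D f.
Proof.
move=> h x Dx; exists D, f, (fun=> 1); split=> //; rewrite ?oner_eq0 //.
- exact: GenBase.
- by rewrite -(setTI D); exact: gen_alg_restr (GenCst G 1) (GenBase h).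
- by move=> y *; rewrite divr1.
Qed.

(** Sums, products and local quotients preserve regularity of pullbacks, so generators suffice. *)
Lemma gen_kmorphism (Y : kspace k) (h : Y -> gen_kspace G) :
  (forall D f, G D f -> open (h @^-1` D) /\ kreg (h @^-1` D) (f \o h)) ->
  kmorphism h.
Proof.
move=> hG.
have alg D f : gen_alg G D f -> open (h @^-1` D) /\ kreg (h @^-1` D) (f \o h).
  elim=> {D f} [D f /hG//|c|D D' f g _ [oD rf] _ [oD' rg]|D D' f g _ [oD rf] _ [oD' rg]].
  - by split; [exact: openT | apply: kreg_cst; exact: openT].
  - have o : open (h @^-1` (D `&` D')) by exact: openI.
    split=> //; apply: kregD => //; apply: kreg_local => // x [Dx D'x].
      by exists (h @^-1` D), (f \o h).
    by exists (h @^-1` D'), (g \o h).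
  - have o : open (h @^-1` (D `&` D')) by exact: openI.
    split=> //; apply: kregM => //; apply: kreg_local => // x [Dx D'x].
      by exists (h @^-1` D), (f \o h).
    by exists (h @^-1` D'), (g \o h).
have cont : continuous h.
  apply/continuousP => U oU.
  have -> : h @^-1` U = \bigcup_(W in [set W | open W /\ W `<=` h @^-1` U]) W.
    apply/seteqP; split=> [x Ux|x [W [_ WU] Wx]]; last exact: WU.
    have [D [s [hs Dx sx sU]]] := oU _ Ux.
    have [oD rs] := alg _ _ hs; have [o _] := kregV oD rs.
    exists (h @^-1` D `&` [set y | (s \o h) y != 0]) => //.
    by split=> // y [Dy sy]; exact: sU.
  by apply: bigcup_open => W [].
split=> // V g oV rg; apply: kreg_local.
  by apply: open_comp => // x _; exact: cont.
move=> x Vx; have [D [a [s [ha hs Dx sx E]]]] := rg _ Vx.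
have [oDa ra] := alg _ _ ha; have [oDs rs] := alg _ _ hs.
have [o rV] := kregV oDs rs.
exists (h @^-1` V `&` (h @^-1` D `&` [set y | (s \o h) y != 0])),
  (fun y => (a \o h) y * ((s \o h) y)^-1).
have oo : open (h @^-1` V `&` (h @^-1` D `&` [set y | (s \o h) y != 0])).
  by apply: openI => //; apply: open_comp => // z _; exact: cont.
split=> //.
  apply: kregM => //; apply: kreg_local => // y [Vy [Dy sy]].
    by exists (h @^-1` D), (a \o h).
  exists (h @^-1` D `&` [set y | (s \o h) y != 0]),
    (fun y => ((s \o h) y)^-1); split=> //.
by move=> y _ [Vy [Dy sy]]; exact: E.
Qed.

End Generated.

Definition subalgebra (k : fieldType) (A : Type) (F : set (A -> k)) : Prop :=
  [/\ forall c, F (fun=> c), forall f g, F f -> F g -> F (fun a => f a + g a) &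
      forall f g, F f -> F g -> F (fun a => f a * g a)].

Section Subalgebra.
Variables (k : fieldType) (A : Type) (F : set (A -> k)).
Hypothesis FA : subalgebra F.

Lemma subalgebra_sum (I : Type) (r : seq I) (P : pred I) (f : I -> A -> k) :
  (forall i, F (f i)) -> F (fun a => \sum_(i <- r | P i) f i a).
Proof.
case: FA => FC FD FM Ff; elim: r => [|i r IH].
  by rewrite (_ : (fun a => _) = fun=> 0) //; apply/funext => a; rewrite big_nil.
have [Pi|nPi] := boolP (P i); last first.
  rewrite (_ : (fun a => _) = fun a => \sum_(i <- r | P i) f i a) //.
  by apply/funext => a; rewrite big_cons (negPf nPi).
rewrite (_ : (fun a => _) = fun a => f i a + \sum_(i <- r | P i) f i a); first exact: FD.
by apply/funext => a; rewrite big_cons Pi.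
Qed.

Lemma subalgebra_prod (I : Type) (r : seq I) (P : pred I) (f : I -> A -> k) :
  (forall i, F (f i)) -> F (fun a => \prod_(i <- r | P i) f i a).
Proof.
case: FA => FC FD FM Ff; elim: r => [|i r IH].
  by rewrite (_ : (fun a => _) = fun=> 1) //; apply/funext => a; rewrite big_nil.
have [Pi|nPi] := boolP (P i); last first.
  rewrite (_ : (fun a => _) = fun a => \prod_(i <- r | P i) f i a) //.
  by apply/funext => a; rewrite big_cons (negPf nPi).
rewrite (_ : (fun a => _) = fun a => f i a * \prod_(i <- r | P i) f i a); first exact: FM.
by apply/funext => a; rewrite big_cons Pi.
Qed.

Lemma subalgebra_exp f m : F f -> F (fun a => f a ^+ m).
Proof.
move=> Ff; rewrite (_ : (fun a => _) = fun a => \prod_(i < m) f a).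
  exact: subalgebra_prod.
by apply/funext => a; rewrite prodr_const card_ord.
Qed.

Lemma subalgebra_meval (n : nat) (h : A -> {ffun 'I_n -> k}) (p : {mpoly k[n]}) :
  (forall i, F (fun a => h a i)) -> F (fun a => p.@[h a]).
Proof.
case: FA => FC FD FM Fh.
rewrite (_ : (fun a => _) = fun a => \sum_(m <- msupp p) p@_m * \prod_i h a i ^+ m i).
  apply: subalgebra_sum => m; apply: FM => //; apply: subalgebra_prod => i.
  exact: subalgebra_exp.
by apply/funext => a; rewrite mevalE.
Qed.

Lemma subalgebra_det (r : nat) (M : A -> 'M[k]_r) :
  (forall i j, F (fun a => M a i j)) -> F (fun a => \det (M a)).
Proof.
case: FA => FC FD FM FMij; rewrite /determinant.
apply: subalgebra_sum => s; apply: FM => //; exact: subalgebra_prod.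
Qed.

End Subalgebra.

(** * Polynomial coordinates of automorphisms; regular functions on the torus *)

Section Affine.
Variables (k : closedFieldType) (n : nat).
Local Notation A := (affine_space k n).
Local Notation pt := {ffun 'I_n -> k}.

Lemma affine_alg D (f : pt -> k) :
  gen_alg (fun D f => D = setT /\ exists p : {mpoly k[n]}, f = fun x : pt => p.@[x]) D f ->
  D = setT /\ exists p : {mpoly k[n]}, f = fun x : pt => p.@[x].
Proof.
elim=> {D f} [D f //|c|D D' f g _ [-> [p ->]] _ [-> [q ->]]|D D' f g _ [-> [p ->]] _ [-> [q ->]]].
- by split=> //; exists c%:MP; apply/funext => x; rewrite mevalC.
- by rewrite setIT; split=> //; exists (p + q); apply/funext => x; rewrite mevalD.
- by rewrite setIT; split=> //; exists (p * q); apply/funext => x; rewrite mevalM.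
Qed.

Lemma affine_poly_reg (p : {mpoly k[n]}) : @kreg k A setT (fun x : pt => p.@[x]).
Proof. by apply: gen_kreg_base; split=> //; exists p. Qed.

Lemma affine_reg_local (U : set A) (g : A -> k) (x : pt) : open U -> kreg U g -> U x ->
  exists p q : {mpoly k[n]}, q.@[x] != 0 /\
    forall y : pt, q.@[y] != 0 -> U y /\ g y = p.@[y] / q.@[y].
Proof.
move=> oU rg Ux; have [D [s [hs _ sx sU]]] := oU _ Ux.
have [D' [a [t [ha ht _ tx E]]]] := rg _ Ux.
have [DT [r rE]] := affine_alg hs; have [D'T [p pE]] := affine_alg ha.
have [_ [q qE]] := affine_alg ht; subst.
exists (p * r), (q * r); rewrite mevalM mulf_neq0 //; split=> // y.
rewrite !mevalM mulf_eq0 negb_or => /andP[qy ry].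
have Uy : U y by exact: sU.
by split=> //; rewrite E // -mulf_div divff // mulr1.
Qed.

Lemma affine_reg_poly (f : A -> k) : kreg setT f ->
  exists p : {mpoly k[n]}, forall x : pt, f x = p.@[x].
Proof.
move=> rf; have : @pregular k n false f.
  apply: locally_rationalP => x _.
  have [p [q [qx E]]] := affine_reg_local (x := x) openT rf I.
  by exists p, q; split=> // y _ /E[].
move=> /pregular_poly[N [p pE]]; exists p => x.
by rewrite -pE ?mul0n ?expr0 ?mulr1 // => i; rewrite expr0 oner_eq0.
Qed.

Lemma affine_kmorphism (Y : kspace k) (h : Y -> A) :
  (forall i, kreg setT (fun y => (h y : pt) i)) -> kmorphism h.
Proof.
move=> hc; apply: gen_kmorphism => D f [-> [p ->]]; rewrite preimage_setT.
split; first exact: openT.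
apply: (@subalgebra_meval k Y (kreg setT) _ n h p) => //; split.
- by move=> c; apply: kreg_cst; exact: openT.
- by move=> u v; apply: kregD; exact: openT.
- by move=> u v; apply: kregM; exact: openT.
Qed.

Lemma affine_coord_reg (Y : kspace k) (h : Y -> A) i : kmorphism h ->
  kreg setT (fun y => (h y : pt) i).
Proof.
move=> [_ /(_ setT (fun x : pt => ('X_i : {mpoly k[n]}).@[x]) openT (affine_poly_reg _))].
rewrite preimage_setT; congr kreg; apply/funext => y /=.
by rewrite mevalXU.
Qed.

Lemma poly_kmorphism (P : 'I_n -> {mpoly k[n]}) :
  @kmorphism k A A (fun x : pt => [ffun i => (P i).@[x]]).
Proof.
apply: affine_kmorphism => i; rewrite (_ : (fun y => _) = fun y : pt => (P i).@[y]).
  exact: affine_poly_reg.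
by apply/funext => y; rewrite ffunE.
Qed.

Lemma aut_poly (f : aut A) : exists P : 'I_n -> {mpoly k[n]},
  forall (x : pt) i, (f x : pt) i = (P i).@[x].
Proof.
have h i : exists p : {mpoly k[n]}, forall x : pt, (f x : pt) i = p.@[x].
  apply: affine_reg_poly; apply: affine_coord_reg.
  exact: (autP f).1.
by have [P hP] := choice h; exists P.
Qed.

Definition autp (f : aut A) : 'I_n -> {mpoly k[n]} := projT1 (cid (aut_poly f)).

Lemma autpE (f : aut A) (x : pt) i : (f x : pt) i = (autp f i).@[x].
Proof. exact: (projT2 (cid (aut_poly f))). Qed.

Lemma autp_unique (f : aut A) (P : 'I_n -> {mpoly k[n]}) :
  (forall (x : pt) i, (f x : pt) i = (P i).@[x]) -> autp f = P.
Proof.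
by move=> h; apply/funext => i; apply: meval_inj => x; rewrite -autpE h.
Qed.

Lemma autp1 : autp 1%g = fun i => 'X_i.
Proof. by apply: autp_unique => x i; rewrite mevalXU. Qed.

Lemma autpM (f g : aut A) : autp (f * g)%g = fun i => compm (autp g) (autp f i).
Proof.
apply: autp_unique => x i; rewrite compmE; transitivity ((f (g x) : pt) i) => //.
by rewrite autpE; apply: meval_eq => j; rewrite autpE.
Qed.

Lemma aut_ext (f g : aut A) : (forall i, autp f i = autp g i) -> f = g.
Proof. by move=> h; apply: aut_inj => x; apply/ffunP => i; rewrite !autpE h. Qed.

Lemma aut_of_polys (P Q : 'I_n -> {mpoly k[n]}) :
  (forall i, compm Q (P i) = 'X_i) -> (forall i, compm P (Q i) = 'X_i) ->
  exists f : aut A, autp f = P.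
Proof.
move=> PQ QP; unshelve eexists.
  apply: (@Aut k A (fun x : pt => [ffun i => (P i).@[x]])); split.
    exact: poly_kmorphism.
  exists (fun x : pt => [ffun i => (Q i).@[x]]); split; first exact: poly_kmorphism.
    move=> x; apply/ffunP => i; rewrite ffunE.
    have := congr1 (meval x) (QP i); rewrite compmE mevalXU => <-.
    by apply: meval_eq => j; rewrite ffunE.
  move=> x; apply/ffunP => i; rewrite ffunE.
  have := congr1 (meval x) (PQ i); rewrite compmE mevalXU => <-.
  by apply: meval_eq => j; rewrite ffunE.
by apply: autp_unique => x i; rewrite /= ffunE.
Qed.

Lemma Gm_alg_local D (s : Gm k n -> k) :
  gen_alg (fun (D : set (set_type (@Gm_set k n))) f =>
    exists (U : set A) (g : A -> k), [/\ open U, kreg U g, D = val @^-1` U & f = g \o val]) D s ->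
  forall x, D x -> exists p q : {mpoly k[n]}, q.@[Gm_coord x] != 0 /\
    forall y, q.@[Gm_coord y] != 0 -> D y /\ s y = p.@[Gm_coord y] / q.@[Gm_coord y].
Proof.
elim=> {D s} [D s [U [g [oU rg -> ->]]] x Ux|c x _|D D' s t _ IH _ IH' x [Dx D'x]|D D' s t _ IH _ IH' x [Dx D'x]].
- have [p [q [qx E]]] := affine_reg_local oU rg Ux.
  by exists p, q; split=> // y /E.
- exists c%:MP, 1; rewrite meval1 oner_neq0; split=> // y _.
  by rewrite mevalC meval1 divr1.
- have [p [q [qx E]]] := IH _ Dx; have [p' [q' [qx' E']]] := IH' _ D'x.
  exists (p * q' + p' * q), (q * q'); rewrite mevalM mulf_neq0 //; split=> // y.
  rewrite mevalD !mevalM mulf_eq0 negb_or => /andP[qy qy'].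
  have [Dy ->] := E y qy; have [D'y ->] := E' y qy'.
  by split=> //; rewrite addf_div.
- have [p [q [qx E]]] := IH _ Dx; have [p' [q' [qx' E']]] := IH' _ D'x.
  exists (p * p'), (q * q'); rewrite mevalM mulf_neq0 //; split=> // y.
  rewrite !mevalM mulf_eq0 negb_or => /andP[qy qy'].
  have [Dy ->] := E y qy; have [D'y ->] := E' y qy'.
  by split=> //; rewrite mulf_div.
Qed.

Lemma Gm_open_poly (U : set (Gm k n)) : open U -> U !=set0 ->
  exists2 w : {mpoly k[n]}, w != 0 & forall y, w.@[Gm_coord y] != 0 -> U y.
Proof.
move=> oU [x Ux]; have [D [s [hs Dx sx sU]]] := oU _ Ux.
have [p [q [qx E]]] := Gm_alg_local hs Dx.
have px : p.@[Gm_coord x] != 0.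
  by apply: contraNneq sx => px; have [_ ->] := E _ qx; rewrite px mul0r.
exists (p * q).
  by rewrite mulf_neq0 //; [apply: contraNneq px|apply: contraNneq qx] => ->; rewrite meval0.
move=> y; rewrite mevalM mulf_eq0 negb_or => /andP[py qy]; have [Dy sy] := E _ qy.
by apply: sU => //; rewrite sy mulf_neq0 // invr_neq0.
Qed.

Definition to_Gm (x : pt) (h : forall i, x i != 0) : Gm k n :=
  exist (fun x => x \in @Gm_set k n) x (mem_set h).

(** A nonempty open set contains the nonvanishing locus of a nonzero polynomial, and a product of
    two such polynomials is nonzero at some point with nonzero coordinates. *)
Lemma Gm_irreducible : irreducible (Gm k n).
Proof.
split.
  have h i : ([ffun=> 1] : pt) i != 0 by rewrite ffunE oner_neq0.
  by exists (to_Gm h).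
move=> C D cC cD CD; apply: contrapT => /not_orP[nC nD].
have ne (E : set (Gm k n)) : E <> setT -> ~` E !=set0.
  by move=> nE; apply/set0P; apply/eqP => E0; apply: nE; rewrite -(setCK E) E0 setC0.
have [w w0 wC] := Gm_open_poly (closed_openC cC) (ne _ nC).
have [w' w'0 wD] := Gm_open_poly (closed_openC cD) (ne _ nD).
have [v [v0]] := mpoly_nonroot (mulf_neq0 w0 w'0).
rewrite mevalM mulf_eq0 negb_or => /andP[wv w'v].
have : (C `|` D) (to_Gm v0) by rewrite CD.
by move=> [Cv|Dv]; [apply: (wC (to_Gm v0))|apply: (wD (to_Gm v0))].
Qed.

Lemma Gm_reg_laurent (f : Gm k n -> k) : kreg setT f -> exists N (p : {mpoly k[n]}),
  forall a, f a * (\prod_j Gm_coord a j) ^+ N = p.@[Gm_coord a].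
Proof.
move=> rf.
(* Extension by [0] off the torus; [pregular] looks only at points of the chart. *)
pose f' (x : pt) : k := if pselect (x \in @Gm_set k n) is left h
  then f (exist (fun x => x \in @Gm_set k n) x h) else 0.
have f'E a : f' (Gm_coord a) = f a.
  rewrite /f'; case: pselect => h; last by case: h; case: a.
  by congr f; apply: val_inj.
have : @pregular k n true f'.
  apply: locally_rationalP => x cx.
  have gx y : chart true y -> y \in @Gm_set k n.
    by move=> h; apply/mem_set => i; have := h i; rewrite expr1.
  pose X y (cy : chart true y) : Gm k n := exist (fun x => x \in @Gm_set k n) y (gx y cy).
  have [D [a [s [ha hs Dx sx E]]]] := rf (X x cx) I.
  have [p [q [qx Ea]]] := Gm_alg_local ha Dx; have [p' [q' [qx' Es]]] := Gm_alg_local hs Dx.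
  have px' : p'.@[x] != 0.
    apply: contraNneq sx => px'; have [_ ->] := Es _ qx'.
    by rewrite [Gm_coord _]/= px' mul0r.
  exists (p * q' * q'), (q * p' * q'); rewrite !mevalM !mulf_neq0 //; split=> // y cy.
  rewrite !mevalM !mulf_eq0 !negb_or => /andP[/andP[qy py'] qy'].
  have -> : f' y = f (X y cy) by rewrite -f'E.
  have [Dy ay] := Ea (X y cy) qy; have [_ sy] := Es (X y cy) qy'.
  have s0 : s (X y cy) != 0 by rewrite sy mulf_neq0 // invr_neq0.
  by rewrite E // ay sy [Gm_coord _]/=; field; rewrite qy py' qy'.
move=> /pregular_poly[N [p pE]]; exists N, p => a.
by rewrite -f'E -pE ?mul1n // => i; rewrite expr1 Gm_coord_neq0.
Qed.

End Affine.

(** * Degree bounds *)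

Section LinearAlgebra.
Variable (k : fieldType).

(** Choose [r] points by induction and expand the determinant along the row of a further point [x].
    This is a combination of the [phi i x] in which the last coefficient is, up to sign, the nonzero
    minor; by independence it is nonzero for some [x]. *)
Lemma evaluation_points (X : Type) (r : nat) (phi : 'I_r -> X -> k) :
  (forall c : 'I_r -> k, (forall x, \sum_i c i * phi i x = 0) -> forall i, c i = 0) ->
  exists z : 'I_r -> X, \det (\matrix_(s, i) phi i (z s)) != 0.
Proof.
elim: r phi => [|r IH] phi free.
  have z0 : 'I_0 -> X by case.
  by exists z0; rewrite det_mx00 oner_neq0.
have [|z dz] := IH (fun i => phi (lift ord_max i)).
  move=> c hc i; pose c' j := if unlift ord_max j is Some i then c i else 0.
  have -> : c i = c' (lift ord_max i) by rewrite /c' liftK.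
  apply: free => x; rewrite big_ord_recr /= {2}/c' unlift_none mul0r addr0 -[RHS](hc x).
  apply: eq_bigr => j _; have -> : widen_ord (leqnSn r) j = lift ord_max j.
    by apply: val_inj; rewrite /= /bump leqNgt ltn_ord.
  by rewrite /c' liftK.
pose c (i : 'I_r.+1) := (-1) ^+ (r + i) * \det (\matrix_(s, j) phi (lift i j) (z s)).
apply: contrapT => no; suff : c ord_max = 0.
  by move/eqP; rewrite mulf_eq0 signr_eq0 (negPf dz).
apply: free => x; apply/eqP/negP => /negP nz; apply: no.
exists (fun s => if unlift ord_max s is Some s' then z s' else x).
rewrite (expand_det_row _ ord_max); move: nz; congr (_ != 0).
apply: eq_bigr => i _; rewrite mxE unlift_none mulrC; congr (_ * _).
rewrite /c /cofactor; congr (_ * \det _); apply/matrixP => s j.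
by rewrite !mxE liftK.
Qed.

(** At most [d ^ n] monomials have degree below [d], because each of their exponents is below
    [d]. *)
Lemma linear_dependence (n d : nat) (I : finType) (F : I -> {mpoly k[n]}) :
  (forall i, msize (F i) <= d)%N -> (d ^ n < #|I|)%N ->
  exists2 c : I -> k, (exists i, c i != 0) & \sum_i c i *: F i = 0.
Proof.
move=> hF cI; pose J : finType := 'X_{1..n < d}.
have cJ : (#|J| <= d ^ n)%N.
  have -> : (d ^ n = #|{ffun 'I_n -> 'I_d}|)%N by rewrite card_ffun !card_ord.
  have lt (m : J) i : (bmnm (m : 'X_{1..n < d}) i < d)%N.
    by apply: leq_ltn_trans (bmdeg m); rewrite mdegE (bigD1 i) //= leq_addr.
  pose h (m : J) : {ffun 'I_n -> 'I_d} := [ffun i => Ordinal (lt m i)].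
  apply: (@leq_card _ _ h) => m m' /ffunP e; apply: val_inj; apply/mnmP => i.
  by have := congr1 val (e i); rewrite !ffunE.
pose M := \matrix_(i < #|I|, j < #|J|) (F (enum_val i))@_(enum_val j : J).
have : kermx M != 0.
  rewrite -mxrank_eq0 mxrank_ker -lt0n subn_gt0.
  by rewrite (leq_ltn_trans (rank_leq_col _)) // (leq_ltn_trans cJ).
move=> /rowV0Pn[v /sub_kermxP vM v0].
exists (fun i => v 0 (enum_rank i)).
  apply: contrapT => no; move/eqP: v0; apply; apply/rowP => j; rewrite mxE.
  by apply/eqP/negPn/negP => nz; apply: no; exists (enum_val j); rewrite enum_valK.
apply/mpolyP => m; rewrite mcoeff0 raddf_sum /=.
have [lt|ge] := ltnP (mdeg m) d; last first.
  rewrite big1 // => i _; rewrite mcoeffZ (memN_msupp_eq0 (p := F i)) ?mulr0 //.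
  exact: msize_mdeg_ge (leq_trans (hF i) ge).
have /rowP/(_ (enum_rank (BMultinom lt))) := vM; rewrite !mxE => E0; rewrite -[RHS]E0.
rewrite (reindex (@enum_val _ (mem I))) /=; last first.
  by exists enum_rank => i _; rewrite ?enum_valK ?enum_rankK.
by apply: eq_bigr => i _; rewrite mcoeffZ mxE enum_valK enum_rankK.
Qed.

End LinearAlgebra.

Section Degree.
Variables (k : fieldType).

Definition degle (n : nat) (d : nat) (p : {mpoly k[n]}) := (msize p <= d.+1)%N.

Lemma degle_trans n d d' (p : {mpoly k[n]}) : degle d p -> (d <= d')%N -> degle d' p.
Proof. by rewrite /degle => h hd; apply: leq_trans h _. Qed.

Lemma degleC n d (c : k) : degle d (c%:MP : {mpoly k[n]}).
Proof. by rewrite /degle msizeC; case: eqP. Qed.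

Lemma degleZ n d c (p : {mpoly k[n]}) : degle d p -> degle d (c *: p).
Proof. by apply: leq_trans; apply: msizeZ_le. Qed.

Lemma degleD n d (p q : {mpoly k[n]}) : degle d p -> degle d q -> degle d (p + q).
Proof. by rewrite /degle => hp hq; apply: (leq_trans (msizeD_le _ _)); rewrite geq_max hp hq. Qed.

Lemma degle_sum n d (I : Type) (r : seq I) (P : pred I) (F : I -> {mpoly k[n]}) :
  (forall i, P i -> degle d (F i)) -> degle d (\sum_(i <- r | P i) F i).
Proof.
by move=> h; apply: (big_ind (degle d)) => //; [rewrite /degle msize0|exact: degleD].
Qed.

Lemma degleM n d d' (p q : {mpoly k[n]}) :
  degle d p -> degle d' q -> degle (d + d') (p * q).
Proof.
rewrite /degle => hp hq.
have [->|p0] := eqVneq p 0; first by rewrite mul0r msize0.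
have [->|q0] := eqVneq q 0; first by rewrite mulr0 msize0.
by rewrite msizeM //; move: (msize p) (msize q) hp hq => a b; clear; lia.
Qed.

Lemma degleXn n d e (p : {mpoly k[n]}) : degle d p -> degle (e * d) (p ^+ e).
Proof.
move=> hp; elim: e => [|e IH]; first by rewrite expr0 -mpolyC1; exact: degleC.
by rewrite exprS mulSn; exact: degleM.
Qed.

Lemma degle_prod n d (I : Type) (r : seq I) (e : I -> nat) (F : I -> {mpoly k[n]}) :
  (forall i, degle d (F i)) -> degle ((\sum_(i <- r) e i) * d) (\prod_(i <- r) F i ^+ e i).
Proof.
move=> h; elim: r => [|i r IH].
  by rewrite !big_nil -mpolyC1; exact: degleC.
by rewrite !big_cons mulnDl; apply: degleM => //; exact: degleXn.
Qed.

Lemma degle_compm n l d e (g : 'I_n -> {mpoly k[l]}) p :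
  degle d p -> (forall i, degle e (g i)) -> degle (d * e) (compm g p).
Proof.
move=> hp hg; rewrite /compm comp_mpolyE big_seq; apply: degle_sum => m hm.
apply: degleZ; apply: (@degle_trans _ (mdeg m * e)).
  rewrite mdegE; apply: (eq_ind _ (degle _) (degle_prod (index_enum _) m hg)).
  by apply: eq_bigr => i _; rewrite tnth_mktuple.
by rewrite leq_mul2r -ltnS (leq_trans (msize_mdeg_lt hm)) ?orbT.
Qed.

Lemma degle_msupp n d (p : {mpoly k[n]}) : degle d p -> forall m, m \in msupp p -> (mdeg m <= d)%N.
Proof. by move=> h m /msize_mdeg_lt hm; rewrite -ltnS (leq_trans hm). Qed.

(* If [p] were of large degree, the top nonzero [Q l] would dominate. *)
Lemma degle_algebraic n (a E : nat) (Q : 'I_E -> {mpoly k[n]}) p :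
  (forall l, degle a (Q l)) -> (exists l, Q l != 0) ->
  \sum_(l < E) Q l * p ^+ l = 0 -> degle a p.
Proof.
move=> hQ [l1 Ql1] S0.
pose l0 := [arg max_(l > l1 | Q l != 0) (l : nat)].
have [Ql0 l0max] : Q l0 != 0 /\ forall l, Q l != 0 -> (l <= l0)%N.
  by rewrite /l0; case: arg_maxnP.
rewrite /degle leqNgt; apply/negP => ltp.
have p0 : p != 0 by apply: contraTneq ltp => ->; rewrite msize0.
pose g := (msize p).-1; have gE : msize p = g.+1 by rewrite /g prednK // (leq_trans _ ltp).
have hp : degle g p by rewrite /degle gE.
have E0 : Q l0 * p ^+ l0 = - \sum_(l | l != l0) Q l * p ^+ l.
  by move: S0; rewrite (bigD1 l0) //= => /eqP; rewrite addr_eq0 => /eqP.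
have sz e : msize (p ^+ e) = (e * g).+1.
  elim: e => [|e IH]; first by rewrite expr0 msize1.
  by rewrite exprS msizeM ?expf_neq0 // gE IH mulSn; clear; lia.
have low : (l0 * g < msize (Q l0 * p ^+ l0))%N.
  rewrite msizeM ?expf_neq0 // sz; have : msize (Q l0) != 0%N by rewrite msize_poly_eq0.
  by move: (msize (Q l0)) (l0 * g)%N => x y; clear; lia.
have [z|n0] := posnP l0.
  move: E0; rewrite big1 ?oppr0 => [/eqP|l nl].
    by rewrite mulf_eq0 expf_eq0 (negPf Ql0) (negPf p0) andbF.
  have [->|/l0max] := eqVneq (Q l) 0; first by rewrite mul0r.
  by rewrite z leqn0 => /eqP lz; case/eqP: nl; apply: val_inj; rewrite /= lz z.
have : degle (a + (l0 : nat).-1 * g) (- \sum_(l | l != l0) Q l * p ^+ l).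
  rewrite /degle msizeN; apply: degle_sum => l nl.
  have [->|/l0max le] := eqVneq (Q l) 0; first by rewrite mul0r /degle msize0.
  apply: degleM => //; apply: degle_trans (degleXn l hp) _.
  have : (l < l0)%N by rewrite ltn_neqAle le andbT; exact: nl.
  by move=> lt; rewrite leq_mul2r -ltnS prednK // lt orbT.
rewrite /degle -E0 => up; have := leq_trans low up.
rewrite ltnS; have : (a < g)%N by rewrite -ltnS -gE.
have -> : (l0 * g = g + (l0 : nat).-1 * g)%N by rewrite -mulSn prednK.
by rewrite leq_add2r => h1 h2; have := leq_ltn_trans h2 h1; rewrite ltnn.
Qed.

End Degree.

Section Inverse.
Variables (k : fieldType).

Lemma sum_ord_le (n E : nat) (m : {ffun 'I_n -> 'I_E.+1}) :
  (\sum_j (m j : nat) <= n * E)%N.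
Proof.
apply: leq_trans (_ : \sum_(j < n) E <= _)%N; last by rewrite sum_nat_const card_ord.
by apply: leq_sum => j _; rewrite -ltnS.
Qed.

Definition inverse_bound (n d : nat) : nat := (n * (n * d + 2) ^ n.+1).+1.

(* The [E ^ n.+1] products [f ^ m * 'X_i ^ l] have too small a degree to be
   independent; substituting [g] turns a relation between them into an
   algebraic equation for [g i] with coefficients of bounded degree. *)
Lemma degle_inverse n d (f g : 'I_n -> {mpoly k[n]}) :
  (forall i, degle d (f i)) -> (forall i, compm g (f i) = 'X_i) ->
  forall i, degle (inverse_bound n d) (g i).
Proof.
(* This [E] gives [((n * d + 2) * E) ^ n < E ^ n.+1], so the products outnumber the monomials
   available to them. The resulting equation for [g i] has coefficients of degree at most
   [n * E.-1]. *)
move=> hf fg i; pose E := ((n * d + 2) ^ n).+1.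
pose I := ({ffun 'I_n -> 'I_E} * 'I_E)%type.
pose F (c : I) : {mpoly k[n]} := (\prod_j f j ^+ c.1 j) * 'X_i ^+ c.2.
have [||c [[m1 l1] c0] S0] := @linear_dependence k n ((n * d + 2) * E) I F.
- move=> [m l]; rewrite /F /=.
  have h1 := degle_prod (index_enum 'I_n) (fun j => m j : nat) hf.
  have h2 : degle (l * 1) (('X_i : {mpoly k[n]}) ^+ l).
    by apply: degleXn; rewrite /degle msizeX mdeg1.
  apply: leq_trans (degleM h1 h2) _.
  have hm : (\sum_j (m j : nat) <= n * E.-1)%N.
    exact: sum_ord_le.
  have gen s (l' : nat) e : (s <= n * e)%N -> (l' < e.+1)%N ->
      ((s * d + l' * 1).+1 <= (n * d + 2) * e.+1)%N.
    move=> hs hl; have : (s * d <= n * e * d)%N by rewrite leq_mul2r hs orbT.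
    by move: hl; rewrite mulnDl mulnS; move: (n * e * d)%N (mulnAC n e d) => a; clear; lia.
  by apply: gen => //; exact: ltn_ord.
- rewrite card_prod card_ffun !card_ord expnMn mulnC ltn_pmul2l ?expn_gt0 //.
- pose Q (l : 'I_E) : {mpoly k[n]} := \sum_(m : {ffun 'I_n -> 'I_E}) c (m, l) *: \prod_j 'X_j ^+ m j.
  apply: degle_trans (_ : degle (n * E.-1) (g i)) _; last first.
    rewrite /inverse_bound /E /= expnS; clear; nia.
  apply: (@degle_algebraic _ _ _ E Q).
  + move=> l; apply: degle_sum => m _; apply: degleZ.
    apply: degle_trans (degle_prod (d := 1) _ _ _) _.
      by move=> j; rewrite /degle msizeX mdeg1.
    by rewrite muln1; exact: sum_ord_le.
  + exists l1; apply: contraNneq c0 => Q0.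
    have := congr1 (mcoeff [multinom (m1 j : nat) | j < n]) Q0.
    rewrite mcoeff0 raddf_sum /= (bigD1 m1) //= => E1.
    have XE (m : {ffun 'I_n -> 'I_E}) : \prod_j 'X_j ^+ m j = 'X_[[multinom (m j : nat) | j < n]] :> {mpoly k[n]}.
      by rewrite mpolyXE_id; apply: eq_bigr => j _; rewrite mnmE.
    rewrite -E1 mcoeffZ XE mcoeffX eqxx mulr1 big1 ?addr0 // => m nm.
    rewrite mcoeffZ XE mcoeffX; case: eqP => [/mnmP e|]; last by rewrite mulr0.
    case/eqP: nm; apply/ffunP => j; apply: val_inj.
    by have := e j; rewrite !mnmE.
  + have := congr1 (compm g) S0; rewrite /compm comp_mpoly0 raddf_sum /=.
    move=> E0; rewrite -[RHS]E0 /Q; under eq_bigr do rewrite big_distrl /=.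
    rewrite exchange_big /= pair_bigA /=; apply: eq_bigr => -[m l] _ /=.
    rewrite comp_mpolyZ -scalerAl; congr (_ *: _).
    rewrite rmorphM rmorphXn rmorph_prod /=; congr (_ * _ ^+ _); last first.
      by rewrite comp_mpolyXU -tnth_nth tnth_mktuple.
    by apply: eq_bigr => j _; rewrite rmorphXn /= -fg.
Qed.

End Inverse.

(** * Families of automorphisms *)

Section Interpolation.
Variables (k : closedFieldType) (n d : nat).

Lemma unisolvent_points : let J := 'X_{1..n < d.+1} in
  exists z : 'I_#|{: J}| -> {ffun 'I_n -> k},
    \det (\matrix_(s, j) ('X_[enum_val j : J] : {mpoly k[n]}).@[z s]) != 0.
Proof.
move=> J; apply: (evaluation_points
  (phi := fun j (x : {ffun 'I_n -> k}) => ('X_[(enum_val j : J)] : {mpoly k[n]}).@[x])).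
move=> c hc j; pose p : {mpoly k[n]} := \sum_j c j *: 'X_[enum_val j : J].
have p0 : p = 0.
  apply: meval_inj => v; rewrite meval0 -[RHS](hc v) raddf_sum /=.
  by apply: eq_bigr => i _; rewrite mevalZ.
have := congr1 (mcoeff (enum_val j : J)) p0; rewrite mcoeff0 raddf_sum /= (bigD1 j) //=.
rewrite mcoeffZ mcoeffX eqxx mulr1 big1 ?addr0 // => i ij.
rewrite mcoeffZ mcoeffX; case: eqP => [e|]; last by rewrite mulr0.
by move: ij; rewrite (enum_val_inj (val_inj e)) eqxx.
Qed.

Lemma degle_expand (p : {mpoly k[n]}) : degle d p ->
  p = \sum_(j < #|{: 'X_{1..n < d.+1}}|)
    p@_(enum_val j : 'X_{1..n < d.+1}) *: 'X_[enum_val j : 'X_{1..n < d.+1}].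
Proof.
move=> hp; rewrite {1}(mpolywE hp).
rewrite (reindex (@enum_val _ (mem {: 'X_{1..n < d.+1}}))) //.
by exists enum_rank => i _; rewrite ?enum_valK ?enum_rankK.
Qed.

(** Coefficients are fixed linear combinations of values at fixed points; this transfers regularity
    from values to coefficients. *)
Lemma coef_interpolation : exists (r : nat) (z : 'I_r -> {ffun 'I_n -> k})
    (lam : 'X_{1..n} -> 'I_r -> k),
  forall p, degle d p -> forall m, p@_m = \sum_s lam m s * p.@[z s].
Proof.
pose J := 'X_{1..n < d.+1}; have [z dz] := unisolvent_points.
set V := \matrix_(s, j) _ in dz.
have uV : V \in unitmx by rewrite unitmxE unitfE.
(* Coefficients in degree above [d] vanish, whence the default [0]. *)
exists #|{: J}|, z, (fun m s => if @idP (mdeg m < d.+1)%N is ReflectT h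
  then invmx V (enum_rank (BMultinom h)) s else 0) => p hp m.
case: {-}_ / idP => h; last first.
  rewrite big1 => [|s _]; last by rewrite mul0r.
  apply: memN_msupp_eq0; apply: contraPN h => /msize_mdeg_lt lt; apply.
  exact: leq_trans lt hp.
have E : \col_s p.@[z s] = V *m \col_j p@_(enum_val j : J).
  apply/colP => s; rewrite !mxE {1}(degle_expand hp) raddf_sum /=.
  by apply: eq_bigr => j _; rewrite mevalZ !mxE mulrC.
have /colP/(_ (enum_rank (BMultinom h))) := congr1 (mulmx (invmx V)) E.
rewrite mulKmx // !mxE enum_rankK /= => <-.
by apply: eq_bigr => s _; rewrite !mxE.
Qed.

End Interpolation.

Section Families.
Variables (k : closedFieldType) (n : nat).
Local Notation X := (affine_space k n).
Local Notation pt := {ffun 'I_n -> k}.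

(* [F] is to be thought of as the ring of regular functions of an irreducible
   variety with set of points [A]. *)
Definition irreducible_functions (A : Type) (F : set (A -> k)) : Prop :=
  [/\ subalgebra F,
      forall f g, F f -> F g -> (exists a, f a != 0) -> (exists a, g a != 0) ->
        exists a, f a != 0 /\ g a != 0 &
      forall f, (forall a, exists p q, [/\ F p, F q, q a != 0 &
        forall b, q b != 0 -> f b * q b = p b]) -> F f].

Definition polynomial_family (A : Type) (F : set (A -> k)) (rho : A -> aut X) : Prop :=
  (exists d, forall a i, degle d (autp (rho a) i)) /\
  forall (x : pt) i, F (fun a => (rho a x : pt) i).

Lemma family_coef A F (rho : A -> aut X) i m : subalgebra F ->
  polynomial_family F rho -> F (fun a => (autp (rho a) i)@_m).
Proof.
move=> FA [[d hd] hF]; have [r [z [lam E]]] := coef_interpolation k n d.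
rewrite (_ : (fun a => _) = fun a => \sum_s lam m s * (rho a (z s) : pt) i).
  case: (FA) => FC FD FM; apply: subalgebra_sum => // s; exact: FM.
by apply/funext => a; rewrite (E _ (hd a i)); apply: eq_bigr => s _; rewrite autpE.
Qed.

(** Regularity in each variable separately stands in for the product variety, which keeps
    irreducibility of products elementary. *)
Definition slicewise (A B : Type) (F : set (A -> k)) (F' : set (B -> k)) :
    set (A * B -> k) :=
  [set f | (forall b, F (fun a => f (a, b))) /\ (forall a, F' (fun b => f (a, b)))].

(** Functions nonzero at [(a, b)] and [(a', b')] are first made nonzero at a common [a2], keeping
    [b] and [b'], and then at a common [b2]. *)
Lemma slicewise_irreducible A B (F : set (A -> k)) (F' : set (B -> k)) :
  irreducible_functions F -> irreducible_functions F' ->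
  irreducible_functions (slicewise F F').
Proof.
move=> [[FC FD FM] Fdom Floc] [[FC' FD' FM'] Fdom' Floc']; split.
- by split=> [c|f g [f1 f2] [g1 g2]|f g [f1 f2] [g1 g2]]; split=> x //;
    [exact: FD|exact: FD'|exact: FM|exact: FM'].
- move=> f g [f1 f2] [g1 g2] [[a b] fab] [[a' b'] gab].
  have [a2 [fa ga]] : exists a2, f (a2, b) != 0 /\ g (a2, b') != 0.
    by apply: (Fdom _ _ (f1 b) (g1 b')); [exists a|exists a'].
  have [b2 [fb gb]] : exists b2, f (a2, b2) != 0 /\ g (a2, b2) != 0.
    by apply: (Fdom' _ _ (f2 a2) (g2 a2)); [exists b|exists b'].
  by exists (a2, b2).
- move=> f floc; split=> [b|a].
    apply: Floc => a; have [p [q [[p1 p2] [q1 q2] qab E]]] := floc (a, b).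
    by exists (fun a => p (a, b)), (fun a => q (a, b)); split=> // a'; exact: E.
  apply: Floc' => b; have [p [q [[p1 p2] [q1 q2] qab E]]] := floc (a, b).
  by exists (fun b => p (a, b)), (fun b => q (a, b)); split=> // b'; exact: E.
Qed.

(** Degrees multiply, and a value of the composite is a sum of coefficients of [rho a] times
    monomials in the values of [sigma a]. *)
Lemma family_mul A (F : set (A -> k)) rho sigma : subalgebra F ->
  polynomial_family F rho -> polynomial_family F sigma ->
  polynomial_family F (fun a => (rho a * sigma a)%g).
Proof.
move=> FA hr hs; have [[d hd] hF] := hr; have [[d' hd'] hF'] := hs; split.
  exists (d * d')%N => a i; rewrite autpM; exact: degle_compm.
move=> x i; pose J := 'X_{1..n < d.+1}.
rewrite (_ : (fun a => _) = fun a => \sum_(j < #|{: J}|)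
  (autp (rho a) i)@_(enum_val j : J) * ('X_[enum_val j : J]).@[(sigma a x : pt)]).
  case: (FA) => FC FD FM; apply: subalgebra_sum => // j; apply: (FM).
    exact: family_coef.
  by apply: subalgebra_meval => // l; exact: hF'.
apply/funext => a; rewrite -[_ (x : pt)]/(rho a (sigma a x)) autpE.
rewrite {1}(degle_expand (hd a i)) raddf_sum /=.
by apply: eq_bigr => j _; rewrite mevalZ.
Qed.

Lemma family_const A (F : set (A -> k)) (f : aut X) : subalgebra F ->
  polynomial_family F (fun=> f).
Proof.
move=> [FC _ _]; split=> [|x i]; last exact: FC.
exists (\sum_i msize (autp f i))%N => _ i.
by rewrite /degle (bigD1 i) //= -addnS leq_addr.
Qed.

Lemma family_fst A B (F : set (A -> k)) (F' : set (B -> k)) rho : subalgebra F' ->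
  polynomial_family F rho ->
  polynomial_family (slicewise F F') (fun c : A * B => rho c.1).
Proof.
move=> [FC _ _] [[d hd] hF]; split; first by exists d.
by move=> x i; split=> [b|a]; [exact: hF|exact: (FC (rho a x i))].
Qed.

Lemma family_snd A B (F : set (A -> k)) (F' : set (B -> k)) rho : subalgebra F ->
  polynomial_family F' rho ->
  polynomial_family (slicewise F F') (fun c : A * B => rho c.2).
Proof.
move=> [FC _ _] [[d hd] hF]; split; first by exists d.
by move=> x i; split=> [b|a]; [exact: (FC (rho b x i))|exact: hF].
Qed.

(* The coefficients of the inverse solve a linear system, obtained by evaluation
   at points where it is unisolvent for the parameter [a0]. *)
Lemma family_inv A (F : set (A -> k)) rho : irreducible_functions F ->
  polynomial_family F rho -> polynomial_family F (fun a => (rho a)^-1%g).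
Proof.
move=> [FA _ Floc] [[d hd] hF].
have hE a i : degle (inverse_bound n d) (autp (rho a)^-1%g i).
  apply: (degle_inverse (hd a)) => j.
  have := congr1 (fun f => autp f j) (mulgV (rho a)).
  by rewrite autpM autp1.
split; first by exists (inverse_bound n d).
move: hE; set d' := inverse_bound n d => hE.
move=> x i; pose J := 'X_{1..n < d'.+1}; have [z dz] := unisolvent_points k n d'.
apply: Floc => a0.
(* Since [rho a0 (y s) = z s], the matrix [V a0] is the unisolvent one. For every [a], the
   coefficients [G] of the inverse solve [V a *m G = y], because the inverse sends [rho a (y s)] to
   [y s]. *)
pose y s : pt := (rho a0)^-1%g (z s).
pose V a : 'M[k]_#|{: J}| := \matrix_(s, j) ('X_[enum_val j : J] : {mpoly k[n]}).@[(rho a (y s) : pt)].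
have FV (s j : 'I_#|{: J}|) : F (fun a => V a s j).
  rewrite (_ : (fun a => _) = fun a => ('X_[enum_val j : J] : {mpoly k[n]}).@[(rho a (y s) : pt)]).
    by apply: subalgebra_meval => // l; exact: hF.
  by apply/funext => b; rewrite mxE.
have key a : (rho a)^-1%g x i * \det (V a) =
   \sum_j ('X_[enum_val j : J] : {mpoly k[n]}).@[x] * \sum_s (\adj (V a)) j s * y s i.
  pose G : 'cV[k]_#|{: J}| := \col_j (autp (rho a)^-1%g i)@_(enum_val j : J).
  have E : V a *m G = \col_s y s i.
    apply/colP => s; rewrite !mxE.
    have -> : y s i = (rho a)^-1%g (rho a (y s)) i.
      by rewrite -[_ (rho a _)]/(((rho a)^-1 * rho a)%g (y s)) mulVg.
    rewrite autpE {1}(degle_expand (hE a i)) raddf_sum /=.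
    by apply: eq_bigr => j _; rewrite mevalZ !mxE mulrC.
  have E2 : \det (V a) *: G = \adj (V a) *m \col_s y s i.
    by rewrite -E mulmxA mul_adj_mx mul_scalar_mx.
  rewrite autpE {1}(degle_expand (hE a i)) raddf_sum big_distrl /=.
  apply: eq_bigr => j _; rewrite mevalZ.
  have /colP/(_ j) := E2; rewrite [LHS]mxE [G j _]mxE [RHS]mxE => e.
  rewrite mulrAC [_ * \det _]mulrC e mulrC; congr (_ * _).
  by apply: eq_bigr => s _; congr (_ * _); rewrite mxE.
case: (FA) => FC FD FM.
exists (fun a => \sum_j ('X_[enum_val j : J] : {mpoly k[n]}).@[x] *
   \sum_s (\adj (V a)) j s * y s i), (fun a => \det (V a)); split=> //.
- apply: subalgebra_sum => // j; apply: (FM) => //; apply: subalgebra_sum => // s.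
  apply: (FM) => //; rewrite (_ : (fun a => _) = fun a => cofactor (V a) s j); last first.
    by apply/funext => a; rewrite mxE.
  apply: (FM) => //; apply: subalgebra_det => // u v.
  rewrite (_ : (fun a => _) = fun a => V a (lift s u) (lift j v)) //.
  by apply/funext => a; rewrite !mxE.
- exact: subalgebra_det.
- move: dz; congr (\det _ != 0); apply/matrixP => s j; rewrite !mxE.
  by apply: meval_eq => l; rewrite -[rho a0 _]/((rho a0 * (rho a0)^-1)%g (z s)) mulgV.
Qed.

End Families.

(** * Derived and conjugate subgroups *)

Section Groups.
Variable gT : groupType.
Local Open Scope group_scope.
Implicit Types (H K : set gT).

Lemma is_subgroupP H : is_subgroup H <->
  [/\ H 1, forall x y, H x -> H y -> H (x * y) & forall x, H x -> H x^-1].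
Proof.
split=> [Hg|[H1 HM HV]].
  split; first by case: Hg => /set_mem.
    by move=> x y Hx Hy; apply/set_mem/(group_closedM Hg); apply/mem_set.
  by move=> x Hx; apply/set_mem/(group_closedV Hg); apply/mem_set.
split; first exact/mem_set.
by move=> x y /set_mem Hx /set_mem Hy; apply/mem_set/HM => //; exact: HV.
Qed.

Lemma derived_subgroup H : is_subgroup (derived H).
Proof.
apply/is_subgroupP; split=> [K [/is_subgroupP[]] //|x y hx hy K hK|x hx K hK].
  by have [/is_subgroupP[_ KM _] _] := hK; apply: KM; [exact: hx|exact: hy].
by have [/is_subgroupP[_ _ KV] _] := hK; apply: KV; exact: hx.
Qed.

Lemma commg_derived H x y : H x -> H y -> derived H [~ x, y].
Proof. by move=> Hx Hy K [_]; apply; exists x => //; exists y. Qed.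

Lemma derived_min H K : is_subgroup K ->
  (forall x y, H x -> H y -> K [~ x, y]) -> derived H `<=` K.
Proof. by move=> Kg KH x; apply; split=> // _ [a Ha [b Hb <-]]; exact: KH. Qed.

Lemma derived_sub H : is_subgroup H -> derived H `<=` H.
Proof.
move=> Hg; apply: derived_min => // x y Hx Hy.
have /is_subgroupP[_ HM HV] := Hg; rewrite /commg /conjg.
by apply: (HM) (HV _ Hx) _; apply: (HM) (HV _ Hy) _; exact: HM.
Qed.

Definition conj_set (g : gT) H : set gT := [set h ^ g | h in H].

Lemma conj_subgroup g H : is_subgroup H -> is_subgroup (conj_set g H).
Proof.
move=> /is_subgroupP[H1 HM HV]; apply/is_subgroupP; split.
- by exists 1 => //; rewrite conj1g.
- by move=> _ _ [x Hx <-] [y Hy <-]; exists (x * y); rewrite ?conjMg //; exact: HM.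
- by move=> _ [x Hx <-]; exists x^-1; rewrite ?conjVg //; exact: HV.
Qed.

Lemma derived_conj g H : derived (conj_set g H) `<=` conj_set g (derived H).
Proof.
apply: derived_min; first exact/conj_subgroup/derived_subgroup.
move=> _ _ [x Hx <-] [y Hy <-]; exists [~ x, y]; first exact: commg_derived.
by rewrite conjRg.
Qed.

Lemma derived_mono H K : H `<=` K -> derived H `<=` derived K.
Proof.
move=> HK; apply: derived_min; first exact: derived_subgroup.
by move=> x y /HK Kx /HK Ky; exact: commg_derived.
Qed.

Lemma iter_derived_conj m g H :
  iter m (@derived gT) (conj_set g H) `<=` conj_set g (iter m (@derived gT) H).
Proof.
elim: m => //= m IH; apply: subset_trans (derived_mono IH) _.
exact: derived_conj.
Qed.

End Groups.

(** * Connectedness through irreducible families *)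

Section Joined.
Variables (k : closedFieldType) (n : nat).
Local Notation X := (affine_space k n).
Local Notation pt := {ffun 'I_n -> k}.
Implicit Types (M : set (aut X)) (f g : aut X).

(** The parameter space is any type with an irreducible ring of functions, a notion stable under
    [slicewise] products; varieties enter through [connected_subgroup_group]. *)
Definition joined M f : Prop :=
  exists (A : Type) (F : set (A -> k)) (rho : A -> aut X),
    [/\ irreducible_functions F, polynomial_family F rho & range rho `<=` M] /\
    [/\ range rho 1%g & range rho f].

Definition connected_group M : Prop :=
  is_subgroup M /\ forall f, M f -> joined M f.

Lemma joined1 M : is_subgroup M -> joined M 1%g.
Proof.
move=> /is_subgroupP[M1 _ _]; exists unit, setT, (fun=> 1%g); split; split=> //.
- split=> // f g _ _ [[] fa] [[] gb]; exists tt; by split.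
- exact: family_const.
- by move=> _ [_ _ <-].
- by exists tt.
- by exists tt.
Qed.

Lemma joinedM M f g : is_subgroup M -> joined M f -> joined M g -> joined M (f * g)%g.
Proof.
move=> /is_subgroupP[_ MM _].
move=> [A [F [rho [[iF hrho rM] [[a1 _ r1] [af _ rf]]]]]].
move=> [B [F' [sigma [[iF' hsigma sM] [[b1 _ s1] [bg _ sg]]]]]].
have iFF := slicewise_irreducible iF iF'.
have [[FA _ _] [FA' _ _] [FFA _ _]] := And3 iF iF' iFF.
exists (A * B)%type, (slicewise F F'), (fun c => rho c.1 * sigma c.2)%g; split; split=> //.
- by apply: family_mul => //; [exact: family_fst|exact: family_snd].
- by move=> _ [[a b] _ <-] /=; apply: MM; [apply: rM; exists a|apply: sM; exists b].
- by exists (a1, b1) => //=; rewrite r1 s1 mulg1.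
- by exists (af, bg) => //=; rewrite rf sg.
Qed.

Lemma joinedV M f : is_subgroup M -> joined M f -> joined M f^-1%g.
Proof.
move=> /is_subgroupP[_ _ MV].
move=> [A [F [rho [[iF hrho rM] [[a1 _ r1] [af _ rf]]]]]].
exists A, F, (fun a => (rho a)^-1%g); split; split=> //.
- exact: family_inv.
- by move=> _ [a _ <-]; apply/MV/rM; exists a.
- by exists a1; rewrite // r1 invg1.
- by exists af; rewrite // rf.
Qed.

Lemma joined_commg M f g : joined M f -> joined M g -> joined (derived M) [~ f, g]%g.
Proof.
move=> [A [F [rho [[iF hrho rM] [[a1 _ r1] [af _ rf]]]]]].
move=> [B [F' [sigma [[iF' hsigma sM] [[b1 _ s1] [bg _ sg]]]]]].
have iFF := slicewise_irreducible iF iF'.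
have [[FA _ _] [FA' _ _] [FFA _ _]] := And3 iF iF' iFF.
exists (A * B)%type, (slicewise F F'), (fun c => [~ rho c.1, sigma c.2])%g; split; split=> //.
- have h1 := family_fst FA' hrho; have h2 := family_snd FA hsigma.
  apply: family_mul => //; first exact: family_inv.
  apply: family_mul => //; first exact: family_inv.
  exact: family_mul.
- move=> _ [[a b] _ <-] /=; apply: commg_derived.
    by apply: rM; exists a.
  by apply: sM; exists b.
- by exists (a1, b1) => //=; rewrite r1 s1 comm1g.
- by exists (af, bg) => //=; rewrite rf sg.
Qed.

(** The elements joined to [1] inside [derived M] form a subgroup, and it contains all commutators:
    those of two families through [1] form a family through [1] over the product of the
    parameters. *)
Lemma connected_derived M : connected_group M -> connected_group (derived M).
Proof.
move=> [Mg Mj]; have dg := derived_subgroup M; split=> //.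
have /is_subgroupP[d1 dM dV] := dg.
suff sub : derived M `<=` [set f | derived M f /\ joined (derived M) f].
  by move=> f /sub[].
apply: derived_min.
  apply/is_subgroupP; split=> [|f g [df jf] [dg' jg]|f [df jf]].
  - by split=> //; exact: joined1.
  - by split; [exact: dM|exact: joinedM].
  - by split; [exact: dV|exact: joinedV].
move=> f g Mf Mg'; split; first exact: commg_derived.
by apply: joined_commg; exact: Mj.
Qed.

Lemma connected_conj M g : connected_group M -> connected_group (conj_set g M).
Proof.
move=> [Mg Mj]; split; first exact: conj_subgroup.
move=> _ [f Mf <-].
have [A [F [rho [[iF hrho rM] [[a1 _ r1] [af _ rf]]]]]] := Mj f Mf.
have [FA _ _] := iF.
exists A, F, (fun a => rho a ^ g)%g; split; split=> //.
- apply: family_mul => //; first exact: family_const.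
  by apply: family_mul => //; exact: family_const.
- by move=> _ [a _ <-]; exists (rho a) => //; apply: rM; exists a.
- by exists a1; rewrite // r1 conj1g.
- by exists af; rewrite // rf.
Qed.

End Joined.

(** * Families over irreducible varieties have bounded degree *)

Section FamilyOfVariety.
Variables (k : closedFieldType) (n : nat).
Local Notation X := (affine_space k n).
Local Notation pt := {ffun 'I_n -> k}.

Lemma irreducible_meet (A : topologicalType) (U V : set A) : irreducible A ->
  open U -> open V -> U !=set0 -> V !=set0 -> U `&` V !=set0.
Proof.
move=> [_ irrA] oU oV [x Ux] [y Vy]; apply: contrapT => /nonemptyPn UV.
have [] := irrA (~` U) (~` V) (open_closedC oU) (open_closedC oV).
- by rewrite -setCI UV setC0.
- by move=> E; have : (~` U) x by rewrite E. 
- by move=> E; have : (~` V) y by rewrite E.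
Qed.

Lemma open_neq0 (A : kspace k) (f : A -> k) : kreg setT f -> open [set a | f a != 0].
Proof. by move=> /(kregV openT)[]; rewrite setTI. Qed.

Lemma kreg_irreducible (A : kspace k) : irreducible A ->
  irreducible_functions (kreg [set: A]).
Proof.
move=> irrA; split.
- split=> [c|f g|f g]; [apply: kreg_cst|apply: kregD|apply: kregM]; exact: openT.
- move=> f g rf rg fa ga.
  by have [a [fa' ga']] := irreducible_meet irrA (open_neq0 rf) (open_neq0 rg) fa ga; exists a.
- move=> f floc; apply: kreg_local => [|a _]; first exact: openT.
  have [p [q [rp rq qa E]]] := floc a.
  have [oq rV] := kregV openT rq; rewrite setTI in oq rV.
  exists [set b | q b != 0], (fun b => p b * (q b)^-1); split=> //.
    apply: kregM => //; apply: kreg_local => // b _.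
    by exists setT, p; split=> //; exact: openT.
  by move=> b _ qb; rewrite -E // mulfK.
Qed.

Lemma slice_kmorphism (A Y : kspace k) (y : Y) :
  @kmorphism k A (prod_kspace A Y) (fun a => (a, y)).
Proof.
apply: gen_kmorphism => D f [[U [g [oU rg -> ->]]]|[V [g [oV rg -> ->]]]].
  by rewrite -comp_preimage.
have -> : (fun a : A => (a, y)) @^-1` (snd @^-1` V) = [set _ | V y] by [].
have o : open [set _ : A | V y].
  have [Vy|nVy] := pselect (V y).
    have -> : [set _ : A | V y] = setT by apply/seteqP; split.
    exact: openT.
  have -> : [set _ : A | V y] = set0 by apply/seteqP; split.
  exact: open0.
by split=> //; exact: (kreg_cst (g y) o).
Qed.

Section Bound.
Variables (A : kspace k) (rho : A -> aut X).
Hypothesis irrA : irreducible A.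
Hypothesis rho_family : aut_family rho.

Lemma family_eval x i : kreg setT (fun a => (rho a x : pt) i).
Proof.
apply: affine_coord_reg.
exact: (@kmorphism_comp _ _ _ _ _ _ (slice_kmorphism A x) rho_family).
Qed.

(* [w] is a denominator in the second variable, [Q] the numerator as a family of
   polynomials parametrized by the first one. *)
Lemma product_normal_form (D : set (A * X)) (f : A * X -> k) :
  gen_alg (fun D f =>
       (exists (U : set A) (g : A -> k),
          [/\ open U, kreg U g, D = fst @^-1` U & f = g \o fst]) \/
       (exists (V : set X) (g : X -> k),
          [/\ open V, kreg V g, D = snd @^-1` V & f = g \o snd])) D f ->
  forall a0 x0, D (a0, x0) -> exists (U : set A) (w : {mpoly k[n]})
    (d : nat) (Q : A -> {mpoly k[n]}),
    [/\ open U, U a0, w.@[(x0 : pt)] != 0, forall a, degle d (Q a) &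
        forall a (x : pt), U a -> w.@[x] != 0 ->
          D (a, x) /\ f (a, x) * w.@[x] = (Q a).@[x]].
Proof.
elim=> {D f} [D f [[U [g [oU rg -> ->]]]|[V [g [oV rg -> ->]]]] a0 x0 /= h
  |c a0 x0 _|D D' f g _ IH _ IH' a0 x0 [h h']|D D' f g _ IH _ IH' a0 x0 [h h']].
- exists U, 1, 0%N, (fun a => (g a)%:MP); split=> //; rewrite ?meval1 ?oner_neq0 //.
    by move=> a; exact: degleC.
  by move=> a x Ua _; rewrite meval1 mulr1 mevalC.
- have [p [q [qx E]]] := affine_reg_local oV rg h.
  exists setT, q, (msize p), (fun=> p); split=> //; [exact: openT|by move=> _; exact: leqnSn|].
  move=> a x _ qx'; have [Vx ->] := E x qx'; split=> //.
  by rewrite divfK.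
- exists setT, 1, 0%N, (fun=> c%:MP); split=> //; rewrite ?meval1 ?oner_neq0 //.
  + exact: openT.
  + by move=> a; exact: degleC.
  + by move=> a x _ _; rewrite meval1 mulr1 mevalC.
- have [U [w [d [Q [oU Ua wx hQ E]]]]] := IH _ _ h.
  have [U' [w' [d' [Q' [oU' Ua' wx' hQ' E']]]]] := IH' _ _ h'.
  exists (U `&` U'), (w * w'), (d + msize w' + (d' + msize w))%N, (fun a => Q a * w' + Q' a * w).
  split=> //; first exact: openI.
  + by rewrite mevalM mulf_neq0.
  + move=> a; apply: degleD.
      apply: (@degle_trans _ _ (d + msize w')); last exact: leq_addr.
      by apply: degleM => //; exact: leqnSn.
    apply: (@degle_trans _ _ (d' + msize w)); last exact: leq_addl.
    by apply: degleM => //; exact: leqnSn.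
  + move=> a x [Ua1 U'a1]; rewrite mevalM mulf_eq0 negb_or => /andP[wx1 wx1'].
    have [Da e] := E a x Ua1 wx1; have [D'a e'] := E' a x U'a1 wx1'.
    by split=> //; rewrite mevalD !mevalM -e -e'; ring.
- have [U [w [d [Q [oU Ua wx hQ E]]]]] := IH _ _ h.
  have [U' [w' [d' [Q' [oU' Ua' wx' hQ' E']]]]] := IH' _ _ h'.
  exists (U `&` U'), (w * w'), (d + d')%N, (fun a => Q a * Q' a).
  split=> //; first exact: openI.
  + by rewrite mevalM mulf_neq0.
  + by move=> a; exact: degleM.
  + move=> a x [Ua1 U'a1]; rewrite mevalM mulf_eq0 negb_or => /andP[wx1 wx1'].
    have [Da e] := E a x Ua1 wx1; have [D'a e'] := E' a x U'a1 wx1'.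
    by split=> //; rewrite !mevalM -e -e'; ring.
Qed.

(** Near [a0] the coordinate [P] satisfies [P * (Q2 a * w1) = Q1 a * w2]. The right-hand side has
    bounded degree and the factor beside [P] is nonzero, so [P] has bounded degree. *)
Lemma local_degree_bound i a0 : exists (U : set A) d,
  [/\ open U, U a0 & forall a, U a -> degle d (autp (rho a) i)].
Proof.
have rPhi : @kreg k (prod_kspace A X) setT (fun c => (rho c.1 c.2 : pt) i).
  exact: affine_coord_reg.
pose x0 : pt := [ffun=> 0].
have [D [al [s [hal hs Dx sx E]]]] := rPhi (a0, x0) I.
have [U1 [w1 [d1 [Q1 [oU1 Ua1 wx1 hQ1 E1]]]]] := product_normal_form hal Dx.
have [U2 [w2 [d2 [Q2 [oU2 Ua2 wx2 hQ2 E2]]]]] := product_normal_form hs Dx.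
(* On [W] the denominator [s] is nonzero at [(a, x0)], so [Q2 a] is not the zero polynomial. *)
pose W : set A := (fun a => (a, x0)) @^-1` (D `&` [set c | s c != 0]).
have oW : open W.
  have [cont _] := slice_kmorphism A (x0 : X).
  have /continuousP := cont; apply; exact: gen_alg_open.
exists (U1 `&` U2 `&` W), (d1 + msize w2)%N; split.
- by apply: openI => //; exact: openI.
- by split.
move=> a [[U1a U2a] [Da sa]].
have Q2n : Q2 a != 0.
  have [_ e] := E2 a x0 U2a wx2.
  by apply: contraNneq sa => z; move: e; rewrite z meval0 => /eqP; rewrite mulf_eq0 (negPf wx2) orbF.
have w1n : w1 != 0 by apply: contraNneq wx1 => ->; rewrite meval0.
have w2n : w2 != 0 by apply: contraNneq wx2 => ->; rewrite meval0.
set P := autp (rho a) i.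
have PE : P * (Q2 a * w1) = Q1 a * w2.
  apply: (@meval_inj_dense _ _ (w1 * w2 * Q2 a)); first by rewrite !mulf_neq0.
  move=> v; rewrite !mevalM !mulf_eq0 !negb_or => /andP[/andP[v1 v2] vQ].
  have [Dv e1] := E1 a v U1a v1; have [_ e2] := E2 a v U2a v2.
  have sv : s (a, v) != 0.
    by apply: contraNneq vQ => z; rewrite -e2 z mul0r.
  have := E (a, v) I Dv sv; rewrite /= autpE -/P => ->.
  by rewrite -e1 -e2; field.
have [->|Pn] := eqVneq P 0; first by rewrite /degle msize0.
have : degle (d1 + msize w2) (Q1 a * w2) by apply: degleM => //; exact: leqnSn.
rewrite /degle -PE; apply: leq_trans.
have Qn : Q2 a * w1 != 0 by rewrite mulf_neq0.
rewrite msizeM //; have : msize (Q2 a * w1) != 0%N by rewrite msize_poly_eq0.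
by move: (msize P) (msize _) => u v; clear; lia.
Qed.

(** Suppose the degree at [a1] exceeds the bound [d0] valid near [a0], and let [m] be the leading
    monomial at [a1]. Near [a1] the coefficient of [m] agrees with a regular function, so by
    irreducibility it is nonzero at some point of [U0], where degrees are at most [d0]. *)
Lemma degree_bound i : exists d, forall a, degle d (autp (rho a) i).
Proof.
have [[a0 _] _] := irrA; have [U0 [d0 [oU0 U0a h0]]] := local_degree_bound i a0.
exists d0 => a1; rewrite /degle leqNgt; apply/negP => lt.
have [U1 [d1 [oU1 U1a h1]]] := local_degree_bound i a1.
set P := autp (rho a1) i in lt.
have Pn : P != 0 by apply: contraTneq lt => ->; rewrite msize0.
pose m := mlead P; have mP : P@_m != 0 by rewrite -mcoeff_msupp mlead_supp.
have [r [z [lam lamE]]] := coef_interpolation k n d1.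
pose g a := \sum_s lam m s * (rho a (z s) : pt) i.
have gE a : U1 a -> g a = (autp (rho a) i)@_m.
  move=> /h1 ha; rewrite (lamE _ ha); apply: eq_bigr => s _.
  by rewrite -autpE.
have [FA _ _] := kreg_irreducible irrA.
have rg : kreg setT g.
  case: (FA) => FC FD FM; apply: subalgebra_sum => // s; apply: (FM) => //.
  exact: family_eval.
have [a [[ga U1a'] U0a']] : ([set a | g a != 0] `&` U1) `&` U0 !=set0.
  apply: irreducible_meet => //; last by exists a0.
    by apply: openI => //; exact: open_neq0.
  by exists a1; split=> //=; rewrite gE.
move: ga; rewrite /= gE // -mcoeff_msupp => /(degle_msupp (h0 a U0a')).
by rewrite leqNgt -ltnS mlead_deg // lt.
Qed.

Lemma polynomial_family_of_variety : polynomial_family (kreg setT) rho.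
Proof.
split; last by move=> x i; exact: family_eval.
have [d hd] := choice degree_bound.
exists (\sum_i d i)%N => a i; apply: degle_trans (hd i a) _.
by rewrite (bigD1 i) //= leq_addr.
Qed.

End Bound.

Lemma connected_subgroup_group (H : set (aut X)) :
  connected_subgroup H -> connected_group H.
Proof.
move=> [Hg Hc]; split=> // f /Hc[A [rho [[_ irrA fam sub] [r1 rf]]]].
exists A, (kreg setT), rho; split; split=> //; first exact: kreg_irreducible.
exact: polynomial_family_of_variety.
Qed.

End FamilyOfVariety.

(** * Monomials in compositions *)

Lemma size_mul_gt1 (R : idomainType) (p q : {poly R}) : p != 0 -> q != 0 ->
  (1 < size (p * q)%R)%N = (1 < size p)%N || (1 < size q)%N.
Proof.
move=> p0 q0; rewrite size_mul //.
have hp : (0 < size p)%N by rewrite size_poly_gt0.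
have hq : (0 < size q)%N by rewrite size_poly_gt0.
by move: hp hq; move: (size p) (size q) => a b; clear; lia.
Qed.

Section Support.
Variables (k : fieldType) (n : nat).
Implicit Types (p q : {mpoly k[n]}) (l j : 'I_n) (m : 'X_{1..n}) (B : {set 'I_n}).

(** [p] viewed as a polynomial in [x_l]; coefficients stay in the full ring, and evaluation at
    ['X_l] recovers [p]. *)
Definition uni l : {mpoly k[n]} -> {poly {mpoly k[n]}} :=
  mmap (polyC \o @mpolyC n k) (fun j => if j == l then 'X else ('X_j)%:P).

HB.instance Definition _ l := GRing.RMorphism.copy (uni l)
  (mmap (polyC \o @mpolyC n k) (fun j => if j == l then 'X else ('X_j)%:P)).

Lemma uni_X l j : uni l 'X_j = if j == l then 'X else ('X_j)%:P.
Proof. by rewrite /uni mmapX mmap1U. Qed.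

Lemma uni_C l c : uni l c%:MP = (c%:MP)%:P.
Proof. by rewrite /uni mmapC. Qed.

Lemma uniE l p : uni l p = \sum_(m <- msupp p)
  (p@_m *: 'X_[m - U_(l) *+ m l])%:P * 'X^(m l).
Proof.
rewrite /uni /mmap; apply: eq_bigr => m _.
rewrite /mmap1 (bigD1 l) //= eqxx -mul_mpolyC polyCM -mulrA; congr (_ * _).
rewrite mulrC; congr (_ * _).
rewrite mpolyXE_id rmorph_prod /= [RHS](bigD1 l) //= mnmBE mulmnE mnm1E eqxx mul1n subnn.
rewrite expr0 mul1r; apply: eq_bigr => j /negPf jl.
by rewrite jl rmorphXn /= mnmBE mulmnE mnm1E eq_sym jl mul0n subn0.
Qed.

Lemma uni_horner l p : (uni l p).['X_l] = p.
Proof.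
rewrite uniE horner_sum {3}(mpolyE p); apply: eq_bigr => m _.
rewrite hornerM hornerC hornerXn -scalerAl mpolyXn -mpolyXD; congr (_ *: 'X_[_]).
apply/mnmP => j; rewrite mnmDE mnmBE mulmnE mnm1E.
by case: eqVneq => [<-|_]; rewrite ?mul1n ?subnn ?mul0n ?subn0 ?addn0.
Qed.

Definition depends l p := has (fun m => m l != 0%N) (msupp p).

Lemma dependsP l p : reflect (exists2 m, m \in msupp p & m l != 0%N) (depends l p).
Proof. exact: hasP. Qed.

Lemma uni_indep l p : ~~ depends l p -> uni l p = p%:P.
Proof.
move=> /hasPn h; rewrite -[in RHS](uni_horner l p) uniE horner_sum rmorph_sum /=.
rewrite !big_seq; apply: eq_bigr => m /h; rewrite negbK => /eqP ->.
by rewrite expr0 mulr1 hornerC.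
Qed.

Lemma depends_size l p : depends l p = (1 < size (uni l p))%N.
Proof.
have [d|/uni_indep ->] := boolP (depends l p); last first.
  by apply/esym/negbTE; rewrite -leqNgt size_polyC_leq1.
apply/esym; rewrite ltnNge; apply/negP => /size1_polyC e.
have [m hm ml] := dependsP _ _ d; move: hm; rewrite mcoeff_msupp -(uni_horner l p) e hornerC.
rewrite uniE coef_sum raddf_sum /= big_seq big1 ?eqxx // => m' _.
rewrite coefCM coefXn; case: eqP => [_|]; last by rewrite mulr0 mcoeff0.
rewrite mulr1 mcoeffZ mcoeffX; case: eqP => [E|]; last by rewrite mulr0.
by case/eqP: ml; rewrite -E mnmBE mulmnE mnm1E eqxx mul1n subnn.
Qed.

Lemma uni_eq0 l p : (uni l p == 0) = (p == 0).
Proof.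
apply/eqP/eqP => [e|->]; last by rewrite rmorph0.
by rewrite -(uni_horner l p) e horner0.
Qed.

Lemma dependsM l p q : p != 0 -> q != 0 ->
  depends l (p * q) = depends l p || depends l q.
Proof.
rewrite -(uni_eq0 l p) -(uni_eq0 l q) => p0 q0.
rewrite !depends_size.
rewrite rmorphM; exact: (size_mul_gt1 p0 q0).
Qed.

Lemma depends_prod l (I : eqType) (r : seq I) (e : I -> nat) (F : I -> {mpoly k[n]}) :
  (forall i, F i != 0) ->
  depends l (\prod_(i <- r) F i ^+ e i) = has (fun i => (e i != 0%N) && depends l (F i)) r.
Proof.
move=> F0; have d1 : depends l 1 = false.
  by apply/negbTE/hasPn => m; rewrite msupp1 inE => /eqP->; rewrite mnm0E.
elim: r => [|i r IH]; first by rewrite big_nil d1.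
rewrite big_cons dependsM ?expf_neq0 //; last by rewrite prodf_seq_neq0; apply/allP => j _; rewrite expf_neq0.
rewrite IH /=; congr (_ || _); elim: (e i) => [|x IHx] /=; first by rewrite expr0 d1.
rewrite exprS dependsM ?expf_neq0 // IHx /=.
by case: (depends l _); rewrite ?andbF.
Qed.

Definition supported B p := [forall l, (l \notin B) ==> ~~ depends l p].

Lemma supportedP B p :
  reflect (forall m, m \in msupp p -> forall l, l \notin B -> m l = 0%N) (supported B p).
Proof.
apply: (iffP forallP) => [h m hm l lB|h l].
  by have /implyP/(_ lB)/hasPn/(_ m hm) := h l; rewrite negbK => /eqP.
by apply/implyP => lB; apply/hasPn => m /h/(_ l lB) ->.
Qed.

Lemma supported_indep B p l : supported B p -> l \notin B -> ~~ depends l p.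
Proof. by move=> /forallP/(_ l)/implyP. Qed.

Lemma supportedD B p q : supported B p -> supported B q -> supported B (p + q).
Proof.
move=> /supportedP hp /supportedP hq; apply/supportedP => m /msuppD_le.
by rewrite mem_cat => /orP[/hp|/hq].
Qed.

Lemma supported0 B : supported B 0.
Proof. by apply/supportedP => m; rewrite msupp0. Qed.

Lemma supportedC B c : supported B c%:MP.
Proof.
apply/supportedP => m; rewrite msuppC; case: ifP => // _.
by rewrite inE => /eqP -> l _; rewrite mnm0E.
Qed.

Lemma supportedM B p q : supported B p -> supported B q -> supported B (p * q).
Proof.
have [->|p0] := eqVneq p 0; first by rewrite mul0r.
have [->|q0] := eqVneq q 0; first by rewrite mulr0.
move=> /forallP hp /forallP hq; apply/forallP => l; apply/implyP => lB.
rewrite dependsM // negb_or.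
by have /implyP/(_ lB) -> := hp l; have /implyP/(_ lB) -> := hq l.
Qed.

Lemma supportedZ B c p : supported B p -> supported B (c *: p).
Proof. by rewrite -mul_mpolyC; apply: supportedM; exact: supportedC. Qed.

Lemma supported_factor B (e : 'X_{1..n}) (F : 'I_n -> {mpoly k[n]}) i :
  (forall j, F j != 0) -> supported B (\prod_j F j ^+ e j) -> e i != 0%N ->
  supported B (F i).
Proof.
move=> F0 /forallP h ei; apply/forallP => l; apply/implyP => lB.
have /implyP/(_ lB) := h l; rewrite depends_prod // => /hasPn/(_ i (mem_index_enum i)).
by rewrite ei.
Qed.

Lemma compmX (g : 'I_n -> {mpoly k[n]}) m : compm g 'X_[m] = \prod_j g j ^+ m j.
Proof.
by rewrite /compm comp_mpolyX; apply: eq_bigr => i _; rewrite tnth_mktuple.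
Qed.

Lemma compmXU (g : 'I_n -> {mpoly k[n]}) j : compm g 'X_j = g j.
Proof. by rewrite /compm comp_mpolyXU -tnth_nth tnth_mktuple. Qed.

Lemma compm_expand (g : 'I_n -> {mpoly k[n]}) p :
  compm g p = \sum_(m <- msupp p) p@_m *: \prod_j g j ^+ m j.
Proof.
rewrite /compm comp_mpolyE; apply: eq_bigr => m _; congr (_ *: _).
by apply: eq_bigr => j _; rewrite tnth_mktuple.
Qed.

Lemma supported_compm B (g : 'I_n -> {mpoly k[n]}) p :
  (forall j, depends j p -> supported B (g j)) -> supported B (compm g p).
Proof.
move=> h; rewrite compm_expand big_seq.
apply: (big_ind (supported B)) => [||m hm]; [exact: supported0|exact: supportedD|].
apply: supportedZ; apply: (big_ind (supported B)) => [||j _]; [|exact: supportedM|].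
  by rewrite -mpolyC1; exact: supportedC.
have [->|mj] := eqVneq (m j) 0%N; first by rewrite expr0 -mpolyC1; exact: supportedC.
have hj : supported B (g j) by apply: h; apply/dependsP; exists m.
elim: (m j) => [|e IH]; first by rewrite expr0 -mpolyC1; exact: supportedC.
by rewrite exprS; exact: supportedM.
Qed.

(** Reduction modulo [x_l], represented by the polynomial free of [x_l]. *)
Definition kill l p : {mpoly k[n]} := compm (fun j => if j == l then 0 else 'X_j) p.

Lemma mcoeff_kill l p m : (kill l p)@_m = if m l == 0%N then p@_m else 0.
Proof.
rewrite /kill compm_expand raddf_sum /=.
have E m' : (\prod_j (if j == l then 0 else 'X_j : {mpoly k[n]}) ^+ m' j) =
    if m' l == 0%N then 'X_[m'] else 0.
  case: eqP => [e|/eqP ne].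
    rewrite [RHS]mpolyXE_id; apply: eq_bigr => j _; case: eqP => // ->.
    by rewrite e !expr0.
  by rewrite (bigD1 l) //= eqxx expr0n (negPf ne) mul0r.
under eq_bigr do rewrite E mcoeffZ.
rewrite {3}(mpolyE p) raddf_sum /= ; case: eqP => [ml|/eqP ml].
  apply: eq_bigr => m' _; rewrite mcoeffZ mcoeffX.
  case: (eqVneq m' m) => [->|ne]; first by rewrite ml eqxx mcoeffX eqxx.
  by case: ifP => _; rewrite ?mcoeffX ?(negPf ne) ?mcoeff0.
rewrite big1 // => m' _; case: eqP => e; last by rewrite mcoeff0 mulr0.
rewrite mcoeffX; case: (eqVneq m' m) => [E'|]; last by rewrite mulr0.
by rewrite E' in e; rewrite e in ml.
Qed.

Lemma msupp_kill l p m : (m \in msupp (kill l p)) = (m \in msupp p) && (m l == 0%N).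
Proof. by rewrite !mcoeff_msupp mcoeff_kill; case: (m l == 0%N); rewrite ?eqxx ?andbT ?andbF. Qed.

Lemma kill_prod l (m : 'X_{1..n}) (g : 'I_n -> {mpoly k[n]}) :
  kill l (\prod_j g j ^+ m j) = \prod_j kill l (g j) ^+ m j.
Proof. by rewrite /kill /compm rmorph_prod /=; apply: eq_bigr => j _; rewrite rmorphXn. Qed.

Lemma kill_eq0 l p : kill l p = 0 -> exists q, p = 'X_l * q.
Proof.
move=> z; exists (\sum_(m <- msupp p) p@_m *: 'X_[m - U_(l)]).
rewrite {1}(mpolyE p) big_distrr /= !big_seq; apply: eq_bigr => m hm.
rewrite -scalerAr -mpolyXD addmC submK // lep1mP.
apply: contraTneq hm => ml; rewrite mcoeff_msupp negbK.
by have := congr1 (mcoeff m) z; rewrite mcoeff_kill ml eqxx mcoeff0 => ->.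
Qed.

End Support.

Section Compositions.
Variables (k : fieldType) (n : nat).
Implicit Types (p q : {mpoly k[n]}) (f g : 'I_n -> {mpoly k[n]}) (m : 'X_{1..n}).

HB.instance Definition _ g := GRing.RMorphism.copy (compm g)
  (comp_mpoly [tuple g i | i < n]).

Lemma compmZ g c p : compm g (c *: p) = c *: compm g p.
Proof. exact: comp_mpolyZ. Qed.

Lemma compmD g p q : compm g (p + q) = compm g p + compm g q.
Proof. exact: comp_mpolyD. Qed.

Lemma compmM g p q : compm g (p * q) = compm g p * compm g q.
Proof. by rewrite /compm rmorphM. Qed.

Lemma compm_sum g (I : Type) (r : seq I) (P : pred I) (F : I -> {mpoly k[n]}) :
  compm g (\sum_(i <- r | P i) F i) = \sum_(i <- r | P i) compm g (F i).
Proof. exact: raddf_sum. Qed.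

Lemma compmC g c : compm g c%:MP = c%:MP.
Proof. exact: comp_mpolyC. Qed.

Lemma compm_comp g f p : compm g (compm f p) = compm (fun j => compm g (f j)) p.
Proof.
rewrite [in LHS](compm_expand f) [RHS]compm_expand compm_sum; apply: eq_bigr => m _.
rewrite compmZ /compm rmorph_prod /=; congr (_ *: _); apply: eq_bigr => j _.
by rewrite rmorphXn.
Qed.

Lemma compm_eq g g' p : (forall j, depends j p -> g j = g' j) -> compm g p = compm g' p.
Proof.
move=> h; rewrite !compm_expand !big_seq; apply: eq_bigr => m hm; congr (_ *: _).
apply: eq_bigr => j _; have [->|mj] := eqVneq (m j) 0%N; first by rewrite !expr0.
by rewrite h //; apply/dependsP; exists m.
Qed.

Definition twist (t : 'I_n -> k) p := compm (fun i => t i *: 'X_i) p.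

Lemma mcoeff_twist t p m : (twist t p)@_m = ('X_[m] : {mpoly k[n]}).@[t] * p@_m.
Proof.
rewrite /twist compm_expand raddf_sum /= [in RHS](mpolyE p) raddf_sum /= big_distrr /=.
apply: eq_bigr => m' _; rewrite !mcoeffZ.
have -> : \prod_j (t j *: 'X_j : {mpoly k[n]}) ^+ m' j = ('X_[m'] : {mpoly k[n]}).@[t] *: 'X_[m'].
  rewrite mevalX [X in _ = _ *: X]mpolyXE_id -mul_mpolyC rmorph_prod -big_split /=.
  by apply: eq_bigr => j _; rewrite exprZn mul_mpolyC.
rewrite mcoeffZ !mcoeffX mulrCA; case: eqP => [->|]; rewrite ?mulr0 //.
Qed.

(* Up to the torus, all the monomials [g ^ m] with [m] in the support of [p]
   contribute to [p (g)]: this is the coefficient of [m'] in [p (t g)], as a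
   polynomial in [t]. *)
Definition twist_coeff p g m' : {mpoly k[n]} :=
  \sum_(m <- msupp p) (p@_m * (\prod_j g j ^+ m j)@_m') *: 'X_[m].

Lemma mcoeff_twist_coeff p g m' m :
  (twist_coeff p g m')@_m = p@_m * (\prod_j g j ^+ m j)@_m'.
Proof.
rewrite /twist_coeff raddf_sum /=; have [hm|hm] := boolP (m \in msupp p).
  rewrite (bigD1_seq m) ?msupp_uniq //= mcoeffZ mcoeffX eqxx mulr1 [X in _ + X]big1 ?addr0 // => m1 ne.
  by rewrite mcoeffZ mcoeffX (negPf ne) mulr0.
rewrite (memN_msupp_eq0 hm) mul0r big_seq [LHS]big1 // => m1 hm1.
rewrite mcoeffZ mcoeffX; case: eqP => [e|]; last by rewrite mulr0.
by rewrite -e hm1 in hm.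
Qed.

Lemma twist_coeffE p g m' t : (compm g (twist t p))@_m' = (twist_coeff p g m').@[t].
Proof.
have -> : twist t p = \sum_(m <- msupp p) (p@_m * ('X_[m] : {mpoly k[n]}).@[t]) *: 'X_[m].
  apply/mpolyP => m; rewrite mcoeff_twist [in LHS](mpolyE p) !raddf_sum /= big_distrr /=.
  apply: eq_bigr => m1 _; rewrite !mcoeffZ mcoeffX.
  by case: eqP => [->|_]; rewrite ?mulr0 // !mulr1 mulrC.
rewrite compm_sum !raddf_sum /=; apply: eq_bigr => m _.
by rewrite compmZ mcoeffZ mevalZ compmX mulrAC.
Qed.

End Compositions.

Section Generic.
Variables (k : closedFieldType) (n : nat).

Lemma common_nonroot (I : eqType) (r : seq I) (F : I -> {mpoly k[n]}) :
  (forall i, i \in r -> F i != 0) ->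
  exists v : {ffun 'I_n -> k}, (forall i, v i != 0) /\ forall i, i \in r -> (F i).@[v] != 0.
Proof.
move=> F0; have : \prod_(i <- r) F i != 0.
  by rewrite prodf_seq_neq0; apply/allP => i /F0.
move=> /mpoly_nonroot[v [v0]]; rewrite rmorph_prod /= prodf_seq_neq0 => /allP h.
by exists v; split.
Qed.

End Generic.

(** * Variables occurring in the coordinates of automorphisms *)

Section Automorphism.
Variables (k : closedFieldType) (n : nat).
Local Notation X := (affine_space k n).
Local Notation pt := {ffun 'I_n -> k}.
Implicit Types (f g h : aut X) (i j l : 'I_n).

Lemma autpV f i : compm (autp f) (autp f^-1%g i) = 'X_i.
Proof.
have := congr1 (fun h => autp h i) (mulVg f); by rewrite autpM autp1.
Qed.

Lemma autpV' f i : compm (autp f^-1%g) (autp f i) = 'X_i.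
Proof.
have := congr1 (fun h => autp h i) (mulgV f); by rewrite autpM autp1.
Qed.

Lemma autpK f p : compm (autp f) (compm (autp f^-1%g) p) = p.
Proof.
rewrite compm_comp (_ : (fun j => _) = fun j => 'X_j); last by apply/funext => j; exact: autpV.
exact: comp_mpoly_id.
Qed.

Lemma autp_neq0 f i : autp f i != 0.
Proof.
apply/eqP => z; have := autpV' f i; rewrite z /compm comp_mpoly0 => /esym/eqP.
by rewrite -msize_poly_eq0 msizeX.
Qed.

Lemma autp_nonconst f i c : autp f i <> c%:MP.
Proof.
move=> e; have := autpV' f i; rewrite e compmC => /(congr1 (fun p : {mpoly k[n]} => msize p)).
by rewrite msizeC msizeX mdeg1; case: eqP.
Qed.

(* A coordinate of an automorphism is an irreducible polynomial. *)
Lemma autp_kill0 f i l : kill l (autp f i) = 0 -> exists c, autp f i = c *: 'X_l.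
Proof.
move=> /kill_eq0[q e].
have E : 'X_i = autp f^-1%g l * compm (autp f^-1%g) q.
  by rewrite -(autpV' f i) e compmM compmXU.
have q0 : compm (autp f^-1%g) q != 0.
  apply/eqP => z; move: E; rewrite z mulr0 => /eqP.
  by rewrite -msize_poly_eq0 msizeX.
have := congr1 (fun p : {mpoly k[n]} => msize p) E; rewrite msizeM ?autp_neq0 // msizeX mdeg1.
have a1 : (1 < msize (autp f^-1%g l))%N.
  rewrite ltnNge; apply/negP => /msize1_polyC; exact: autp_nonconst.
move=> sz; have /msize1_polyC qC : (msize (compm (autp f^-1%g) q) <= 1)%N.
  by move: a1 sz; move: (msize _) (msize _) => a b; clear; lia.
exists ((compm (autp f^-1%g) q)@_0); rewrite e -[in LHS](autpK f q) qC compmC.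
by rewrite mulrC mul_mpolyC mcoeffC eqxx mulr1.
Qed.

(** A coordinate [j] with zero reduction is a multiple of [x_i1]. Its nonzero coefficient at [x_j]
    forces [j = i1], and then [x_i2] does not occur in it. *)
Lemma autp_kill_neq0 f i1 i2 : i1 != i2 -> (forall j, (autp f j)@_U_(j) != 0) ->
  depends i2 (autp f i1) -> forall j, kill i1 (autp f j) != 0.
Proof.
move=> ne hd dep j; apply/eqP => /autp_kill0[c e].
have := hd j; rewrite e mcoeffZ mcoeffXU; case: (eqVneq i1 j) => [E _|_]; last by rewrite mulr0 eqxx.
move: dep; rewrite {1}E e => /dependsP[m]; move=> /msuppZ_le; rewrite msuppX inE => /eqP->.
by rewrite mnm1E (negPf ne).
Qed.

Definition diag_by (t : 'I_n -> k) (d : aut X) : Prop :=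
  forall (x : pt) i, (d x : pt) i = t i * x i.

Lemma diag_exists t : (forall i, t i != 0) -> exists d, diag_by t d.
Proof.
move=> t0; have [||d dE] := @aut_of_polys k n (fun i => t i *: 'X_i) (fun i => (t i)^-1 *: 'X_i).
- by move=> i; rewrite compmZ compmXU scalerA divff // scale1r.
- by move=> i; rewrite compmZ compmXU scalerA mulVf // scale1r.
by exists d => x i; rewrite autpE dE mevalZ mevalXU.
Qed.

Lemma diag_byV t d : (forall i, t i != 0) -> diag_by t d ->
  diag_by (fun i => (t i)^-1) d^-1%g.
Proof.
move=> t0 hd x i; apply: (mulfI (t0 i)); rewrite -hd.
by rewrite -[d _]/((d * d^-1)%g x) mulgV mulrA divff ?mul1r.
Qed.

Lemma diagonal_autp t d : diag_by t d -> autp d = fun i => t i *: 'X_i.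
Proof. by move=> hd; apply: autp_unique => x i; rewrite hd mevalZ mevalXU. Qed.

Lemma autp_mul_diagonal t d f i : diag_by t d ->
  autp (f * d)%g i = twist t (autp f i).
Proof. by move=> hd; rewrite autpM (diagonal_autp hd). Qed.

Lemma autp_diagonal_mul t d f i : diag_by t d ->
  autp (d * f)%g i = t i *: autp f i.
Proof. by move=> hd; rewrite autpM (diagonal_autp hd) compmZ compmXU. Qed.

Lemma autp_conj_diagonal t d f i : (forall i, t i != 0) -> diag_by t d ->
  autp (f ^ d)%g i = (t i)^-1 *: twist t (autp f i).
Proof.
move=> t0 hd; rewrite /conjg (autp_diagonal_mul _ _ (diag_byV t0 hd)).
by rewrite (autp_mul_diagonal _ _ hd).
Qed.

Definition torus_normal (M : set (aut X)) : Prop :=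
  forall t d f, (forall i, t i != 0) -> diag_by t d -> M f -> M (f ^ d)%g.

Definition edge (M : set (aut X)) j i : Prop := exists2 f, M f & depends j (autp f i).

Lemma edge_sub (M N : set (aut X)) j i : M `<=` N -> edge M j i -> edge N j i.
Proof. by move=> MN [f /MN Nf d]; exists f. Qed.

(* The witness is [f ^ d * g] for a generic diagonal [d]. *)
Lemma generic_composition (M : set (aut X)) f g : is_subgroup M -> torus_normal M ->
  M f -> M g -> exists2 h, M h &
    forall i m m', m \in msupp (autp f i) ->
      m' \in msupp (\prod_j autp g j ^+ m j) -> m' \in msupp (autp h i).
Proof.
move=> /is_subgroupP[_ MM _] Mn Mf Mg.
pose r := [seq (im.1, im.2, m') | im <- [seq (i, m) | i <- enum 'I_n, m <- msupp (autp f i)],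
   m' <- msupp (\prod_j autp g j ^+ (im.2 : 'X_{1..n}) j)].
have [c|t [t0 ht]] := @common_nonroot k n _ r
    (fun c => twist_coeff (autp f c.1.1) (autp g) c.2).
  move=> /allpairsPdep[[i m] [m' [/allpairsPdep[i' [m1 [_ hm [-> ->]]]] hm' ->]]] /=.
  apply/eqP => z; have := mcoeff_twist_coeff (autp f i') (autp g) m' m1.
  rewrite z mcoeff0 => /esym/eqP; rewrite mulf_eq0.
  by rewrite !mcoeff_eq0 hm hm'.
have [d hd] := diag_exists t0.
exists (f ^ d * g)%g; first by apply: MM => //; exact: Mn hd Mf.
move=> i m m' hm hm'; rewrite mcoeff_msupp autpM (autp_conj_diagonal _ _ t0 hd) compmZ.
rewrite mcoeffZ mulf_neq0 ?invr_neq0 // twist_coeffE.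
apply: (ht (i, m, m')); apply/allpairsPdep; exists (i, m), m'; split=> //.
by apply/allpairsPdep; exists i, m; split=> //; rewrite mem_enum.
Qed.

(** A product of nonzero polynomials keeps the variables of its factors, and the generic composite
    keeps the monomials of each product. *)
Lemma edge_trans (M : set (aut X)) i j l : is_subgroup M -> torus_normal M ->
  edge M l j -> edge M j i -> edge M l i.
Proof.
move=> Mg Mn [g Mg' dg] [f Mf /dependsP[m hm mj]].
have [h Mh hh] := generic_composition Mg Mn Mf Mg'.
have : depends l (\prod_j autp g j ^+ m j).
  rewrite depends_prod; last by move=> x; exact: autp_neq0.
  by apply/hasP; exists j; rewrite ?mem_index_enum // mj.
move=> /dependsP[m' hm' ml]; exists h => //; apply/dependsP; exists m' => //.
exact: hh hm hm'.
Qed.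

Lemma torus_normal_derived (M : set (aut X)) : torus_normal M -> torus_normal (derived M).
Proof.
move=> Mn t d f t0 hd df.
have : conj_set d (derived M) `<=` derived M.
  move=> _ [x dx <-]; have /(_ x dx) : derived M `<=` [set x | derived M (x ^ d)%g].
    have /is_subgroupP[d1 dM dV] := derived_subgroup M.
    apply: derived_min.
      apply/is_subgroupP; split=> [|u v hu hv|u hu] /=.
      - by rewrite conj1g.
      - by rewrite conjMg; exact: dM.
      - by rewrite conjVg; exact: dV.
    move=> u v Mu Mv /=; rewrite conjRg; apply: commg_derived.
      exact: Mn hd Mu.
    exact: Mn hd Mv.
  by [].
by apply; exists f.
Qed.

End Automorphism.

(** * Absence of two-cycles *)

(** Degrees multiply under composition over a domain, so both polynomials have degree one, and their
    leading coefficients multiply to [1]. *)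
Lemma comp_poly_eqX (R : idomainType) (p q : {poly R}) : p \Po q = 'X ->
  exists a b c, q = a%:P * 'X + b%:P /\ c * a = 1.
Proof.
move=> E; have sz := congr1 (fun r : {poly R} => (size r).-1) E.
rewrite /= size_comp_poly size_polyX /= in sz.
have affine (r : {poly R}) : (size r).-1 = 1%N -> r = (r`_1)%:P * 'X + (r`_0)%:P.
  move=> sr; apply/polyP => -[|[|i]]; rewrite coefD coefMX !coefC //= ?addr0 ?add0r //.
  by apply: nth_default; rewrite -[size r]prednK ?sr //; case: (size r) sr.
have /eqP := sz; rewrite muln_eq1 => /andP[/eqP/affine pE /eqP/affine qE].
exists q`_1, q`_0, p`_1; split=> //.
move: E; rewrite pE comp_polyD comp_polyM comp_polyX !comp_polyC {1}qE => /polyP/(_ 1%N).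
by rewrite !(coefD, coefCM, coefMX, coefC, coefX) /= !(addr0, add0r, mulr0, mulr1).
Qed.

Section Triangular.
Variables (k : closedFieldType) (n : nat).
Local Notation X := (affine_space k n).
Implicit Types (f g h : aut X) (i j l : 'I_n) (M : set (aut X)).

(** Substituting [f] into the [i]-th coordinate of its inverse gives [x_i]. That coordinate involves
    only [x_i] and [Q], and the [Q]-coordinates of [f] are free of [x_i], so in the variable [x_i]
    this is a composition equal to ['X]. Hence the [i]-th coordinate of [f] is affine in [x_i], with
    a unit and therefore constant coefficient. *)
Lemma triangular_coordinate M (i : 'I_n) (Q : {set 'I_n}) : is_subgroup M -> i \notin Q ->
  (forall f j, M f -> j \in Q -> supported Q (autp f j)) ->
  (forall f, M f -> supported (i |: Q) (autp f i)) ->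
  forall f, M f -> exists (c : k) r, [/\ c != 0, supported Q r & autp f i = c *: 'X_i + r].
Proof.
move=> /is_subgroupP[_ _ MV] iQ hQ hi f Mf.
pose F := autp f; pose p := autp f^-1%g i.
have hp : supported (i |: Q) p by apply: hi; exact: MV.
have hdep j : depends j p -> j != i -> j \in Q.
  move=> dj ji; apply: contraLR dj => jQ; apply: (supported_indep hp).
  by rewrite !inE negb_or ji.
have key : map_poly (compm F) (uni i p) \Po uni i (F i) = uni i (compm F p).
  have GE : uni i (F i) = uni i (F i) by [].
  move: {1 3}(uni i (F i)) GE => G GE.
  rewrite (uniE i p) (compm_expand F) [RHS]rmorph_sum [map_poly _ _]rmorph_sum /=.
  rewrite [LHS]raddf_sum /= [LHS]big_seq [RHS]big_seq.
  apply: eq_bigr => m hm.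
  rewrite -!mul_mpolyC [RHS]rmorphM /= uni_C [in RHS]rmorph_prod /=.
  rewrite [map_poly _ _]rmorphM /= map_polyC map_polyXn /= comp_polyM comp_polyC comp_Xn_poly.
  rewrite compmM compmC polyCM -mulrA; congr (_ * _).
  rewrite compmX rmorph_prod /= (bigD1 i) //= mnmBE mulmnE mnm1E eqxx mul1n subnn expr0 mul1r.
  rewrite [RHS](bigD1 i) //= [in RHS]rmorphXn /= -GE mulrC; congr (_ * _).
  apply: eq_bigr => j ji; rewrite mnmBE mulmnE mnm1E eq_sym (negPf ji) mul0n subn0 !rmorphXn /=.
  have [->|mj] := eqVneq (m j) 0%N; first by rewrite !expr0.
  congr (_ ^+ _); rewrite uni_indep //; apply: (@supported_indep _ _ Q) => //.
  by apply: hQ => //; apply: hdep => //; apply/dependsP; exists m.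
have [a [b [c [E ca]]]] : exists a b c, uni i (F i) = a%:P * 'X + b%:P /\ c * a = 1.
  apply: (@comp_poly_eqX _ (map_poly (compm F) (uni i p))).
  by rewrite key /p autpV uni_X eqxx.
have sa : msize a == 1%N.
  have a0 : a != 0 by apply: contraTneq (oner_neq0 {mpoly k[n]}) => a0; rewrite -ca a0 mulr0 eqxx.
  have c0 : c != 0 by apply: contraTneq (oner_neq0 {mpoly k[n]}) => c0; rewrite -ca c0 mul0r eqxx.
  have := congr1 (fun p : {mpoly k[n]} => msize p) ca; rewrite msizeM // msize1.
  have : msize a != 0%N by rewrite msize_poly_eq0.
  have : msize c != 0%N by rewrite msize_poly_eq0.
  by move: (msize a) (msize c) => u v; clear; lia.
have [a' a'0 aE] := msize_poly1P _ sa.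
have FE : F i = a' *: 'X_i + b.
  by rewrite -(uni_horner i (F i)) E hornerD hornerM !hornerC hornerX aE mul_mpolyC.
exists a', b; split=> //.
have hb : supported (i |: Q) b.
  have -> : b = F i + (- a') *: 'X_i by rewrite FE scaleNr addrAC subrr add0r.
  apply: supportedD; first exact: hi.
  apply: supportedZ; apply/supportedP => m; rewrite msuppX inE => /eqP-> l.
  by rewrite mnm1E !inE negb_or eq_sym => /andP[/negPf->].
apply/forallP => l; apply/implyP => lQ.
have [->|li] := eqVneq l i; last by apply: (supported_indep hb); rewrite !inE negb_or li.
have : uni i b = b%:P.
  have := E; rewrite FE -mul_mpolyC rmorphD rmorphM /= uni_C uni_X eqxx -aE.
  exact: addrI.
by rewrite depends_size => ->; rewrite -leqNgt size_polyC_leq1.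
Qed.

Lemma irreducible_seq (A : Type) (F : set (A -> k)) (I : Type) (r : seq I) (phi : I -> A -> k) :
  irreducible_functions F -> (exists a : A, True) -> (forall x, F (phi x)) ->
  (forall x, exists a, phi x a != 0) ->
  exists a, all (fun x => phi x a != 0) r.
Proof.
move=> [FA Fdom _] [a0 _] Fphi nz.
have [a] : exists a, \prod_(x <- r) phi x a != 0.
  elim: r => [|x r [a ha]]; first by exists a0; rewrite big_nil oner_neq0.
  have [b [hb hb']] := Fdom _ _ (Fphi x) (subalgebra_prod FA r predT Fphi) (nz x) (ex_intro _ a ha).
  by exists b; rewrite big_cons mulf_neq0.
by rewrite prodf_seq_neq0 => ha; exists a.
Qed.

(** In the product family, the diagonal coefficients are nonzero at the identity and the two chosen
    ones at [f1] and [f2]; irreducibility makes them all nonzero at one parameter. *)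
Lemma generic_element M f1 f2 i1 i2 : connected_group M -> M f1 -> M f2 ->
  depends i1 (autp f1 i2) -> depends i2 (autp f2 i1) ->
  exists h, [/\ M h, forall j, (autp h j)@_U_(j) != 0,
    depends i1 (autp h i2) & depends i2 (autp h i1)].
Proof.
move=> [Mg Mj] M1 M2 /dependsP[m1 hm1 m1i] /dependsP[m2 hm2 m2i].
have [A [F [rho [[iF hrho rM] [[a1 _ r1] [af _ rf]]]]]] := Mj _ M1.
have [B [F' [sigma [[iF' hsigma sM] [[b1 _ s1] [bg _ sg]]]]]] := Mj _ M2.
have iFF := slicewise_irreducible iF iF'.
have [[FA _ _] [FA' _ _] [FFA _ _]] := And3 iF iF' iFF.
pose tau (c : A * B) := (rho c.1 * sigma c.2)%g.
have htau : polynomial_family (slicewise F F') tau.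
  by apply: family_mul => //; [exact: family_fst|exact: family_snd].
have tM c : M (tau c).
  have /is_subgroupP[_ MM _] := Mg.
  by apply: MM; [apply: rM; exists c.1|apply: sM; exists c.2].
pose cs : 'I_n + bool -> 'I_n * 'X_{1..n} := fun x => match x with
  | inl j => (j, U_(j)%MM) | inr true => (i2, m1) | inr false => (i1, m2) end.
have [|||c /allP hc] := @irreducible_seq _ _ _ (enum {: 'I_n + bool})
    (fun x c => (autp (tau c) (cs x).1)@_(cs x).2) iFF.
- by exists (a1, b1).
- by move=> x; exact: family_coef.
- move=> [j|[]] /=.
  + exists (a1, b1); rewrite /tau /= r1 s1 mulg1 autp1 mcoeffXU eqxx.
    exact: oner_neq0.
  + by exists (af, b1); rewrite /tau /= rf s1 mulg1 -mcoeff_msupp.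
  + by exists (a1, bg); rewrite /tau /= r1 sg mul1g -mcoeff_msupp.
exists (tau c); split=> //.
- by move=> j; exact: (hc (inl j) (mem_enum _ _)).
- apply/dependsP; exists m1 => //; rewrite mcoeff_msupp.
  exact: (hc (inr true) (mem_enum _ _)).
- apply/dependsP; exists m2 => //; rewrite mcoeff_msupp.
  exact: (hc (inr false) (mem_enum _ _)).
Qed.

End Triangular.

(** * Laurent polynomials and the scaling of one variable *)

Section Laurent.
Variable (k : closedFieldType).

(** The value at [0] is unconstrained, so families over the punctured line may be indexed by [k]
    with a dummy value there. *)
Definition laurent : set (k -> k) := [set phi | exists (N : nat) (p : {poly k}),
  forall s, s != 0 -> s ^+ N * phi s = p.[s]].

Lemma laurent_subalgebra : subalgebra laurent.
Proof.
split=> [c|f g [N [p hp]] [N' [p' hp']]|f g [N [p hp]] [N' [p' hp']]].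
- by exists 0%N, c%:P => s _; rewrite hornerC mul1r.
- exists (N + N')%N, (p * 'X^N' + p' * 'X^N) => s s0.
  by rewrite hornerD !hornerM !hornerXn -hp // -hp' // exprD; ring.
- exists (N + N')%N, (p * p') => s s0.
  by rewrite hornerM -hp // -hp' // exprD; ring.
Qed.

Lemma laurent_id : laurent id.
Proof. by exists 0%N, 'X => s _; rewrite hornerX mul1r. Qed.

Lemma laurent_inv : laurent (fun s => s^-1).
Proof. by exists 1%N, 1 => s s0; rewrite hornerC expr1 divff. Qed.

(** The numerator has no root except [0], so over an algebraically closed field it is a monomial. *)
Lemma laurent_unit (phi : k -> k) : laurent phi -> (forall s, s != 0 -> phi s != 0) ->
  exists (u v : nat) c, c != 0 /\ forall s, s != 0 -> s ^+ u * phi s = c * s ^+ v.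
Proof.
move=> [N [p hp]] nz.
have p1 : p.[1] != 0 by rewrite -hp ?oner_neq0 // expr1n mul1r nz ?oner_neq0.
have p0 : p != 0 by apply: contraNneq p1 => ->; rewrite horner0.
have [rs pE] := closed_field_poly_normal p.
have rs0 z : z \in rs -> z = 0.
  move=> zrs; apply/eqP/negPn/negP => z0.
  have : p.[z] = 0 by apply/eqP/(_ : root p z); rewrite pE rootZ ?lead_coef_eq0 // root_prod_XsubC.
  by rewrite -hp // => /eqP; rewrite mulf_eq0 expf_eq0 (negPf z0) andbF (negPf (nz z z0)).
exists N, (size rs), (lead_coef p); split; first by rewrite lead_coef_eq0.
move=> s s0; rewrite hp // {1}pE hornerZ; congr (_ * _); rewrite horner_prod.
elim: (rs) rs0 => [|z t IH] rs0; first by rewrite big_nil.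
rewrite big_cons IH => [|x xt]; last by apply: rs0; rewrite inE xt orbT.
by have := rs0 z (mem_head _ _) => ->; rewrite hornerXsubC subr0 exprS.
Qed.

Lemma eq_poly_nonzero (p q : {poly k}) : (forall s, s != 0 -> p.[s] = q.[s]) -> p = q.
Proof.
move=> E; apply/eqP; rewrite -subr_eq0; apply/negPn/negP => nz.
have [s] : exists s, ~~ root ((p - q) * 'X) s.
  by apply/closed_nonrootP; rewrite mulf_neq0 ?polyX_eq0.
rewrite rootM negb_or !rootE hornerX => /andP[+ s0].
by rewrite hornerD hornerN E // subrr eqxx.
Qed.

End Laurent.

Section Scaling.
Variables (k : closedFieldType) (n : nat).
Local Notation X := (affine_space k n).
Local Notation pt := {ffun 'I_n -> k}.
Implicit Types (f g h : aut X) (i j l : 'I_n).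

Lemma laurent_ext (phi psi : k -> k) : (forall s, s != 0 -> phi s = psi s) ->
  laurent phi -> laurent psi.
Proof. by move=> E [N [p hp]]; exists N, p => s s0; rewrite -E // hp. Qed.

Lemma laurent_aut h (x : k -> pt) : (forall i, laurent (fun s => x s i)) ->
  forall i, laurent (fun s => (h (x s) : pt) i).
Proof.
move=> hx i; rewrite (_ : (fun s => _) = fun s => (autp h i).@[x s]).
  by apply: subalgebra_meval => //; exact: laurent_subalgebra.
by apply/funext => s; rewrite autpE.
Qed.

Variables (i1 : 'I_n).

Definition scale (s : k) i : k := if i == i1 then s else 1.

Lemma scale_neq0 s i : s != 0 -> scale s i != 0.
Proof. by move=> s0; rewrite /scale; case: ifP => // _; exact: oner_neq0. Qed.

Lemma scaleV s : (fun i => (scale s i)^-1) = scale s^-1.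
Proof. by apply/funext => i; rewrite /scale; case: ifP; rewrite ?invr1. Qed.

Lemma laurent_scale (d : k -> aut X) (c : k -> k) (x : k -> pt) :
  laurent c -> (forall s, s != 0 -> diag_by (scale (c s)) (d s)) ->
  (forall i, laurent (fun s => x s i)) ->
  forall i, laurent (fun s => (d s (x s) : pt) i).
Proof.
move=> lc hd hx i; have [LC LD LM] := laurent_subalgebra k.
apply: (@laurent_ext (fun s => scale (c s) i * x s i)) => [s s0|]; first by rewrite hd.
rewrite /scale; case: eqP => _; apply: LM => //; exact: LC.
Qed.

Lemma meval_scale s m : ('X_[m] : {mpoly k[n]}).@[scale s] = s ^+ m i1.
Proof.
rewrite mevalX (bigD1 i1) //= /scale eqxx big1 ?mulr1 // => j /negPf->.
by rewrite expr1n.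
Qed.

Lemma supported_twist (B : {set 'I_n}) t (p : {mpoly k[n]}) : supported B p -> supported B (twist t p).
Proof.
move=> /supportedP h; apply/supportedP => m hm; apply: h; move: hm.
by rewrite !mcoeff_msupp mcoeff_twist mulf_eq0 negb_or => /andP[].
Qed.

(* For [s] acting on [x_i1] only and [m'] not in the variables of [B], the
   coefficient of [m'] in the coordinate [i2] of the identity
   [f * d s * g = n s * (d s * g * f ^ d s)], where [n s] is the commutator of [f]
   and [d s * g * (d s)^-1] up to inverses, reads
   [upper_part s = a s * s ^ m' i1 * (lower_part s / s ^ e)]; the factor [a s] is a
   unit among Laurent polynomials, hence a monomial. *)
Definition upper_part (f g : aut X) i (m' : 'X_{1..n}) : {poly k} :=
  \sum_(m <- msupp (autp f i))
    ((autp f i)@_m * (\prod_j autp g j ^+ m j)@_m') *: 'X^(m i1).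

Lemma upper_partE f g i m' s :
  (twist_coeff (autp f i) (autp g) m').@[scale s] = (upper_part f g i m').[s].
Proof.
rewrite raddf_sum /= horner_sum; apply: eq_bigr => m _.
by rewrite mevalZ meval_scale hornerZ hornerXn.
Qed.

Lemma coef_upper_part f g i m' e : (upper_part f g i m')`_e =
  \sum_(m <- msupp (autp f i) | m i1 == e)
    (autp f i)@_m * (\prod_j autp g j ^+ m j)@_m'.
Proof.
rewrite coef_sum [RHS]big_mkcond /=; apply: eq_bigr => m _.
by rewrite coefZ coefXn eq_sym; case: eqP; rewrite ?mulr1 ?mulr0.
Qed.

Definition lower_part (f g : aut X) i e (m' : 'X_{1..n}) : {poly k} :=
  \sum_(m <- msupp (autp g i))
    ((autp g i)@_m * (\prod_j autp f j ^+ m j)@_m') *: 'X^(e - m i1).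

Lemma lower_partE f g i e m' s : s != 0 ->
  (forall m, m \in msupp (autp g i) -> m i1 <= e)%N ->
  s ^+ e * (twist_coeff (autp g i) (autp f) m').@[fun j => (scale s j)^-1] =
  (lower_part f g i e m').[s].
Proof.
move=> s0 he; rewrite raddf_sum /= horner_sum big_distrr /= !big_seq.
apply: eq_bigr => m /he hm.
rewrite scaleV mevalZ meval_scale hornerZ hornerXn mulrCA; congr (_ * _).
by rewrite exprVn -(subnK hm) exprD mulfK ?expf_neq0 ?subnK // addnK.
Qed.

Lemma scaling_comparison (M : set (aut X)) (B : {set 'I_n}) i2 f g (e : nat) :
  is_subgroup M -> torus_normal M -> i2 != i1 -> i2 \notin B ->
  (forall h b, M h -> b \in B -> supported B (autp h b)) ->
  (forall h, derived M h -> exists c r,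
      [/\ c != 0, supported B r & autp h i2 = c *: 'X_i2 + r]) ->
  M f -> M g -> (forall m, m \in msupp (autp g i2) -> m i1 <= e)%N ->
  exists (u v : nat) (c : k), c != 0 /\
    forall (m' : 'X_{1..n}) l, l \notin B -> m' l != 0%N ->
      'X^(u + e) * upper_part f g i2 m' =
      c *: ('X^(v + m' i1) * lower_part f g i2 e m').
Proof.
move=> Mg Mn i21 i2B hB hN Mf Mg' he; have /is_subgroupP[M1 MM MV] := Mg.
have /choice[d hd] s : exists d, s != 0 -> diag_by (scale s) d.
  have [->|s0] := eqVneq s 0; first by exists 1%g.
  by have [d hd] := diag_exists (fun i => scale_neq0 i s0); exists d.
have hd' s : s != 0 -> diag_by (scale s^-1) (d s)^-1%g.
  by move=> s0; rewrite -scaleV; apply: diag_byV; [move=> i; exact: scale_neq0|exact: hd].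
pose gs s := (g ^ (d s)^-1)%g.
have Mgs s : s != 0 -> M (gs s).
  by move=> s0; apply: Mn (hd' s s0) Mg' => i; rewrite scale_neq0 // invr_eq0.
pose N s := [~ f^-1, (gs s)^-1]%g.
have hNs s : s != 0 -> derived M (N s).
  by move=> s0; apply: commg_derived; apply: MV => //; exact: Mgs.
have NE s : (N s * (gs s * f) = f * gs s)%g.
  rewrite /N; move: (gs s) => y; rewrite /commg /conjg !invgK !mulgA.
  by rewrite !mulgVK.
have gsd s : (gs s * d s = d s * g)%g.
  by rewrite /gs /conjg invgK !mulgA mulgVK.
have /choice[ar har] s : exists ar : k * {mpoly k[n]}, s != 0 ->
    [/\ ar.1 != 0, supported B ar.2 & autp (N s) i2 = ar.1 *: 'X_i2 + ar.2].
  have [->|s0] := eqVneq s 0; first by exists (0, 0).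
  by have [a [r h]] := hN _ (hNs s s0); exists (a, r).
pose a s := (ar s).1.
(* As the remainder does not involve [x_i2], [a s] is the difference of the [i2]-th coordinates of
   [N s] at the [i2]-th unit vector and at [0]. Both are Laurent, since [N s] is a word in fixed
   automorphisms, [d s] and its inverse. *)
have la : laurent a.
  pose v1 : pt := [ffun i => (i == i2)%:R].
  pose Nx (x : pt) s : k := (f (d s (g ((d s)^-1%g (f^-1%g (d s (g^-1%g ((d s)^-1%g x))))))) : pt) i2.
  have lNx x : laurent (Nx x).
    have [LC _ _] := laurent_subalgebra k.
    have ld := laurent_scale (laurent_id k) hd.
    have ld' := laurent_scale (laurent_inv k) hd'.
    apply: laurent_aut => i3; apply: (ld) => i4; apply: laurent_aut => i5; apply: (ld') => i6.
    apply: laurent_aut => i7; apply: (ld) => i8; apply: laurent_aut => i9; apply: (ld') => i10.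
    exact: LC.
  apply: (@laurent_ext (fun s => Nx v1 s + (-1) * Nx [ffun=> 0] s)) => [s s0|]; last first.
    by have [LC LD LM] := laurent_subalgebra k; apply: (LD) => //; apply: LM.
  have NxE x : Nx x s = (N s x : pt) i2.
    congr (fun_of_fin _ i2).
    have -> : N s = (f * (d s * (g * ((d s)^-1 * (f^-1 * (d s * (g^-1 * (d s)^-1)))))))%g.
      by rewrite /N /gs; move: (d s) => y; rewrite /commg /conjg !(invgM, invgK) -!mulgA.
    by [].
  have [_ hr E] := har s s0.
  rewrite !NxE !autpE E !mevalD !mevalZ !mevalXU !ffunE eqxx mulr1 mulr0 add0r mulN1r.
  rewrite -addrA (_ : _.@[v1] = (ar s).2.@[[ffun=> 0]]) ?subrr ?addr0 //.
  rewrite !mevalE !big_seq; apply: eq_bigr => m hm; congr (_ * _).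
  apply: eq_bigr => i _; rewrite !ffunE; case: eqP => [->|//].
  by have /supportedP/(_ m hm i2 i2B) -> := hr; rewrite !expr0.
have [|u [v [c [c0 hc]]]] := @laurent_unit k a la.
  by move=> s s0; have [] := har s s0.
exists u, v, c; split=> // m' l lB ml.
apply: eq_poly_nonzero => s s0.
pose G := (d s * (g * f ^ d s))%g.
have AE : (f * d s * g = N s * G)%g.
  have -> : G = (gs s * f * d s)%g by rewrite /G /gs /conjg invgK !mulgA.
  by rewrite [RHS]mulgA NE -[RHS]mulgA gsd [RHS]mulgA.
have E1 : (autp (f * d s * g)%g i2)@_m' = (upper_part f g i2 m').[s].
  by rewrite autpM (autp_mul_diagonal _ _ (hd s s0)) twist_coeffE upper_partE.
(* The remainder of [N s] is a polynomial in [x_B] and stays one after substituting [G], so it does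
   not contribute to the coefficient of [m']. *)
have E2 : (autp (N s * G)%g i2)@_m' = a s * (autp G i2)@_m'.
  have [_ hr E] := har s s0; rewrite autpM E compmD compmZ compmXU mcoeffD mcoeffZ.
  have : supported B (compm (autp G) (ar s).2).
    apply: supported_compm => j dj.
    have jB : j \in B by apply: contraLR dj => jB; exact: supported_indep hr jB.
    have -> : G = (gs s * f * d s)%g by rewrite /G /gs /conjg invgK !mulgA.
    rewrite (autp_mul_diagonal _ _ (hd s s0)); apply: supported_twist; apply: hB => //.
    by apply: MM => //; exact: Mgs.
  move=> /supportedP hs; rewrite [X in _ + X]memN_msupp_eq0 ?addr0 //.
  by apply: contra ml => /hs/(_ l lB) ->.
have E3 : (autp G i2)@_m' = s ^+ m' i1 *
    (twist_coeff (autp g i2) (autp f) m').@[fun j => (scale s j)^-1].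
  rewrite (autp_diagonal_mul _ _ (hd s s0)) {1}/scale (negPf i21) scale1r autpM.
  have -> : autp (f ^ d s)%g = fun j => twist (scale s) ((scale s j)^-1 *: autp f j).
    apply/funext => j; rewrite (autp_conj_diagonal _ _ (fun i => scale_neq0 i s0) (hd s s0)).
    by rewrite /twist compmZ.
  have -> : compm (fun j => twist (scale s) ((scale s j)^-1 *: autp f j)) (autp g i2)
     = twist (scale s) (compm (autp f) (twist (fun j => (scale s j)^-1) (autp g i2))).
    rewrite {2 3}/twist (compm_comp (autp f)) compm_comp.
    apply: compm_eq => j _; rewrite -/(twist _ _); congr (twist _ _).
    by rewrite [compm (autp f) _]compmZ compmXU.
  by rewrite mcoeff_twist meval_scale twist_coeffE.
rewrite hornerM hornerXn -E1 AE E2 E3 hornerZ hornerM hornerXn -lower_partE //.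
rewrite !exprD; have := hc s s0.
move: (s ^+ u) (s ^+ v) (s ^+ e) (a s) (s ^+ m' i1) (_.@[_]) => x1 x2 x3 x4 x5 x6 E.
transitivity (x1 * x4 * (x3 * x5 * x6)); first by clear; ring.
by rewrite E; clear; ring.
Qed.

(** [lower_part] has degree at most [e], so a nonzero coefficient of index [j] puts [u + e + j]
    between [v + m' i1] and [v + m' i1 + e]. As [u] and [v] do not depend on [m'], different
    monomials can be compared. *)
Lemma scaling_bounds (M : set (aut X)) (B : {set 'I_n}) i2 f g (e : nat) :
  is_subgroup M -> torus_normal M -> i2 != i1 -> i2 \notin B ->
  (forall h b, M h -> b \in B -> supported B (autp h b)) ->
  (forall h, derived M h -> exists c r,
      [/\ c != 0, supported B r & autp h i2 = c *: 'X_i2 + r]) ->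
  M f -> M g -> (forall m, m \in msupp (autp g i2) -> m i1 <= e)%N ->
  exists (u v : nat), forall (m' : 'X_{1..n}) l (j : nat), l \notin B -> m' l != 0%N ->
    (upper_part f g i2 m')`_j != 0 ->
    (v + m' i1 <= u + e + j)%N /\ (u + j <= v + m' i1)%N.
Proof.
move=> Mg Mn i21 i2B hB hN Mf Mg' he.
have [u [v [c [c0 E]]]] := scaling_comparison Mg Mn i21 i2B hB hN Mf Mg' he.
exists u, v => m' l j lB ml nz.
have := congr1 (fun p : {poly k} => p`_(u + e + j)) (E m' l lB ml).
rewrite /= coefXnM addKn ltnNge leq_addr /= coefZ coefXnM => Ej.
move: nz; rewrite Ej; case: ltnP => [_|le nz]; first by rewrite mulr0 eqxx.
split=> //; rewrite leqNgt; apply/negP => lt; move: nz.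
rewrite nth_default ?mulr0 ?eqxx //.
have sz : (size (lower_part f g i2 e m') <= e.+1)%N.
  apply: (leq_trans (size_sum _ _ _)); apply/bigmax_leqP_seq => m _ _.
  apply: (leq_trans (size_scale_leq _ _)); rewrite size_polyXn ltnS.
  exact: leq_subr.
apply: (leq_trans sz); move: lt; move: (m' i1) => x; clear; lia.
Qed.

End Scaling.

Section TwoCycles.
Variables (k : closedFieldType) (n : nat).
Local Notation X := (affine_space k n).
Implicit Types (f g h : aut X) (i j l : 'I_n) (M : set (aut X)).

Lemma prod_mnm1 (F : 'I_n -> {mpoly k[n]}) i : \prod_j F j ^+ (U_(i)%MM j) = F i.
Proof. by rewrite -compmX compmXU. Qed.

(** As a polynomial in [t], this is up to the factor [t i] the coefficient of index [j] of
    [upper_part] once [h] is conjugated by the diagonal [t]; a generic [t] thus makes prescribed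
    coefficients nonzero. *)
Definition upper_coeff i1 h g i (j : nat) (m' : 'X_{1..n}) : {mpoly k[n]} :=
  \sum_(m <- msupp (autp h i) | m i1 == j)
    ((autp h i)@_m * (\prod_l autp g l ^+ m l)@_m') *: 'X_[m].

Lemma upper_coeff_neq0 i1 h g i (m m' : 'X_{1..n}) :
  m \in msupp (autp h i) -> m' \in msupp (\prod_l autp g l ^+ m l) ->
  upper_coeff i1 h g i (m i1) m' != 0.
Proof.
move=> hm hm'; apply: contraTneq hm => z; rewrite mcoeff_msupp negbK.
have := congr1 (mcoeff m) z; rewrite mcoeff0 raddf_sum /= => E.
have [hm|/memN_msupp_eq0 -> //] := boolP (m \in msupp (autp h i)).
move: E; rewrite (big_rem m hm) /= eqxx mcoeffZ mcoeffX eqxx mulr1 [X in _ + X]big_seq_cond [X in _ + X]big1 ?addr0.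
  by move=> /eqP; rewrite mulf_eq0 [X in _ || X]mcoeff_eq0 hm' orbF.
move=> m1 /andP[hm1 _]; rewrite mcoeffZ mcoeffX.
case: (eqVneq m1 m) hm1 => [->|]; last by rewrite mulr0.
by rewrite mem_rem_uniqF ?msupp_uniq.
Qed.

Lemma coef_upper_part_conj i1 t d h g i (j : nat) m' : (forall l, t l != 0) -> diag_by t d ->
  (upper_part i1 (h ^ d)%g g i m')`_j = (t i)^-1 * (upper_coeff i1 h g i j m').@[t].
Proof.
move=> t0 hd; rewrite coef_upper_part raddf_sum /= big_distrr /=.
have E m : (autp (h ^ d)%g i)@_m = (t i)^-1 * (('X_[m] : {mpoly k[n]}).@[t] * (autp h i)@_m).
  by rewrite (autp_conj_diagonal _ _ t0 hd) mcoeffZ mcoeff_twist.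
have tX m : ('X_[m] : {mpoly k[n]}).@[t] != 0.
  by rewrite mevalX; apply/prodf_neq0 => l _; rewrite expf_neq0.
rewrite (perm_big (msupp (autp h i))) /=; last first.
  apply: uniq_perm; rewrite ?msupp_uniq // => m.
  by rewrite !mcoeff_msupp E !mulf_eq0 invr_eq0 (negPf (t0 i)) (negPf (tX m)).
apply: eq_bigr => m _; rewrite E mevalZ -!mulrA; congr (_ * _).
by rewrite mulrC -mulrA.
Qed.

(** [h] carries the two-cycle and all diagonal terms, and [g] contains every monomial of every
    product arising in the composite of [h] with itself. By the scaling bounds, the product [g ^ m0]
    is modulo [x_i1] a polynomial in [x_B], and so is its factor [g_i1]. As [g_i1] contains the
    monomials of [h ^ u0], so is [h_i2]; yet [h_i2] contains the monomial [x_i2]. *)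
Lemma no_two_cycle M (B : {set 'I_n}) i1 i2 :
  connected_group M -> torus_normal M -> i2 != i1 -> i1 \notin B -> i2 \notin B ->
  (forall h b, M h -> b \in B -> supported B (autp h b)) ->
  (forall h, derived M h -> exists c r,
      [/\ c != 0, supported B r & autp h i2 = c *: 'X_i2 + r]) ->
  edge M i1 i2 -> ~ edge M i2 i1.
Proof.
move=> Mc Mn i21 i1B i2B hB hN [f1 M1 d1] [f2 M2 d2].
have Mg := Mc.1.
have [h [Mh hU hd1 hd2]] := generic_element Mc M1 M2 d1 d2.
have [g Mg' hg] := generic_composition Mg Mn Mh Mh.
have hU' j : U_(j)%MM \in msupp (autp h j) by rewrite mcoeff_msupp.
have sub j m : m \in msupp (autp h j) -> m \in msupp (autp g j).
  by move=> hm; apply: (hg j _ m (hU' j)); rewrite prod_mnm1.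
have [m0 hm0 m0i] := dependsP _ _ hd1; have [u0 hu0 u0i] := dependsP _ _ hd2.
have [e [me hme ee] emax] : exists2 e, exists2 m, m \in msupp (autp g i2) & m i1 = e &
    forall m, m \in msupp (autp g i2) -> (m i1 <= e)%N.
  pose P e := has (fun m : 'X_{1..n} => m i1 == e) (msupp (autp g i2)).
  have exP : exists e, P e by exists (m0 i1); apply/hasP; exists m0; [exact: sub|].
  have leP e : P e -> (e <= msize (autp g i2))%N.
    move=> /hasP[m /msize_mdeg_lt hm /eqP <-]; apply: leq_trans (ltnW hm).
    by rewrite mdegE (bigD1 i1) //= leq_addr.
  have [e /hasP[m hm /eqP me] emax] := ex_maxnP exP leP.
  by exists e; [exists m|move=> m' hm'; apply: emax; apply/hasP; exists m'].
have e0 : e != 0%N.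
  by rewrite -lt0n (leq_trans _ (emax m0 (sub _ _ hm0))) // lt0n.
(* The monomial [me], at index [0] through the term [x_i2] of [h], gives [v <= u]. Then [m'], at
   index [m0 i1], gives [m0 i1 <= m' i1]. *)
have claim m' l : m' \in msupp (\prod_j autp g j ^+ m0 j) -> l \notin B -> m' l != 0%N ->
    m' i1 != 0%N.
  move=> hm' lB ml.
  have [|t [t0 ht]] := @common_nonroot k n _ [:: true; false] (fun b =>
      if b then upper_coeff i1 h g i2 0 me else upper_coeff i1 h g i2 (m0 i1) m').
    move=> [] _; last exact: upper_coeff_neq0.
    have -> : 0%N = U_(i2)%MM i1 by rewrite mnm1E (negPf i21).
    by apply: upper_coeff_neq0; rewrite ?prod_mnm1.
  have [d hd] := diag_exists t0.
  have Mf : M (h ^ d)%g by exact: Mn hd Mh.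
  have [u [v bounds]] := scaling_bounds Mg Mn i21 i2B hB hN Mf Mg' emax.
  have me0 : me i1 != 0%N by rewrite ee.
  have [|b1 _] := bounds me i1 0%N i1B me0.
    rewrite (coef_upper_part_conj _ _ _ _ _ _ t0 hd) mulf_neq0 ?invr_neq0 //.
    exact: (ht true (mem_head _ _)).
  have [|_ b2] := bounds m' l (m0 i1) lB ml.
    rewrite (coef_upper_part_conj _ _ _ _ _ _ t0 hd) mulf_neq0 ?invr_neq0 //.
    by apply: (ht false); rewrite !inE.
  move: b1 b2 m0i; rewrite ee; move: (m' i1) (m0 i1) => x y; clear; lia.
have kg j : kill i1 (autp g j) != 0.
  apply: (@autp_kill_neq0 _ _ g i1 i2); first by rewrite eq_sym.
    by move=> j'; rewrite -mcoeff_msupp; apply: sub; rewrite mcoeff_msupp.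
  by apply/dependsP; exists u0; first exact: sub.
have kh j : kill i1 (autp h j) != 0.
  by apply: (@autp_kill_neq0 _ _ h i1 i2); first by rewrite eq_sym.
have sg : supported B (kill i1 (autp g i1)).
  apply: (@supported_factor _ _ B m0 (fun j => kill i1 (autp g j))) => //.
  rewrite -kill_prod; apply/supportedP => m; rewrite msupp_kill => /andP[hm /eqP mi] l lB.
  by apply/eqP/negPn/negP => ml; have := claim m l hm lB ml; rewrite mi.
have sh : supported B (kill i1 (autp h i2)).
  apply: (@supported_factor _ _ B u0 (fun j => kill i1 (autp h j))) => //.
  rewrite -kill_prod; apply/supportedP => m; rewrite msupp_kill => /andP[hm mi].
  have /supportedP := sg; apply; rewrite msupp_kill mi andbT.
  exact: hg hu0 hm.
have /supportedP/(_ U_(i2)%MM) := sh; rewrite msupp_kill hU' mnm1E (negPf i21) => /(_ isT i2 i2B).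
by rewrite mnm1E eqxx.
Qed.

Lemma edge_derived M j i : is_subgroup M -> edge (derived M) j i -> edge M j i.
Proof. by move=> Mg; apply: edge_sub; exact: derived_sub. Qed.

Lemma no_two_cycles (m : nat) M : connected_group M -> torus_normal M ->
  iter m (@derived (aut X)) M `<=` [set 1%g] ->
  forall i j, i != j -> edge M i j -> ~ edge M j i.
Proof.
elim: m M => [|m IH] M Mc Mn /= hm i j ij.
  move=> [f /hm -> ]; rewrite autp1 => /dependsP[m]; rewrite msuppX inE => /eqP->.
  by rewrite mnm1E [j == i]eq_sym (negPf ij).
have Mg := Mc.1.
have Nc := connected_derived Mc; have Nn := torus_normal_derived Mn; have Ng := Nc.1.
have {}IH := IH (derived M) Nc Nn; rewrite -iterSr iterS in IH; have {}IH := IH hm.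
move=> eij eji.
pose V : pred 'I_n := fun i => `[< exists j, [/\ i != j, edge M i j & edge M j i] >].
have Vi : V i by apply/asboolP; exists j.
pose prec i := [set l | (l != i) && `[< edge (derived M) l i >]]%SET.
have [i2 /asboolP[i1 [i12 e21 e12]] imin] := arg_minnP (fun i => #|prec i|) Vi.
have precP l i' : reflect (l != i' /\ edge (derived M) l i') (l \in prec i').
  by rewrite inE; apply: (iffP andP) => -[-> /asboolP].
pose B := [set l | [&& l != i2, `[< edge M l i2 >] & ~~ `[< edge M i2 l >]]]%SET.
have BP l : reflect [/\ l != i2, edge M l i2 & ~ edge M i2 l] (l \in B).
  rewrite inE; apply: (iffP and3P) => -[-> /asboolP h /asboolPn h']; split=> //; exact/asboolP.
have i2B : i2 \notin B by apply/BP => -[]; rewrite eqxx.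
have hB h b : M h -> b \in B -> supported B (autp h b).
  move=> Mh /BP[bi2 eb neb]; apply/forallP => l; apply/implyP; apply: contraNN => dl.
  have elb : edge M l b by exists h.
  apply/BP; split.
  - by apply: contra_not_neq neb => <-.
  - exact: (edge_trans Mg Mn elb eb).
  - by move=> e2l; apply: neb; exact: (edge_trans Mg Mn e2l elb).
(* A predecessor [l] of [i2] for the derived group outside [B] would lie on a two-cycle of [M] with
   [i2]. Its own derived predecessors are among those of [i2] and omit [l], against the minimal
   choice of [i2]. *)
have hi2 h : derived M h -> supported (i2 |: B) (autp h i2).
  move=> Nh; apply/forallP => l; apply/implyP; apply: contraNN => dl; rewrite !inE.
  have [//|li2 /=] := eqVneq l i2.
  have eN : edge (derived M) l i2 by exists h.
  have eM := edge_derived Mg eN.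
  apply/andP; split; first exact/asboolP.
  apply/asboolPn => e2l.
  have Vl : V l by apply/asboolP; exists i2.
  have := imin l Vl; rewrite leqNgt => /negP; apply; apply: proper_card.
  apply/properP; split; last by exists l; [exact/precP|apply/precP => -[]; rewrite eqxx].
  apply/fintype.subsetP => l' /precP[l'l el']; apply/precP; split; last exact: (edge_trans Ng Nn el' eN).
  apply/eqP => E; rewrite E in l'l el'.
  by apply: (IH _ _ l'l el').
have i1B : i1 \notin B by apply/BP => -[_ _]; apply.
apply: (@no_two_cycle M B i1 i2 Mc Mn _ i1B i2B hB _ e12 e21) => //.
move=> h Nh; apply: (@triangular_coordinate k n (derived M) i2 B Ng i2B) => //.
by move=> f b Nf bB; apply: hB => //; exact: derived_sub Nf.
Qed.

End TwoCycles.

(** * Triangular form *)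

Section Jonquieres.
Variables (k : closedFieldType) (n : nat).
Local Notation X := (affine_space k n).
Local Notation pt := {ffun 'I_n -> k}.
Implicit Types (i j l : 'I_n) (M : set (aut X)).

Lemma meval_supported (Q : {set 'I_n}) (r : {mpoly k[n]}) (v w : 'I_n -> k) :
  supported Q r -> (forall i, i \in Q -> v i = w i) -> r.@[v] = r.@[w].
Proof.
move=> /supportedP hr E; rewrite !mevalE !big_seq; apply: eq_bigr => m hm.
congr (_ * _); apply: eq_bigr => i _.
have [/E -> //|/(hr m hm i) ->] := boolP (i \in Q); by rewrite !expr0.
Qed.

Lemma rank_sort (rank : 'I_n -> nat) : exists sigma tau : 'I_n -> 'I_n,
  [/\ cancel sigma tau, cancel tau sigma &
      forall i j, (rank i < rank j)%N -> (tau i < tau j)%N].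
Proof.
pose leT := relpre rank leq; pose s := sort leT (enum 'I_n).
have ss : size s = n by rewrite size_sort size_enum_ord.
have us : uniq s by rewrite sort_uniq enum_uniq.
have ins i : i \in s by rewrite mem_sort mem_enum.
have lt_index i : (index i s < n)%N by rewrite -[X in (_ < X)%N]ss index_mem.
exists (fun a => nth a s a), (fun i => Ordinal (lt_index i)); split.
- by move=> a; apply: val_inj; rewrite /= index_uniq ?ss.
- by move=> i; rewrite /= (set_nth_default i) ?nth_index ?ss.
move=> i j lt; rewrite /= ltnNge; apply/negP => le.
have sorted_s : sorted leT s by apply: sort_sorted => x y; exact: leq_total.
have trT : transitive leT by move=> x y z; exact: leq_trans.
have rT : reflexive leT by move=> x; exact: leqnn.
have := sorted_leq_nth trT rT i sorted_s.
move=> /(_ (index j s) (index i s)); rewrite !inE !index_mem !ins => /(_ isT isT le).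
by rewrite !nth_index // /leT /= leqNgt lt.
Qed.

Lemma permutation_exists (sigma tau : 'I_n -> 'I_n) : cancel sigma tau -> cancel tau sigma ->
  exists g : aut X, (forall (y : pt) i, (g y : pt) i = y (tau i)) /\
    forall (x : pt) a, (g^-1%g x : pt) a = x (sigma a).
Proof.
move=> st ts; have [||g gE] := @aut_of_polys k n (fun i => 'X_(tau i)) (fun i => 'X_(sigma i)).
- by move=> i; rewrite compmXU ts.
- by move=> i; rewrite compmXU st.
have gy (y : pt) i : (g y : pt) i = y (tau i) by rewrite autpE gE mevalXU.
exists g; split=> // x a.
have -> : x = g (g^-1%g x) by rewrite -[g _]/((g * g^-1)%g x) mulgV.
rewrite gy st; congr (fun_of_fin _ a).
by rewrite -[g (g^-1%g x)]/((g * g^-1)%g x) mulgV.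
Qed.

Lemma triangularizable M (m : nat) : connected_group M -> torus_normal M ->
  iter m (@derived (aut X)) M `<=` [set 1%g] ->
  exists g, conj_set g M `<=` @Jonq k n.
Proof.
move=> Mc Mn hm; have Mg := Mc.1.
have no2 := no_two_cycles Mc Mn hm.
pose Q i := [set l | (l != i) && `[< edge M l i >]]%SET.
have QP l i : reflect (l != i /\ edge M l i) (l \in Q i).
  by rewrite inE; apply: (iffP andP) => -[-> /asboolP].
have Qtrans l j i : l \in Q j -> j \in Q i -> l \in Q i.
  move=> /QP[lj el] /QP[ji ej]; apply/QP; split; last exact: (edge_trans Mg Mn el ej).
  by apply/eqP => E; rewrite E in lj el; exact: (no2 _ _ lj el ej).
have tri f i : M f -> exists (c : k) r, [/\ c != 0, supported (Q i) r & autp f i = c *: 'X_i + r].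
  move=> Mf; apply: (@triangular_coordinate k n M i (Q i) Mg) => //.
  - by rewrite inE eqxx.
  - move=> h j Mh jQ; apply/forallP => l; apply/implyP; apply: contraNN => dl.
    have [->//|lj] := eqVneq l j.
    by apply: (Qtrans l j i) => //; apply/QP; split=> //; exists h.
  - move=> h Mh; apply/forallP => l; apply/implyP; apply: contraNN => dl.
    by rewrite !inE; case: eqVneq => //= li; apply/asboolP; exists h.
(* If [l] is in [Q i], then [Q l] is a proper subset of [Q i], so the cardinal of [Q i] orders the
   variables compatibly with the relation. *)
have [sigma [tau [st ts rk]]] := rank_sort (fun i => #|Q i|).
have Qtau l i : l \in Q i -> (tau l < tau i)%N.
  move=> lQ; apply: rk; apply: proper_card; apply/properP; split.
    by apply/fintype.subsetP => x /Qtrans; apply.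
  by exists l => //; rewrite inE eqxx.
have [g [gE gVE]] := permutation_exists st ts.
exists g => _ [f Mf <-].
have /choice[c /choice[r hcr]] : forall i, exists c r, [/\ c != 0, supported (Q i) r & autp f i = c *: 'X_i + r].
  by move=> i; exact: tri.
(* The default [0] is for variables placed at [a] or later, which do not occur in [r (sigma a)]. *)
pose sub (a : 'I_n) (i : 'I_n) : {mpoly k[a]} :=
  if insub (tau i : nat) is Some j then 'X_j else 0.
exists (fun a => c (sigma a)), (fun a => compm (sub a) (r (sigma a))).
split=> [a|x a]; first by have [] := hcr (sigma a).
have [_ sr E] := hcr (sigma a).
rewrite -[_ x]/(g^-1%g (f (g x))) gVE autpE E mevalD mevalZ mevalXU gE st.
congr (_ + _); rewrite compmE; apply: (meval_supported sr) => i /Qtau.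
rewrite st => lt; rewrite gE /sub insubT mevalXU; congr (x _).
exact: val_inj.
Qed.

End Jonquieres.

(** * Diagonalization of an n-dimensional torus *)

Section Characters.
Variables (k : closedFieldType) (n : nat).
Local Notation G := (Gm k n).
Implicit Types (e : 'rV[int]_n) (a b : G).

Definition chi e a : k := \prod_i Gm_coord a i ^ e 0 i.

Lemma chiD e e' a : chi (e + e') a = chi e a * chi e' a.
Proof.
by rewrite /chi -big_split; apply: eq_bigr => i _; rewrite mxE expfzDr // Gm_coord_neq0.
Qed.

Lemma chi0 a : chi 0 a = 1.
Proof. by rewrite /chi big1 // => i _; rewrite mxE expr0z. Qed.

Lemma chiM e a b : chi e (Gm_mul a b) = chi e a * chi e b.
Proof.
rewrite /chi -big_split; apply: eq_bigr => i _.
by rewrite /= -expfzMl; congr (_ ^ _); rewrite /Gm_coord /= ffunE.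
Qed.

Lemma Gm_coord_to (x : {ffun 'I_n -> k}) (h : forall i, x i != 0) : Gm_coord (to_Gm h) = x.
Proof. by []. Qed.

(** The exponents of a character after multiplication by the [N]-th power of all coordinates; once
    [N] bounds them, [absz] is a mere cast. *)
Definition shift_mnm e (N : nat) : 'X_{1..n} := [multinom absz (e 0%R i + N%:Z)%R | i < n].

Lemma chi_shift e (N : nat) a : (forall i, absz (e 0%R i) <= N)%N ->
  (\prod_j Gm_coord a j) ^+ N * chi e a = ('X_[shift_mnm e N] : {mpoly k[n]}).@[Gm_coord a].
Proof.
move=> hN; rewrite mevalX -prodrXl -big_split; apply: eq_bigr => i _ /=.
rewrite mnmE !exprnP -expfzDr ?Gm_coord_neq0 //; congr (_ ^ _).
by have := hN i; move: (e 0 i) => z; clear; lia.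
Qed.

Lemma shift_mnm_inj e e' (N : nat) : (forall i, absz (e 0%R i) <= N)%N ->
  (forall i, absz (e' 0%R i) <= N)%N -> shift_mnm e N = shift_mnm e' N -> e = e'.
Proof.
move=> h h' /mnmP E; apply/rowP => i; have := E i; rewrite !mnmE.
by have := h i; have := h' i; move: (e 0 i) (e' 0 i) => z z'; clear; lia.
Qed.

(** Independence of characters, with polynomial coefficients and possible repetitions: after
    clearing denominators, distinct characters become distinct monomials. *)
Lemma chi_indep (l : seq ('rV[int]_n * {mpoly k[n]})) :
  (forall a, \sum_(c <- l) chi c.1 a *: c.2 = 0) ->
  forall e, \sum_(c <- l | c.1 == e) c.2 = 0.
Proof.
move=> S0 e; pose sz e := (\sum_i absz (e 0%R i))%N.
pose N := (\sum_(c <- l) sz c.1 + sz e)%N.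
have szE e' i : (absz (e' 0%R i) <= sz e')%N by rewrite /sz (bigD1 i) //= leq_addr.
have hNe i : (absz (e 0%R i) <= N)%N by rewrite (leq_trans (szE _ _)) ?leq_addl.
have hNl c i : c \in l -> (absz (c.1 0%R i) <= N)%N.
  by move=> cl; rewrite (leq_trans (szE _ _)) // (leq_trans _ (leq_addr _ _)) // (big_rem c cl) /= leq_addr.
apply/mpolyP => m; rewrite mcoeff0 raddf_sum /=.
pose Q : {mpoly k[n]} := \sum_(c <- l) c.2@_m *: 'X_[shift_mnm c.1 N].
have Q0 : Q = 0.
  apply: (@meval_inj_dense _ _ (\prod_i 'X_i)).
    by apply/prodf_neq0 => i _; rewrite -(msize_poly_eq0 'X_i) msizeX.
  move=> v; rewrite rmorph_prod /= => /prodf_neq0 hv.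
  have v0 i : v i != 0 by have := hv i isT; rewrite mevalXU.
  have := congr1 (mcoeff m) (S0 (to_Gm v0)); rewrite mcoeff0 raddf_sum /= => E.
  rewrite meval0 raddf_sum /=.
  transitivity ((\prod_j v j) ^+ N * \sum_(c <- l) (chi c.1 (to_Gm v0) *: c.2)@_m); last by rewrite E mulr0.
  rewrite big_distrr /= big_seq [RHS]big_seq; apply: eq_bigr => c cl.
  rewrite mevalZ mcoeffZ -(chi_shift (to_Gm v0)); last by move=> i; exact: hNl.
  by rewrite mulrC mulrA.
have := congr1 (mcoeff (shift_mnm e N)) Q0; rewrite mcoeff0 raddf_sum /= => E.
rewrite -[RHS]E [LHS]big_mkcond /= big_seq [RHS]big_seq; apply: eq_bigr => c cl.
rewrite mcoeffZ mcoeffX; case: (eqVneq c.1 e) => [->|ne]; first by rewrite eqxx mulr1.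
case: eqP => [E'|]; last by rewrite mulr0.
by case/eqP: ne; apply: shift_mnm_inj E' => // i; exact: hNl.
Qed.

End Characters.

(** * Weight vectors of a torus action *)

Section Weights.
Variables (k : closedFieldType) (n : nat).
Local Notation X := (affine_space k n).
Local Notation pt := {ffun 'I_n -> k}.
Local Notation G := (Gm k n).
Variable phi : G -> aut X.
Implicit Types (e : 'rV[int]_n) (a b : G) (p q : {mpoly k[n]}) (l : seq ('rV[int]_n * {mpoly k[n]})).

Definition torus_action : Prop :=
  [/\ aut_family phi, forall a b, phi (Gm_mul a b) = (phi a * phi b)%g & injective phi].

Hypothesis act : torus_action.

Definition Gm_one : G := @to_Gm k n [ffun=> 1]
  (fun i => eq_ind_r (fun x => x != 0) (oner_neq0 k) (ffunE (fun=> 1) i)).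

Lemma Gm_one_coord i : Gm_coord Gm_one i = 1.
Proof. by rewrite /Gm_coord /= ffunE. Qed.

Lemma chi_one e : chi e Gm_one = 1.
Proof. by rewrite /chi big1 // => i _; rewrite Gm_one_coord exp1rz. Qed.

Lemma phi_one : phi Gm_one = 1%g.
Proof.
have [_ hM _] := act; apply: (mulgI (phi Gm_one)); rewrite mulg1 -hM; congr phi.
apply: val_inj; apply/ffunP => i; rewrite -[RHS]/(Gm_coord Gm_one i).
transitivity (Gm_coord Gm_one i * Gm_coord Gm_one i); first by rewrite /= ffunE.
by rewrite Gm_one_coord mulr1.
Qed.

Definition weight_vector e p : Prop :=
  forall a, compm (autp (phi a)) p = chi e a *: p.

Lemma weight_vectorM e e' p q : weight_vector e p -> weight_vector e' q ->
  weight_vector (e + e') (p * q).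
Proof.
move=> hp hq a; rewrite compmM hp hq chiD -scalerAr -scalerAl scalerA.
by rewrite mulrC.
Qed.

Lemma weight_vectorZ e c p : weight_vector e p -> weight_vector e (c *: p).
Proof. by move=> hp a; rewrite compmZ hp !scalerA mulrC. Qed.

Lemma weight_vectorC c : weight_vector 0 c%:MP.
Proof. by move=> a; rewrite compmC chi0 scale1r. Qed.

Lemma weight_vectorX e p (m : nat) : weight_vector e p -> weight_vector (e *+ m) (p ^+ m).
Proof.
move=> hp; elim: m => [|m IH]; first by rewrite mulr0n expr0 -mpolyC1; exact: weight_vectorC.
by rewrite mulrS exprS; exact: weight_vectorM.
Qed.

Lemma weight_vector_prod (I : Type) (r : seq I) (e : I -> 'rV[int]_n) (F : I -> {mpoly k[n]}) :
  (forall i, weight_vector (e i) (F i)) ->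
  weight_vector (\sum_(i <- r) e i) (\prod_(i <- r) F i).
Proof.
move=> h; elim: r => [|i r IH]; first by rewrite !big_nil -mpolyC1; exact: weight_vectorC.
by rewrite !big_cons; exact: weight_vectorM.
Qed.

Definition weight_list l := forall c, c \in l -> weight_vector c.1 c.2.

Lemma weight_component l e p : weight_list l -> weight_vector e p ->
  p = \sum_(c <- l) c.2 -> p = \sum_(c <- l | c.1 == e) c.2.
Proof.
move=> hl hp E; have := @chi_indep k n ((e, - p) :: l) _ e.
rewrite big_cons eqxx /= addrC => H; apply/esym/eqP; rewrite -subr_eq0; apply/eqP/H.
move=> a; rewrite big_cons /= scalerN -hp {1}E compm_sum addrC; apply/eqP; rewrite subr_eq0.
apply/eqP; rewrite big_seq [RHS]big_seq; apply: eq_bigr => c cl.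
by rewrite hl.
Qed.

Lemma phi_laurent : exists (d N : nat) (P : 'I_n -> 'X_{1..n < d.+1} -> {mpoly k[n]}),
  forall i a, autp (phi a) i = \sum_(m : 'X_{1..n < d.+1})
    ((P i m).@[Gm_coord a] / (\prod_j Gm_coord a j) ^+ N) *: 'X_[m].
Proof.
have [fam _ _] := act.
have hF := polynomial_family_of_variety (@Gm_irreducible k n) fam.
have [FA _ _] := kreg_irreducible (@Gm_irreducible k n).
have [[d hd] _] := hF.
have /choice[NP hNP] : forall im : 'I_n * 'X_{1..n < d.+1}, exists NP : nat * {mpoly k[n]},
    forall a, (autp (phi a) im.1)@_(im.2 : 'X_{1..n < d.+1}) * (\prod_j Gm_coord a j) ^+ NP.1 = NP.2.@[Gm_coord a].
  move=> [i m]; have [N [p h]] := Gm_reg_laurent (family_coef i m FA hF).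
  by exists (N, p).
pose N := (\sum_im (NP im).1)%N.
exists d, N, (fun i m => (NP (i, m)).2 * (\prod_j 'X_j) ^+ (N - (NP (i, m)).1)) => i a.
rewrite {1}(mpolywE (hd a i)); apply: eq_bigr => m _; congr (_ *: _).
set D := \prod_j Gm_coord a j.
have D0 : D != 0 by apply/prodf_neq0 => j _; exact: Gm_coord_neq0.
apply: (mulIf (expf_neq0 N D0)); rewrite divfK ?expf_neq0 //.
have le : ((NP (i, m)).1 <= N)%N by rewrite /N (bigD1 (i, m)) //= leq_addr.
rewrite -{1}(subnKC le) exprD mulrA (hNP (i, m)) mevalM rmorphXn rmorph_prod /=.
by congr (_ * _ ^+ _); apply: eq_bigr => j _; rewrite mevalXU.
Qed.

(** Expand the image of [x_i] under [phi a] in characters of [a], with coefficients [y u]. Comparing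
    characters of [a] in the image under [phi (Gm_mul a b)] shows that each [y u] is a weight
    vector, and [a = 1] recovers [x_i]. *)
Lemma coordinate_decomposition i : exists2 l, weight_list l & 'X_i = \sum_(c <- l) c.2.
Proof.
have [_ hM _] := act; have [d [N [P HP]]] := phi_laurent.
pose D := (\sum_(m : 'X_{1..n < d.+1}) msize (P i m))%N.
pose J := 'X_{1..n < D}.
pose ex (u : J) : 'rV[int]_n := \row_j ((u j)%:Z - N%:Z).
pose y (u : J) : {mpoly k[n]} := \sum_(m : 'X_{1..n < d.+1}) (P i m)@_u *: 'X_[m].
have exE (u : J) a : chi (ex u) a = ('X_[u] : {mpoly k[n]}).@[Gm_coord a] / (\prod_j Gm_coord a j) ^+ N.
  rewrite /chi mevalX -prodrXl -prodfV -big_split; apply: eq_bigr => j _ /=.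
  by rewrite mxE expfzDr ?Gm_coord_neq0 // -invr_expz.
have E a : autp (phi a) i = \sum_(u : J) chi (ex u) a *: y u.
  rewrite HP; under [RHS]eq_bigr do rewrite scaler_sumr.
  rewrite exchange_big /=; apply: eq_bigr => m _.
  have hs : (msize (P i m) <= D)%N by rewrite /D (bigD1 m) //= leq_addr.
  rewrite {1}(mpolywE hs) raddf_sum big_distrl scaler_suml /=; apply: eq_bigr => u _.
  by rewrite scalerA exE mevalZ; congr (_ *: _); rewrite -mulrA mulrC.
have ex_inj : injective ex.
  move=> u u' /rowP e; apply: val_inj; apply/mnmP => j; have := e j; rewrite !mxE.
  by move=> /addIr[].
have wy u : weight_vector (ex u) (y u).
  move=> b; apply/esym/eqP; rewrite -subr_eq0; apply/eqP.
  have := @chi_indep k n [seq (ex u, chi (ex u) b *: y u - compm (autp (phi b)) (y u)) | u : J] _ (ex u).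
  rewrite big_map big_enum_cond /= (bigD1 u) //= big1 ?addr0; last first.
    by move=> u' /andP[/eqP/ex_inj -> /eqP].
  apply=> a; rewrite big_map big_enum /=.
  under eq_bigr do rewrite scalerBr scalerA -chiM.
  rewrite sumrB -E hM autpM E compm_sum; apply/eqP; rewrite subr_eq0; apply/eqP.
  by apply: eq_bigr => u' _; rewrite compmZ.
exists [seq (ex u, y u) | u : J].
  by move=> c /mapP[u _ ->]; exact: wy.
rewrite big_map big_enum /= -[LHS]/((fun j => 'X_j) i) -autp1 -phi_one E.
by apply: eq_bigr => u _; rewrite chi_one scale1r.
Qed.

End Weights.

Lemma exprz_trivial (k : closedFieldType) (z : int) :
  (forall s : k, s != 0 -> s ^ z = 1) -> z = 0.
Proof.
move=> h; apply/eqP/negPn/negP => z0; pose m := absz z.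
have m0 : (0 < m)%N by rewrite /m absz_gt0.
have hm (s : k) : s != 0 -> s ^+ m = 1.
  move=> s0; have := h s s0; rewrite /m; case: (z) => p //= e.
  by move: e; rewrite NegzE -invr_expz => /(congr1 (fun x => x^-1)); rewrite invrK invr1.
have [s] : exists s : k, ~~ root (('X^m - 1%:P) * 'X) s.
  apply/closed_nonrootP; rewrite mulf_neq0 ?polyX_eq0 //.
  by rewrite -size_poly_eq0 size_XnsubC.
rewrite rootM negb_or !rootE hornerX => /andP[+ s0].
by rewrite !hornerE hm // subrr eqxx.
Qed.

(* A binary form over [k] is a product of linear factors. *)
Lemma binary_form_vanish (k : closedFieldType) (n E : nat) (u v : {mpoly k[n]}) (c : 'I_E -> k) i0 :
  v != 0 -> c i0 != 0 -> \sum_(i < E) c i *: (u ^+ i * v ^+ (E.-1 - i)) = 0 ->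
  exists z, u = z *: v.
Proof.
move=> v0 ci0 S0; pose C : {poly k} := \sum_(i < E) c i *: 'X^i.
have C0 : C != 0.
  apply: contraNneq ci0 => C0; have := congr1 (fun p : {poly k} => p`_i0) C0.
  rewrite /= coef0 coef_sum (bigD1 i0) //= coefZ coefXn eqxx mulr1 big1 ?addr0 => [-> //|i ne].
  rewrite coefZ coefXn; case: eqP => [e|]; last by rewrite mulr0.
  by case/eqP: ne; apply: val_inj.
have [rs CE] := closed_field_poly_normal C.
suff : \prod_(z <- rs) (u - z *: v) = 0.
  move/eqP; rewrite prodf_seq_eq0 => /hasP[z _ /=]; rewrite subr_eq0 => /eqP ->.
  by exists z.
apply: (@meval_inj_dense _ _ v) => // x vx; rewrite meval0.
have : C.[u.@[x] / v.@[x]] = 0.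
  apply: (mulIf (expf_neq0 E.-1 vx)); rewrite mul0r -[RHS](meval0 (x : 'I_n -> k)) -S0 raddf_sum /=.
  rewrite horner_sum big_distrl /=; apply: eq_bigr => i _.
  rewrite mevalZ mevalM !rmorphXn /= hornerZ hornerXn -mulrA; congr (_ * _).
  have le : (i <= E.-1)%N by rewrite -ltnS prednK // (leq_ltn_trans _ (ltn_ord i)).
  by rewrite -{1}(subnKC le) exprD mulrA -exprMn divfK.
rewrite CE hornerZ horner_prod => /eqP; rewrite mulf_eq0 lead_coef_eq0 (negPf C0) /=.
rewrite prodf_seq_eq0 => /hasP[z zrs /=]; rewrite hornerXsubC subr_eq0 => /eqP e.
rewrite rmorph_prod /=; apply/eqP; rewrite prodf_seq_eq0; apply/hasP; exists z => //=.
by rewrite mevalB mevalZ -e divfK // subrr.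
Qed.

Lemma mpoly_alg_ind (k : fieldType) (n : nat) (P : {mpoly k[n]} -> Prop) :
  (forall c, P c%:MP) -> (forall i, P 'X_i) -> (forall p q, P p -> P q -> P (p + q)) ->
  (forall p q, P p -> P q -> P (p * q)) -> forall p, P p.
Proof.
move=> PC PX PD PM p; rewrite (mpolyE p).
apply: (big_ind P) => [|//|m _]; first by rewrite -mpolyC0.
rewrite -mul_mpolyC; apply: (PM) => //; rewrite mpolyXE_id.
apply: (big_ind P) => [|//|i _]; first by rewrite -mpolyC1.
by elim: (m i) => [|j IH]; [rewrite expr0 -mpolyC1|rewrite exprS; exact: PM].
Qed.

Lemma row_det_inj (n : nat) (w : 'I_n -> 'rV[int]_n) (m m' : 'I_n -> nat) :
  \det (\matrix_(s, j) w s 0 j) != 0 ->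
  \sum_s w s *+ m s = \sum_s w s *+ m' s -> forall s, m s = m' s.
Proof.
move=> d0; set W := \matrix_(s, j) _ in d0.
have E (x : 'I_n -> nat) : \sum_s w s *+ x s = (\row_s (x s)%:Z) *m W.
  apply/rowP => j; rewrite summxE mxE; apply: eq_bigr => s _.
  by rewrite !mxE mulmxnE -mulr_natl -natz mulrC.
rewrite !E => /(congr1 (fun A => A *m \adj W)); rewrite -!mulmxA mul_mx_adj !mul_mx_scalar.
move=> /rowP e s; have := e s; rewrite !mxE => /(mulfI d0).
by case.
Qed.

(** * One-dimensional weight spaces and the pointed weight monoid *)

Section MultiplicityFree.
Variables (k : closedFieldType) (n : nat).
Local Notation X := (affine_space k n).
Local Notation pt := {ffun 'I_n -> k}.
Local Notation G := (Gm k n).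
Variable phi : G -> aut X.
Hypothesis act : torus_action phi.
Local Notation wv := (weight_vector phi).
Local Notation wvec := ('rV[int]_n * {mpoly k[n]})%type.
Implicit Types (e : 'rV[int]_n) (a b : G) (p q u v h : {mpoly k[n]}) (l : seq wvec).

(** An integer vector orthogonal to all weights defines a one-parameter subgroup acting trivially;
    faithfulness makes it trivial. *)
Lemma weights_span (c : 'I_n -> int) :
  (forall e p, wv e p -> p != 0 -> \sum_j c j * e 0 j = 0) -> forall j, c j = 0.
Proof.
move=> hc j; apply: (@exprz_trivial k) => s s0.
have x0 i : ([ffun i => s ^ c i] : pt) i != 0 by rewrite ffunE expfz_neq0.
have [_ _ inj] := act.
suff -> : s ^ c j = Gm_coord (Gm_one k n) j by rewrite Gm_one_coord.
have <- : Gm_coord (to_Gm x0) j = s ^ c j by rewrite /Gm_coord /= ffunE.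
congr (Gm_coord _ j); apply: inj; rewrite phi_one //; apply: aut_ext => i; rewrite autp1.
have [l hl E] := coordinate_decomposition act i.
rewrite -[LHS](compmXU (autp (phi (to_Gm x0)))) E compm_sum big_seq [RHS]big_seq.
apply: eq_bigr => d dl; rewrite hl //.
have [->|d0] := eqVneq d.2 0; first by rewrite scaler0.
suff -> : chi d.1 (to_Gm x0) = 1 by rewrite scale1r.
rewrite -(expr0z s) -(hc d.1 d.2 (hl d dl) d0) /chi.
rewrite (big_morph (fun z : int => s ^ z) (id1 := 1) (op1 := *%R)) //; last by move=> x y; rewrite expfzDr.
by apply: eq_bigr => i' _; rewrite Gm_coord_to ffunE exprz_exp.
Qed.

Lemma independent_weights : exists w : 'I_n -> wvec,
  (forall s, wv (w s).1 (w s).2 /\ (w s).2 != 0) /\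
  \det (\matrix_(s, j) (w s).1 0 j) != 0.
Proof.
pose W := {c : wvec | wv c.1 c.2 /\ c.2 != 0}.
have [|z dz] := @evaluation_points rat W n (fun j x => ((sval x).1 0 j)%:~R).
  (* [evaluation_points] is applied over [rat]; clearing denominators reduces to the integral
     [weights_span]. *)
  move=> c hc j; pose c' i := numq (c i) * \prod_(i' | i' != i) denq (c i').
  pose D := \prod_i denq (c i).
  have cE i : (c' i)%:~R = c i * D%:~R :> rat.
    rewrite /c' /D [in RHS](bigD1 i) //= !intrM mulrA; congr (_ * _).
    exact: numqE.
  have D0 : D%:~R != 0 :> rat by rewrite intr_eq0; apply/prodf_neq0 => i _; exact: denq_neq0.
  apply: (mulIf D0); rewrite mul0r -cE (weights_span (c := c')) // => e p we p0.
  apply: (@intr_inj rat); rewrite rmorph_sum /=.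
  transitivity ((\sum_i c i * (e 0 i)%:~R) * D%:~R); last first.
    by rewrite (hc (exist _ (e, p) (conj we p0))) mul0r.
  rewrite big_distrl /=; by apply: eq_bigr => i _; rewrite intrM cE mulrAC.
exists (fun s => sval (z s)); split=> [s|]; first exact: (svalP (z s)).
move: dz; rewrite (_ : \matrix_(s, i) _ = map_mx intr (\matrix_(s, j) (sval (z s)).1 0 j)).
  by rewrite det_map_mx intr_eq0.
by apply/matrixP => s i; rewrite !mxE.
Qed.

(* Otherwise [u / v] and [n] weight vectors of independent weights would be
   [n.+1] algebraically independent elements of a field of transcendence degree
   [n]; the contradiction is reached by counting monomials. *)
Lemma multiplicity_free e u v : wv e u -> wv e v -> v != 0 -> exists z, u = z *: v.
Proof.
move=> wu wv' v0; have [w [hw dw]] := independent_weights.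
pose D := (\sum_s msize (w s).2 + msize u + msize v)%N.
(* With this [E] the products [F] outnumber the monomials available to them. The exponents of [u]
   and [v] add up to [E.-1], so the weight of [F c] depends on [c.1] only and, by independence of
   the weights, determines it; a relation thus splits into binary forms in [u] and [v]. *)
pose E := (((n.+1 * D).+1 ^ n).+1)%N.
pose I := ({ffun 'I_n -> 'I_E} * 'I_E)%type.
pose Wm (m : {ffun 'I_n -> 'I_E}) : {mpoly k[n]} := \prod_s (w s).2 ^+ m s.
pose F (c : I) : {mpoly k[n]} := Wm c.1 * (u ^+ c.2 * v ^+ (E.-1 - c.2)).
pose kap (m : {ffun 'I_n -> 'I_E}) : 'rV[int]_n := \sum_s (w s).1 *+ m s + e *+ E.-1.
have wF c : wv (kap c.1) (F c).
  apply: weight_vectorM; first by apply: weight_vector_prod => s; apply: weight_vectorX; case: (hw s).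
  have le : (c.2 <= E.-1)%N by rewrite -ltnS; exact: ltn_ord.
  by rewrite -(subnKC le) mulrnDr subnKC //; apply: weight_vectorM; exact: weight_vectorX.
have [||c [[m1 i1] c0] S0] := @linear_dependence k n ((n.+1 * D).+1 * E) I F.
- move=> [m i]; rewrite /F /=.
  have dw' s : degle D (w s).2.
    by rewrite /degle /D (bigD1 s) //= -!addnA -addnS leq_addr.
  have du : degle D u by rewrite /degle /D -addnA addnCA -addnS leq_addr.
  have dv : degle D v by rewrite /degle /D addnC -addnS leq_addr.
  have h1 := degle_prod (index_enum 'I_n) (fun j => m j : nat) dw'.
  have h2 := degleM (degleXn i du) (degleXn (E.-1 - i) dv).
  apply: leq_trans (degleM h1 h2) _; rewrite -mulnDl -mulnDl.
  have h3 : (\sum_j (m j : nat) <= n * E.-1)%N by exact: sum_ord_le.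
  have le : (i <= E.-1)%N by rewrite -ltnS; exact: ltn_ord.
  rewrite subnKC // mulSn; apply: (@leq_ltn_trans ((n * E.-1 + E.-1) * D)).
    by rewrite leq_mul2r leq_add2r h3 orbT.
  rewrite addnC -mulSn mulnAC /E /=; move: (n.+1 * D)%N => x.
  by move: (x.+1 ^ n)%N => y; clear; nia.
- by rewrite card_prod card_ffun !card_ord expnMn mulnC ltn_pmul2l ?expn_gt0.
have wl : \sum_(c' : I | kap c'.1 == kap m1) c c' *: F c' = 0.
  have := @chi_indep k n [seq (kap c'.1, c c' *: F c') | c' : I] _ (kap m1).
  rewrite big_map big_enum_cond /=; apply=> a; rewrite big_map big_enum /=.
  transitivity (compm (autp (phi a)) (\sum_i c i *: F i)); last by rewrite S0 /compm comp_mpoly0.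
  by rewrite compm_sum; apply: eq_bigr => c' _; rewrite compmZ wF !scalerA mulrC.
have kap_inj m : kap m = kap m1 -> m = m1.
  move=> /addIr E1; apply/ffunP => s; apply: val_inj.
  exact: (row_det_inj dw E1).
have E1 : Wm m1 * \sum_(i < E) c (m1, i) *: (u ^+ i * v ^+ (E.-1 - i)) = 0.
  apply: etrans wl; rewrite big_distrr /=.
  rewrite (reindex (fun i : 'I_E => (m1, i))) /=; last first.
    exists snd => [i //|[m i]] /=; rewrite inE => /eqP/kap_inj /= -> //.
  rewrite [RHS](eq_bigl predT) => [|i]; last by rewrite eqxx.
  by apply: eq_bigr => i _; rewrite /F /= -scalerAr.
apply: (@binary_form_vanish k n E u v (fun i => c (m1, i)) i1 v0 c0).
move/eqP: E1; rewrite mulf_eq0 => /orP[|/eqP //].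
rewrite prodf_seq_eq0 => /hasP[s _ /=]; rewrite expf_eq0 => /andP[_].
by have [_ /negPf ->] := hw s.
Qed.

Lemma weight_unique e e' p : wv e p -> wv e' p -> p != 0 -> e = e'.
Proof.
move=> h h' p0; apply/eqP; apply: contraNT p0 => ne.
have hl : weight_list phi [:: (e', p)] by move=> c; rewrite inE => /eqP->.
rewrite (weight_component hl h); last by rewrite big_seq1.
by rewrite big_cons big_nil /= [e' == e]eq_sym (negPf ne).
Qed.

(** The constant [1] has weight zero, and weight spaces are lines. *)
Lemma weight0_const p : wv 0 p -> exists c, p = c%:MP.
Proof.
move=> h; have [z ->] := @multiplicity_free 0 p 1 h (weight_vectorC phi 1) (oner_neq0 _).
by exists z; rewrite -mul_mpolyC mulr1.
Qed.

(** The product has weight zero, so it is constant, and so are its factors. *)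
Lemma weights_pointed e e' p q : wv e p -> wv e' q -> p != 0 -> q != 0 ->
  e + e' = 0 -> e = 0.
Proof.
move=> hp hq p0 q0 s0; have := weight_vectorM hp hq; rewrite s0 => /weight0_const[c pq].
have : msize p = 1%N.
  have : msize (p * q) = 1%N.
    rewrite pq msizeC; case: eqP => // c0; move: pq; rewrite c0 mpolyC0 => /eqP.
    by rewrite mulf_eq0 (negPf p0) (negPf q0).
  rewrite msizeM //; have : msize p != 0%N by rewrite msize_poly_eq0.
  have : msize q != 0%N by rewrite msize_poly_eq0.
  by move: (msize p) (msize q) => x y; clear; lia.
move/eqP => /msize_poly1P[d _ pd]; apply: (weight_unique hp) => //.
by rewrite pd; exact: weight_vectorC.
Qed.

Definition positive (c : wvec) : Prop := [/\ wv c.1 c.2, c.2 != 0 & c.1 != 0].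

(** This turns out to be the maximal ideal of the fixed point, and [pos_span2] its square. *)
Definition pos_span p : Prop :=
  exists2 l, (forall c, c \in l -> positive c) & p = \sum_(c <- l) c.2.

Definition pos_span2 p : Prop :=
  exists2 l : seq (wvec * wvec), (forall c, c \in l -> positive c.1 /\ positive c.2) &
    p = \sum_(c <- l) c.1.2 * c.2.2.

Lemma pos_span0 : pos_span 0.
Proof. by exists [::]; rewrite ?big_nil. Qed.

Lemma pos_spanD p q : pos_span p -> pos_span q -> pos_span (p + q).
Proof.
move=> [l hl ->] [l' hl' ->]; exists (l ++ l'); last by rewrite big_cat.
by move=> c; rewrite mem_cat => /orP[/hl|/hl'].
Qed.

Lemma positiveZ z (c : wvec) : z != 0 -> positive c -> positive (c.1, z *: c.2).
Proof.
move=> z0 [h1 h2 h3]; split=> //=; first exact: weight_vectorZ.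
by rewrite -mul_mpolyC mulf_neq0 // mpolyC_eq0.
Qed.

Lemma pos_spanZ z p : pos_span p -> pos_span (z *: p).
Proof.
have [->|z0] := eqVneq z 0; first by rewrite scale0r => _; exact: pos_span0.
move=> [l hl ->]; exists [seq (c.1, z *: c.2) | c <- l].
  by move=> _ /mapP[c /hl hc ->]; exact: positiveZ.
by rewrite big_map scaler_sumr.
Qed.

Lemma pos_span20 : pos_span2 0.
Proof. by exists [::]; rewrite ?big_nil. Qed.

Lemma pos_span2D p q : pos_span2 p -> pos_span2 q -> pos_span2 (p + q).
Proof.
move=> [l hl ->] [l' hl' ->]; exists (l ++ l'); last by rewrite big_cat.
by move=> c; rewrite mem_cat => /orP[/hl|/hl'].
Qed.

Lemma pos_span2Z z p : pos_span2 p -> pos_span2 (z *: p).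
Proof.
have [->|z0] := eqVneq z 0; first by rewrite scale0r => _; exact: pos_span20.
move=> [l hl ->]; exists [seq ((c.1.1, z *: c.1.2), c.2) | c <- l].
  by move=> _ /mapP[c /hl[hc hc'] ->]; split=> //; exact: positiveZ.
by rewrite big_map scaler_sumr; apply: eq_bigr => c _; rewrite scalerAl.
Qed.

Lemma pos_spanM p q : pos_span p -> pos_span q -> pos_span2 (p * q).
Proof.
move=> [l hl ->] [l' hl' ->]; exists [seq (c, c') | c <- l, c' <- l'].
  by move=> _ /allpairsP[[c c'] /= [/hl ? /hl' ? ->]].
rewrite big_allpairs_dep big_distrl /=; apply: eq_bigr => c _.
by rewrite big_distrr.
Qed.

Lemma positiveM (c c' : wvec) : positive c -> positive c' ->
  positive (c.1 + c'.1, c.2 * c'.2).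
Proof.
move=> [h1 h2 h3] [h1' h2' h3']; split=> /=.
- exact: weight_vectorM.
- by rewrite mulf_neq0.
- by apply: contraNneq h3 => s0; apply/eqP; exact: (weights_pointed h1 h1').
Qed.

Lemma pos_span2_span p : pos_span2 p -> pos_span p.
Proof.
move=> [l hl ->]; exists [seq (c.1.1 + c.2.1, c.1.2 * c.2.2) | c <- l]; last by rewrite big_map.
by move=> _ /mapP[c /hl[hc hc'] ->]; exact: positiveM.
Qed.

Lemma coordinate_shift i : exists o : k, pos_span ('X_i - o%:MP).
Proof.
have [l hl E] := coordinate_decomposition act i.
have [o oE] : exists o, \sum_(c <- l | c.1 == 0) c.2 = o%:MP.
  apply: weight0_const => a; rewrite compm_sum scaler_sumr big_seq_cond [RHS]big_seq_cond.
  by apply: eq_bigr => c /andP[cl /eqP c0]; rewrite hl // c0.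
exists o, [seq c <- l | (c.1 != 0) && (c.2 != 0)].
  by move=> c; rewrite mem_filter => /andP[/andP[h1 h2] cl]; split=> //; exact: hl.
rewrite E (bigID (fun c : wvec => c.1 == 0)) /= oE addrAC subrr add0r big_filter.
rewrite big_mkcond [RHS]big_mkcond /=; apply: eq_bigr => c _.
by case: (c.1 != 0) => //=; case: eqP.
Qed.

End MultiplicityFree.

(** * Eigencoordinates at the fixed point *)

Section FixedPoint.
Variables (k : closedFieldType) (n : nat).
Local Notation X := (affine_space k n).
Local Notation pt := {ffun 'I_n -> k}.
Local Notation G := (Gm k n).
Variable phi : G -> aut X.
Hypothesis act : torus_action phi.
Local Notation wv := (weight_vector phi).
Local Notation wvec := ('rV[int]_n * {mpoly k[n]})%type.
Implicit Types (e : 'rV[int]_n) (a b : G) (p q u v h : {mpoly k[n]}) (l : seq wvec).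

Section Origin.
Variable o : 'I_n -> k.
Hypothesis oP : forall i, pos_span phi ('X_i - (o i)%:MP).

Lemma pos_span_value p : pos_span phi (p - (p.@[o])%:MP).
Proof.
elim/mpoly_alg_ind: p => [c|i|p q hp hq|p q hp hq].
- by rewrite mevalC subrr; exact: pos_span0.
- by rewrite mevalXU.
- by rewrite mevalD mpolyCD opprD addrACA; exact: pos_spanD.
- have -> : p * q - ((p * q).@[o])%:MP = (p - (p.@[o])%:MP) * (q - (q.@[o])%:MP)
      + ((p.@[o]) *: (q - (q.@[o])%:MP) + (q.@[o]) *: (p - (p.@[o])%:MP)).
    by rewrite mevalM mpolyCM -!mul_mpolyC; ring.
  apply: pos_spanD; first by apply: pos_span2_span => //; exact: pos_spanM.
  by apply: pos_spanD; exact: pos_spanZ.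
Qed.

(** The difference of [c.2] and its value at [o] is a sum of weight vectors of nonzero weight, so
    its weight-zero component, which is minus that value, vanishes. *)
Lemma positive_value (c : wvec) : positive phi c -> c.2.@[o] = 0.
Proof.
move=> [hc c0 e0]; have [l hl E] := pos_span_value c.2.
have w0 : weight_vector phi 0 (- (c.2.@[o])%:MP).
  by rewrite -mpolyCN; exact: weight_vectorC.
have := @weight_component k n phi ((c.1, - c.2) :: l) 0 _ _ w0.
rewrite !big_cons -E /= (negPf e0) => H; apply/eqP; rewrite -(mpolyC_eq0 n) -oppr_eq0.
rewrite H; last by rewrite addKr.
  by rewrite big1_seq // => d /andP[/eqP d0 /hl[_ _]]; rewrite d0 eqxx.
move=> d; rewrite inE => /orP[/eqP -> /=|/hl[] //].
by rewrite -scaleN1r; exact: weight_vectorZ.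
Qed.

Definition translate p := compm (fun i => 'X_i + (o i)%:MP) p.

Lemma translate_expand p :
  p = \sum_(m <- msupp (translate p)) (translate p)@_m *: \prod_i ('X_i - (o i)%:MP) ^+ m i.
Proof.
rewrite -compm_expand /translate compm_comp -[LHS](comp_mpoly_id p).
apply: (@compm_eq _ _ (fun i => 'X_i)) => i _.
by rewrite compmD compmXU compmC subrK.
Qed.

Lemma translate0 p : (translate p)@_0%MM = p.@[o].
Proof.
rewrite /translate compm_expand raddf_sum /= mevalE; apply: eq_bigr => m _.
rewrite mcoeffZ; congr (_ * _); rewrite rmorph_prod /=; apply: eq_bigr => i _.
by rewrite rmorphXn /= mcoeffD mcoeffX mnm1_eq0 add0r mcoeffC eqxx mulr1.
Qed.

Lemma pos_span_monomial (m : 'X_{1..n}) : m != 0%MM ->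
  pos_span phi (\prod_i ('X_i - (o i)%:MP) ^+ m i).
Proof.
move: {2}(mdeg m) (leqnn (mdeg m)) => d; elim: d m => [|d IH] m hd m0.
  by move: hd; rewrite leqn0 mdeg_eq0 (negPf m0).
have [i mi] : exists i, m i != 0%N.
  apply/existsP; apply: contraNT m0 => /existsPn h; apply/eqP/mnmP => i.
  by rewrite mnm0E; apply/eqP/negPn/h.
pose m' := (m - U_(i))%MM; have mE : m = (U_(i) + m')%MM by rewrite addmC submK // lep1mP.
have -> : \prod_i0 ('X_i0 - (o i0)%:MP) ^+ m i0 =
    ('X_i - (o i)%:MP) * \prod_i0 ('X_i0 - (o i0)%:MP : {mpoly k[n]}) ^+ m' i0.
  by rewrite -!compmX mE mpolyXD compmM compmXU.
have [z|m'0] := eqVneq m' 0%MM.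
  by rewrite z big1 ?mulr1 // => j _; rewrite mnm0E expr0.
apply: pos_span2_span => //; apply: pos_spanM => //; apply: IH => //.
by move: hd; rewrite {1}mE mdegD mdeg1.
Qed.

(** Every monomial in the expansion at [o] has degree at least two, so it is some [x_i - o_i] times
    a nonconstant monomial, both in [pos_span]. *)
Lemma second_order p : p.@[o] = 0 -> (forall j, (translate p)@_U_(j) = 0) -> pos_span2 phi p.
Proof.
move=> p0 p1; rewrite (translate_expand p) big_seq.
apply: (big_ind (pos_span2 phi)) => [||m hm]; [exact: pos_span20|exact: pos_span2D|].
apply: pos_span2Z.
have m0 : m != 0%MM.
  by apply: contraTneq hm => ->; rewrite mcoeff_msupp translate0 p0 eqxx.
have [i mi] : exists i, m i != 0%N.
  apply/existsP; apply: contraNT m0 => /existsPn h; apply/eqP/mnmP => i.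
  by rewrite mnm0E; apply/eqP/negPn/h.
pose m' := (m - U_(i))%MM; have mE : m = (U_(i) + m')%MM by rewrite addmC submK // lep1mP.
have -> : \prod_i0 ('X_i0 - (o i0)%:MP) ^+ m i0 =
    ('X_i - (o i)%:MP) * \prod_i0 ('X_i0 - (o i0)%:MP : {mpoly k[n]}) ^+ m' i0.
  by rewrite -!compmX mE mpolyXD compmM compmXU.
apply: pos_spanM => //; apply: pos_span_monomial.
apply: contraTneq hm => z; rewrite mE z addm0 mcoeff_msupp p1 eqxx //.
Qed.

Lemma translateD p q : translate (p + q) = translate p + translate q.
Proof. exact: compmD. Qed.

Lemma translateZ c p : translate (c *: p) = c *: translate p.
Proof. exact: compmZ. Qed.

Lemma translate_sum (I : Type) (r : seq I) (F : I -> {mpoly k[n]}) :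
  translate (\sum_(i <- r) F i) = \sum_(i <- r) translate (F i).
Proof. exact: compm_sum. Qed.

(* The differentials at [o] of the weight vectors span the cotangent space. *)
Lemma cotangent_basis : exists f : 'I_n -> wvec, (forall s, positive phi (f s)) /\
  \det (\matrix_(s, j) (translate (f s).2)@_U_(j)) != 0.
Proof.
pose W := {c : wvec | positive phi c}.
have [|z dz] := @evaluation_points k W n (fun j x => (translate (sval x).2)@_U_(j)).
  move=> c hc i; have [l hl E] := oP i.
  have -> : c i = \sum_j c j * (translate ('X_i - (o i)%:MP))@_U_(j).
    rewrite /translate -mpolyCN compmD compmXU compmC mpolyCN addrK (bigD1 i) //=.
    rewrite mcoeffXU eqxx mulr1 big1 ?addr0 // => j ji.
    by rewrite mcoeffXU eq_sym (negPf ji) mulr0.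
  rewrite E translate_sum; under eq_bigr do rewrite raddf_sum /= big_distrr /=.
  rewrite exchange_big /= big_seq big1 // => d /hl hd.
  exact: (hc (exist _ d hd)).
by exists (fun s => sval (z s)); split=> // s; exact: (svalP (z s)).
Qed.

(** A graded Nakayama argument. Matching differentials writes [h] as a combination of the [f s] plus
    products of two positive weight vectors. The weight space of [h] is a line, so [h] is a multiple
    of a single summand: an [f s], or a product of two nonconstant weight vectors, both of smaller
    degree. *)
Lemma monomial_generation (f : 'I_n -> wvec) : (forall s, positive phi (f s)) ->
  \det (\matrix_(s, j) (translate (f s).2)@_U_(j)) != 0 ->
  forall h e, wv e h -> h != 0 ->
    exists c (m : 'X_{1..n}), h = c *: \prod_s (f s).2 ^+ m s.
Proof.
move=> hf; set L := \matrix_(s, j) _ => dL h.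
have uL : L \in unitmx by rewrite unitmxE unitfE.
move: {2}(msize h) (leqnn (msize h)) => d; elim: d h => [|d IH] h hd e wh h0.
  by move: hd; rewrite leqn0 msize_poly_eq0 (negPf h0).
have [e0|e0] := eqVneq e 0.
  move: wh; rewrite e0 => /(weight0_const act)[c ->]; exists c, 0%MM.
  by rewrite big1 ?alg_mpolyC // => s _; rewrite mnm0E expr0.
pose b := (\row_j (translate h)@_U_(j)) *m invmx L.
pose q := h - \sum_s b 0 s *: (f s).2.
have hv : h.@[o] = 0 by apply: (@positive_value (e, h)).
have q2 : pos_span2 phi q.
  apply: second_order.
    apply/eqP; rewrite mevalB hv sub0r oppr_eq0 raddf_sum /=; apply/eqP/big1 => s _.
    by rewrite mevalZ positive_value ?mulr0.
  move=> j; rewrite /q -scaleN1r translateD translateZ translate_sum mcoeffD mcoeffZ mulN1r.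
  apply/eqP; rewrite subr_eq0; apply/eqP.
  have : b *m L = \row_j (translate h)@_U_(j) by rewrite /b mulmxKV.
  move=> /rowP/(_ j); rewrite !mxE => <-; rewrite raddf_sum /=.
  by apply: eq_bigr => s _; rewrite translateZ mcoeffZ !mxE.
have [l hl qE] := q2.
pose ll : seq wvec := [seq ((f s).1, b 0 s *: (f s).2) | s : 'I_n] ++
   [seq (c.1.1 + c.2.1, c.1.2 * c.2.2) | c <- l].
have hll : weight_list phi ll.
  move=> c; rewrite mem_cat => /orP[/mapP[s _ ->]|/mapP[c' /hl[h1 h2] ->]] /=.
    by apply: weight_vectorZ; case: (hf s).
  by apply: weight_vectorM; [case: h1|case: h2].
have hE : h = \sum_(c <- ll) c.2.
  by rewrite big_cat /= [X in _ + X]big_map -qE big_map big_enum /= /q addrC subrK.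
have := weight_component hll wh hE.
have [/hasP[c cl /andP[/eqP ce c0]] _|/hasPn no E] :=
    boolP (has (fun c : wvec => (c.1 == e) && (c.2 != 0)) ll); last first.
  case/eqP: h0; rewrite E big1_seq // => c /andP[ce cl].
  by have := no c cl; rewrite ce /= negbK => /eqP.
have [z hz] := multiplicity_free act wh (eq_ind _ (fun e => wv e c.2) (hll c cl) _ ce) c0.
move: cl c0 hz; rewrite mem_cat => /orP[/mapP[s _ ->]|/mapP[c' /hl[h1 h2] ->]] /= c0 hz.
  exists (z * b 0 s), U_(s)%MM; rewrite hz scalerA; congr (_ *: _).
  by rewrite -compmX compmXU.
have sm (c1 c2 : wvec) : positive phi c1 -> positive phi c2 -> z != 0 ->
    msize h = msize (c1.2 * c2.2) -> (msize c1.2 <= d)%N.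
  move=> [w1 n1 p1] [w2 n2 p2] z0 sz.
  have s2 : (1 < msize c2.2)%N.
    rewrite ltnNge; apply/negP => /msize1_polyC cc; case/eqP: p2.
    by apply: (weight_unique w2 _ n2); rewrite cc; exact: weight_vectorC.
  by move: hd s2; rewrite sz msizeM //; move: (msize c1.2) (msize c2.2) => x y; clear; lia.
have z0 : z != 0 by apply: contraNneq h0 => z0; rewrite hz z0 scale0r.
have sz : msize h = msize (c'.1.2 * c'.2.2) by rewrite hz msizeZ.
have [c1 [m1 E1]] : exists c (m : 'X_{1..n}), c'.1.2 = c *: \prod_s (f s).2 ^+ m s.
  by case: (h1) => w1 n1 _; apply: (IH _ _ c'.1.1) => //; exact: (sm _ c'.2).
have [c2 [m2 E2]] : exists c (m : 'X_{1..n}), c'.2.2 = c *: \prod_s (f s).2 ^+ m s.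
  by case: (h2) => w2 n2 _; apply: (IH _ _ c'.2.1) => //; apply: (sm _ c'.1) => //; rewrite mulrC.
exists (z * (c1 * c2)), (m1 + m2)%MM; rewrite hz E1 E2 -scalerAl -scalerAr !scalerA mulrA.
congr (_ *: _); rewrite -big_split; apply: eq_bigr => s _ /=.
by rewrite mnmDE exprD.
Qed.

End Origin.

(** Each [x_i] is a sum of weight vectors, hence a polynomial in the [f s]. Monomials in the [f s]
    have distinct weights, hence are independent. So the [f s] are coordinates. *)
Lemma torus_coordinates : exists (f : 'I_n -> wvec) (g : aut X),
  [/\ forall s, wv (f s).1 (f s).2, autp g = fun s => (f s).2 &
      \det (\matrix_(s, j) (f s).1 0 j) != 0].
Proof.
have [o oP] := choice (coordinate_shift act).
have [f [hf dL]] := cotangent_basis oP.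
have gen := monomial_generation oP hf dL.
have hw s : wv (f s).1 (f s).2 by case: (hf s).
pose F s := (f s).2.
have span i : exists g, compm F g = 'X_i.
  have [l hl ->] := coordinate_decomposition act i.
  elim: l hl => [|c l IH] hl; first by exists 0; rewrite big_nil /compm comp_mpoly0.
  have [|g gE] := IH; first by move=> d dl; apply: hl; rewrite inE dl orbT.
  have [g' g'E] : exists g', compm F g' = c.2.
    have [->|c0] := eqVneq c.2 0; first by exists 0; rewrite /compm comp_mpoly0.
    have [z [m E]] := gen _ _ (hl c (mem_head _ _)) c0.
    by exists (z *: 'X_[m]); rewrite compmZ compmX.
  by exists (g' + g); rewrite compmD big_cons gE g'E.
have [g gE] := choice span.
(* The weights of the [f s] generate all weights, among which there are [n] independent ones. *)
have dE : \det (\matrix_(s, j) (f s).1 0 j) != 0.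
  have [w [hwv dw]] := independent_weights act.
  have /choice[M hM] : forall s, exists m : 'X_{1..n}, (w s).1 = \sum_j (f j).1 *+ m j.
    move=> s; have [w1 w0] := hwv s; have [c [m E]] := gen _ _ w1 w0.
    exists m; apply: (weight_unique w1 _ w0); rewrite E; apply: weight_vectorZ.
    by apply: weight_vector_prod => j; exact: weight_vectorX.
  apply: contraNneq dw => d0.
  have -> : \matrix_(s, j) (w s).1 0 j = (\matrix_(s, j) ((M s : 'X_{1..n}) j)%:Z) *m \matrix_(s, j) (f s).1 0 j.
    apply/matrixP => s j; rewrite !mxE hM summxE; apply: eq_bigr => s' _.
    by rewrite !mxE mulmxnE -mulr_natl -natz.
  by rewrite det_mulmx d0 mulr0.
have inj p : compm F p = 0 -> p = 0.
  move=> p0; apply/mpolyP => m; rewrite mcoeff0.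
  have [hm|/memN_msupp_eq0 //] := boolP (m \in msupp p).
  have := @chi_indep k n [seq (\sum_j (f j).1 *+ (m' : 'X_{1..n}) j, p@_m' *: \prod_j F j ^+ m' j) | m' <- msupp p] _
    (\sum_j (f j).1 *+ m j).
  rewrite big_map big_mkcond (bigD1_seq m) ?msupp_uniq //= eqxx [X in _ + X]big1 ?addr0; last first.
    move=> m' ne; case: eqP => // e'; case/eqP: ne; apply/mnmP => s.
    exact: (row_det_inj dE e').
  move=> H; apply/eqP; have /eqP : p@_m *: \prod_j F j ^+ m j = 0.
    apply: H => a; rewrite big_map /=.
    transitivity (compm (autp (phi a)) (compm F p)); last by rewrite p0 /compm comp_mpoly0.
    rewrite (compm_expand F) compm_sum; apply: eq_bigr => m' _; rewrite compmZ.
    rewrite (_ : compm _ _ = chi (\sum_j (f j).1 *+ m' j) a *: \prod_j F j ^+ m' j).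
      by rewrite !scalerA mulrC.
    by apply: weight_vector_prod => j; apply: weight_vectorX.
  rewrite -mul_mpolyC mulf_eq0 mpolyC_eq0 => /orP[//|].
  rewrite prodf_seq_eq0 => /hasP[s _ /=]; rewrite expf_eq0 => /andP[_ /eqP Fs].
  by have [_ /eqP] := hf s.
have gF i : compm g (F i) = 'X_i.
  apply/eqP; rewrite -subr_eq0; apply/eqP/inj.
  rewrite /compm comp_mpolyB -/(compm F _) -/(compm F 'X_i) compm_comp compmXU.
  rewrite (_ : (fun j => compm F (g j)) = fun j => 'X_j); last exact/funext.
  by rewrite [compm _ _]comp_mpoly_id subrr.
have [//|//|h hE] := @aut_of_polys k n F g.
by exists f, h.
Qed.

Lemma root_exprz (z : int) (t : k) : z != 0 -> t != 0 -> exists2 r, r != 0 & r ^ z = t.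
Proof.
move=> z0 t0; pose m := absz z; have m0 : (0 < m)%N by rewrite /m absz_gt0.
have key (x : k) : x != 0 -> exists2 r, r != 0 & r ^+ m = x.
  move=> x0; have [r] : exists r, root ('X^m - x%:P) r.
    by apply/closed_rootP; rewrite size_XnsubC // eqSS -lt0n.
  rewrite rootE !hornerE subr_eq0 => /eqP E; exists r => //.
  by apply: contraNneq x0 => r0; rewrite -E r0 expf_eq0 m0 eqxx.
have t0' : t^-1 != 0 by rewrite invr_eq0.
have [r r0 E] := key t t0; have [r' r0' E'] := key _ t0'.
move: E E'; rewrite /m; case: (z) => p /= E E'; first by exists r.
by exists r' => //; rewrite NegzE -invr_expz -[t]invrK -E'.
Qed.

(** Cramer's rule written multiplicatively: solve [r j ^ det W = t j], then combine the [r j] with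
    the exponents of the adjugate of [W]. *)
Lemma chi_surjective (w : 'I_n -> 'rV[int]_n) (t : 'I_n -> k) :
  \det (\matrix_(s, j) w s 0 j) != 0 -> (forall i, t i != 0) ->
  exists a : G, forall s, chi (w s) a = t s.
Proof.
set W := \matrix_(s, j) _ => d0 t0.
have /choice[r hr] : forall j, exists r : k, r != 0 /\ r ^ (\det W) = t j.
  by move=> j; have [r r0 E] := root_exprz d0 (t0 j); exists r.
have x0 i : ([ffun i => \prod_j r j ^ (\adj W) i j] : pt) i != 0.
  by rewrite ffunE; apply/prodf_neq0 => j _; rewrite expfz_neq0 //; case: (hr j).
exists (to_Gm x0) => s; rewrite /chi Gm_coord_to.
have powz (x : k) (I : Type) (rI : seq I) (F : I -> int) : x != 0 ->
    \prod_(i <- rI) x ^ F i = x ^ (\sum_(i <- rI) F i).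
  move=> xn; elim: rI => [|i rI IH]; first by rewrite !big_nil expr0z.
  by rewrite !big_cons IH expfzDr.
have prodz (z : int) (F : 'I_n -> k) : (\prod_j F j) ^ z = \prod_j F j ^ z.
  by rewrite (big_morph (fun x : k => x ^ z) (id1 := 1) (op1 := *%R)) ?exp1rz // => x y; rewrite expfzMl.
under eq_bigr do rewrite ffunE prodz.
rewrite exchange_big /=.
have E j : \prod_i (r j ^ (\adj W) i j) ^ w s 0 i = if j == s then t j else 1.
  have [r0 rE] := hr j; under eq_bigr do rewrite exprz_exp; rewrite powz //.
  have -> : \sum_i (\adj W) i j * w s 0 i = (W *m \adj W) s j.
    by rewrite mxE; apply: eq_bigr => i _; rewrite mulrC [W s i]mxE.
  rewrite mul_mx_adj !mxE [s == j]eq_sym; case: eqP => _; first by rewrite mulr1n.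
  by rewrite mulr0n expr0z.
by under eq_bigr do rewrite E; rewrite -big_mkcond big_pred1_eq.
Qed.

Lemma torus_diagonalizable : exists g : aut X, forall t d,
  (forall i, t i != 0) -> diag_by t d -> exists a, (phi a ^ g)%g = d.
Proof.
have [f [h [hw hE dE]]] := torus_coordinates.
exists h^-1%g => t d t0 hd; have [a ha] := chi_surjective dE t0; exists a.
apply: aut_ext => i; rewrite (diagonal_autp hd) /conjg invgK autpM.
rewrite hE -[in RHS](ha i).
have -> : autp (phi a * h^-1)%g = fun j => compm (autp h^-1%g) (autp (phi a) j) by rewrite autpM.
rewrite -compm_comp hw compmZ; congr (_ *: _).
have <- : autp h i = (f i).2 by rewrite hE.
exact: autpV'.
Qed.

End FixedPoint.

Theorem theorem6p25 (k : closedFieldType) (n : nat)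
    (H T : set (aut (affine_space k n)))
    (Hconnected : connected_subgroup H)
    (Hsolvable : solvable_subgroup H)
    (Ttorus : is_torus n T)
    (TH : T `<=` H) :
  exists g : aut (affine_space k n),
    [set (h ^ g)%g | h in H] `<=` @Jonq k n.
Proof.
have [phi [fam phiM inj TE]] := Ttorus.
have [g gP] := torus_diagonalizable (And3 fam phiM inj).
have Mc := connected_conj g (connected_subgroup_group Hconnected).
(* The conjugate of [H] contains all diagonal automorphisms, so they normalize it. *)
have Mn : torus_normal (conj_set g H).
  move=> t d f t0 hd Mf; have [a <-] := gP t d t0 hd.
  have /is_subgroupP[_ MM MV] := Mc.1.
  have Md : conj_set g H (phi a ^ g)%g by exists (phi a) => //; apply: TH; rewrite TE; exists a.
  by rewrite {2}/conjg; apply: (MM); [exact: MV|exact: MM].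
have [_ [m Hm]] := Hsolvable.
have Ms : iter m (@derived (aut (affine_space k n))) (conj_set g H) `<=` [set 1%g].
  apply: subset_trans (@iter_derived_conj _ m g H) _; rewrite Hm.
  by move=> _ [_ -> <-]; rewrite conj1g.
have [g' hg'] := triangularizable Mc Mn Ms.
exists (g * g')%g => _ [h Hh <-]; rewrite conjgM.
by apply: hg'; exists (h ^ g)%g => //; exists h.
Qed.
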